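(* Let $\alpha>0$, $p\ge 0$, $\beta>0$, $C\ge 1$, let $\tau_n>0$ satisfy $n\tau_n^2\to\infty$, let $\lambda_i=\tau_n^2 i^{-1-2\alpha}$ and $C^{-1}i^{-p}\le\kappa_i\le C i^{-p}$ for all $i\in\mathbb N$, and let $\gamma\in(0,1)$. Set $\tilde\beta=\beta\wedge(1+2\alpha+2p)$. The asymptotic coverage (the limit as $n\to\infty$ of the coverage $\mathrm P_{\mu_0}(\mu_0\in AY+B(r_{n,\gamma}))$) of the credible ball $AY+B(r_{n,\gamma})$ is: (i) $1$, uniformly in $\mu_0$ with $\|\mu_0\|_\beta\le 1$, if $\tau_n\gg n^{(\alpha-\tilde\beta)/(1+2\tilde\beta+2p)}$; in this case $\tilde r_{n,\gamma}\asymp r_{n,\gamma}$. (ii) $1$, for every fixed $\mu_0\in S^\beta$, if $\beta<1+2\alpha+2p$ and $\tau_n\asymp n^{(\alpha-\tilde\beta)/(1+2\tilde\beta+2p)}$; and, for any $c\in[0,1)$, it is $c$ along some sequence $\mu_0^n$ with $\sup_n\|\mu_0^n\|_\beta<\infty$, if $\tau_n\asymp n^{(\alpha-\tilde\beta)/(1+2\tilde\beta+2p)}$. (iii) $0$, along some sequence $\mu_0^n$ with $\sup_n\|\mu_0^n\|_\beta<\infty$, if $\tau_n\ll n^{(\alpha-\tilde\beta)/(1+2\tilde\beta+2p)}$. If $\tau_n\equiv 1$, then the cases (i), (ii) and (iii) arise if $\alpha<\beta$, $\alpha=\beta$ and $\alpha>\beta$, respectively. In case (iii) (with $\tau_n\equiv1$)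 the sequence $\mu_0^n$ can then be chosen fixed, i.e. equal to one element $\mu_0\in S^\beta$ for all $n$.
   Context: Setting. $H_1,H_2$ are separable Hilbert spaces with norms $\|\cdot\|_1,\|\cdot\|_2$ and inner products $\langle\cdot,\cdot\rangle_1,\langle\cdot,\cdot\rangle_2$; $K:H_1\to H_2$ is a known injective continuous linear operator with adjoint $K^T$. For $\mu\in H_1$ one observes $Y=K\mu+n^{-1/2}Z$, $Z$ the iso-Gaussian process of $H_2$; this means that $Y=(Y_h:h\in H_2)$ is a Gaussian process with $\mathrm E Y_h=\langle K\mu,h\rangle_2$ and $\mathrm{cov}(Y_h,Y_{h'})=n^{-1}\langle h,h'\rangle_2$. $\mathrm P_{\mu_0}$ is the probability when $\mu=\mu_0$; ''coverage along a sequence $\mu_0^n$'' means that for each $n$ the coverage is computed with $\mu_0$ replaced by $\mu_0^n$. For a continuous linear $B:H_2\to H_1$, $BY$ is the process $(BY)_h=Y_{B^Th}$, $h\in H_1$, identified with a random element of $H_1$ when such an element exists with $\langle BY,h\rangle_1=(BY)_h$. Prior and posterior. The prior on $\mu$ is the Gaussian distribution $N(0,\Lambda)$ on $H_1$. The operators $K^TK$ and $\Lambda$ have the same eigenfunctions $(e_i)_{i\in\mathbb N}$, an orthonormal basis of $H_1$, with eigenvalues $(\kappa_i^2)$ and $(\lambda_i)$, respectively ($\kappa_i>0$); the prior may depend on $n$ through $\tau_n$. The posterior $\Pi_n(\cdot\,|\,Y)$ is $N(AY,S_n)$ with $A=\Lambda K^T(n^{-1}I+K\Lambda K^T)^{-1}$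 and $S_n=\Lambda-A(n^{-1}I+K\Lambda K^T)A^T$. In coordinates $\mu=\sum_i\mu_ie_i$, with $Ke_i=\kappa_if_i$ and $Y_i=Y_{f_i}$, under the posterior the $\mu_i$ are independent $N\big(n\lambda_i\kappa_iY_i/(1+n\lambda_i\kappa_i^2),\ \lambda_i/(1+n\lambda_i\kappa_i^2)\big)$. Credible ball. $AY+B(r)=\{\mu\in H_1:\|\mu-AY\|_1<r\}$. The (nonrandom) radius $r_{n,\gamma}$ is determined by $\Pi_n(AY+B(r_{n,\gamma})\,|\,Y)=1-\gamma$. The radius $\tilde r_{n,\gamma}$ (of the correct frequentist confidence ball) is determined by $\mathrm P_{\mu_0}(\mu_0\in AY+B(\tilde r_{n,\gamma}))=1-\gamma$. Sobolev space. For $\mu=\sum_i\mu_ie_i$, $\|\mu\|_\beta^2=\sum_i\mu_i^2i^{2\beta}$ and $S^\beta=\{\mu\in H_1:\|\mu\|_\beta<\infty\}$. Notation. $a\wedge b=\min(a,b)$; $a_n\asymp b_n$ means $|a_n/b_n|$ is bounded away from $0$ and $\infty$ as $n\to\infty$; $a_n\ll b_n$, equivalently $b_n\gg a_n$, means $a_n/b_n\to0$. *)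

(* Defs.v *)
From HB Require Import structures.
From mathcomp Require Export all_boot all_order all_algebra sesquilinear.
From mathcomp Require Export all_classical all_reals all_analysis.
Export Order.TTheory GRing.Theory Num.Theory.
Export numFieldNormedType.Exports.

Set Implicit Arguments.
Unset Strict Implicit.
Unset Printing Implicit Defensive.

#[export] Set Implicit Arguments.
#[export] Unset Strict Implicit.
#[export] Unset Printing Implicit Defensive.

Local Open Scope classical_set_scope.
Local Open Scope ring_scope.

Section hilbert.
Context {R : realType}.

(* A real Hilbert space is a [completeNormedModType R] together with a positive
   definite symmetric bilinear form [ip : {dot H for idfun}] inducing its norm. *)
Definition induces_norm (H : normedModType R) (ip : {dot H for idfun}) : Prop :=
  forall x : H, ip x x = `|x| ^+ 2.

Definition separable (T : topologicalType) : Prop :=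
  exists2 D : set T, countable D & dense D.

Definition orthonormal_basis (H : normedModType R) (ip : {dot H for idfun})
    (e : nat -> H) : Prop :=
  (forall i j, ip (e i) (e j) = (i == j)%:R) /\
  (forall x, series (fun i => ip x (e i) *: e i) @ \oo --> x).

Definition is_adjoint (H H' : normedModType R)
    (ip : {dot H for idfun}) (ip' : {dot H' for idfun})
    (B : H -> H') (BT : H' -> H) : Prop :=
  forall x y, ip' (B x) y = ip x (BT y).

(* Coordinates are numbered from 0 here, so that [e i] is the (i+1)-st basis
   vector and carries the weight (i+1)^(2 beta). *)
Definition sobolev_norm (H : normedModType R) (ip : {dot H for idfun})
    (e : nat -> H) (beta : R) (mu : H) : \bar R :=
  sqrte (\sum_(0 <= i <oo)
    (ip mu (e i) ^+ 2 * i.+1%:R `^ (2 * beta))%:E)%E.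

Definition borel (T : ptopologicalType) := g_sigma_algebraType (@open T).

End hilbert.

Section gaussian.
Context {R : realType}.

(* The normal distribution with mean [m] and variance [v >= 0].  The library's
   [normal_prob m s] takes the standard deviation and is a uniform law at
   [s = 0], hence the separate degenerate case. *)
Definition normal_law (m v : R) (A : set R) : \bar R :=
  if v == 0 then \d_m A else normal_prob m (Num.sqrt v) A.

Definition has_normal_law d (T : measurableType d) (P : probability T R)
    (X : T -> R) (m v : R) : Prop :=
  forall A : set R, measurable A -> P (X @^-1` A) = normal_law m v A.

Definition gaussian_process d (T : measurableType d) (P : probability T R)
    (I : Type) (Y : I -> T -> R) (mean : I -> R) (cov : I -> I -> R) : Prop :=
  [/\ forall h, measurable_fun [set: T] (Y h),
      forall (k : nat) (h : 'I_k -> I) (a : 'I_k -> R),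
        exists m v, 0 <= v /\
          has_normal_law P (fun w => \sum_(j < k) a j * Y (h j) w) m v,
      forall h, ('E_P[Y h] = (mean h)%:E)%E
    & forall h h', covariance P (Y h) (Y h') = (cov h h')%:E].

(* [Q] is N(m, S) on the Hilbert space [H]: the law of <x, h> under [Q] is
   N(<m, h>, <S h, h>) for every [h]. *)
Definition gaussian_measure (H : normedModType R) (ip : {dot H for idfun})
    (Q : probability (borel H) R) (m : H) (S : H -> H) : Prop :=
  forall h : H, has_normal_law Q (fun x : H => ip x h) (ip m h) (ip (S h) h).

(* [X] is a random element of [H] with <X, h> = W_h almost surely, for each
   [h]; the exceptional set may depend on [h]. *)
Definition represents d (T : measurableType d) (P : probability T R)
    (H : normedModType R) (ip : {dot H for idfun})
    (W : H -> T -> R) (X : T -> H) : Prop :=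
  measurable_fun [set: T] (X : T -> borel H) /\
  forall h, {ae P, forall w, ip (X w) h = W h w}.

End gaussian.

Section posterior.
Context {R : realType} {H1 H2 : normedModType R}.
Variables (K : H1 -> H2) (KT : H2 -> H1) (Lam : H1 -> H1) (n : nat).

Definition marginal_op (y : H2) : H2 := n%:R^-1 *: y + K (Lam (KT y)).

(* [marginal_op] is a bijection of [H2] in the intended setting, so [pinv] is its
   genuine inverse. *)
Definition posterior_mean_op (y : H2) : H1 :=
  Lam (KT (pinv [set: H2] marginal_op y)).

(* [AT] stands for the adjoint of [posterior_mean_op]. *)
Definition posterior_cov_op (AT : H1 -> H2) (h : H1) : H1 :=
  Lam h - posterior_mean_op (marginal_op (AT h)).

End posterior.

Section asymptotics.
Context {R : realType}.

Definition same_order (a b : nat -> R) : Prop :=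
  exists c C : R, 0 < c /\ \forall n \near \oo, c <= `|a n / b n| <= C.

Definition much_smaller (a b : nat -> R) : Prop :=
  (fun n => a n / b n) @ \oo --> (0 : R).

End asymptotics.

(* Main.v *)
Require Import Defs.
From mathcomp Require Import measurable_realfun ring lra.
Local Open Scope classical_set_scope.
Local Open Scope ring_scope.

(** Everything is diagonal in the basis [e].  Write x_i = n lambda_i kappa_i^2
for the signal-to-noise ratio in coordinate i.  The posterior is a product of
normal laws with variances s_i = lambda_i / (1 + x_i); its centre AY has, under
mu, independent normal coordinates with variances t_i = s_i x_i / (1 + x_i)
and bias - mu_i / (1 + x_i).  Hence AY - mu = X + b with X centred Gaussian and
b deterministic, and the true mu is covered exactly when |X + b| < r.

Put q = 1 + 2 alpha + 2 p.  The ratios x_i compare with (M / i)^q where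
M = (n tau^2)^(1/q) is an effective dimension, and with R0 = tau^2 M^(-2 alpha)
the sums of the s_i, of the t_i and of the differences s_i - t_i are all of
order R0 ([sum_post_var_ub], [sum_mean_var_lb], [sum_gap_lb]), whereas the sum
of the s_i^2 is of the smaller order R0^2 / M ([sum_post_var_sqr_ub]).  By
Chebyshev ([gauss_seq_chebyshev]) the squared radius r^2 and |X|^2 concentrate
around sum s_i and sum t_i with errors that are small multiples of R0.  As the
posterior spread exceeds the spread of AY by a multiple of R0, coverage tends
to 1 as soon as |b|^2 is below a small multiple of R0 ([coverage_ge]), and to 0
as soon as |b|^2 is above a large multiple of R0 ([coverage_le]).

It remains to compare |b|^2 with R0.  On a ball of the Sobolev space the bias
has |b|^2 of order at most M^(-2 betat), which is attained along one basis
vector, and M^(-2 betat) = R0 rho, where rho is a positive power of rate / tau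
([eff_dim_rate]).  So rho tends to 0, stays bounded away from 0 and infinity,
or diverges, in the three cases.  When rho is bounded and beta < q, a fixed mu
still has |b|^2 = o(R0): finitely many coordinates contribute M^(-2 q), and the
remaining ones carry a small part of the Sobolev norm
([sobolev_bias_head_tail]).  To reach a prescribed level c in the balanced
case, let the size of a signal along one basis vector grow from 0, where
coverage is near 1, to a value where it is near 0: coverage is continuous in
that size ([coverage_continuous]), so the intermediate value theorem applies.

That continuity has to be read off from the one-dimensional projections of the
Gaussian laws, which determine the joint characteristic function.  The identity
exp (- c y^2) = E cos (sqrt (2 c) y g), with g standard normal, turns it into
the Laplace transform of the sum of squares, which determines the tail
probabilities ([same_tail]).  The law of |X + b|^2 therefore is the one obtained
by replacing the shifted coordinate by an independent normal variable, and its
dependence on the shift is that of a normal density on its mean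
([shift_continuous]). *)

(** * Integrals against normal laws *)

Section normal.
Context {R : realType}.
Implicit Types (m s : R).
Local Notation mu := (@lebesgue_measure R).

Lemma ge0_integral_normal_prob m s (f : R -> \bar R) :
  measurable_fun [set: R] f -> (forall x, (0 <= f x)%E) ->
  (\int[normal_prob m s]_x f x = \int[mu]_x (f x * (normal_pdf m s x)%:E))%E.
Proof.
move=> mf f0.
have dom := normal_prob_dominates m s.
rewrite -(Radon_Nikodym_SigmaFinite.change_of_variables dom f0)//.
apply: ae_eq_integral => //.
- apply: emeasurable_funM => //; apply: (measurable_int mu).
  exact: Radon_Nikodym_SigmaFinite.f_integrable.
- apply: emeasurable_funM => //; apply/measurable_EFinP.
  exact: measurable_normal_pdf.
apply: ae_eqe_mul2l => /=.
apply: integral_ae_eq => //=.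
- exact: Radon_Nikodym_SigmaFinite.f_integrable.
- by apply/measurable_EFinP; exact: measurable_normal_pdf.
- by move=> E ET mE; rewrite -Radon_Nikodym_SigmaFinite.f_integral.
Qed.

Lemma integrable_normal_prob m s (f : R -> R) : measurable_fun [set: R] f ->
  mu.-integrable setT (fun x => (f x * normal_pdf m s x)%:E) ->
  (normal_prob m s).-integrable setT (EFin \o f).
Proof.
move=> mf /integrableP[_ fi]; apply/integrableP; split.
  exact/measurable_EFinP.
rewrite ge0_integral_normal_prob//; last first.
  by apply: measurableT_comp => //; exact/measurable_EFinP.
move: fi; congr (_ < _)%E; apply: eq_integral => x _.
by rewrite -EFinM /= normrM (ger0_norm (normal_pdf_ge0 _ _ _)).
Qed.

(** Signed integrands cannot be handled through [ge0_integral_normal_prob];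
the Radon-Nikodym derivative is identified with the density instead. *)
Lemma integral_normal_prob m s (f : R -> R) :
  (normal_prob m s).-integrable setT (EFin \o f) ->
  mu.-integrable setT (fun x => (f x * normal_pdf m s x)%:E) /\
  (\int[normal_prob m s]_x (f x)%:E =
   \int[mu]_x (f x * normal_pdf m s x)%:E)%E.
Proof.
move=> fi; have mf : measurable_fun setT f.
  by apply/measurable_EFinP; exact: measurable_int fi.
have [mfE fi'] := integrableP _ _ _ fi.
rewrite ge0_integral_normal_prob// in fi'; last first.
  by apply: measurableT_comp => //; exact/measurable_EFinP.
have fw : mu.-integrable setT (fun x => (f x * normal_pdf m s x)%:E).
  apply/integrableP; split.
    by apply/measurable_EFinP/measurable_funM => //; exact: measurable_normal_pdf.
  move: fi'; congr (_ < _)%E; apply: eq_integral => x _.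
  by rewrite -EFinM /= normrM (ger0_norm (normal_pdf_ge0 _ _ _)).
split => //.
have dom := normal_prob_dominates m s.
under [RHS]eq_integral do rewrite EFinM.
rewrite -(Radon_Nikodym_change_of_variables dom)//=.
apply: ae_eq_integral => //.
- exact: emeasurable_funM.
- by apply: emeasurable_funM => //; apply/measurable_EFinP; exact: measurable_normal_pdf.
apply: ae_eqe_mul2l => /=.
rewrite Radon_NikodymE//=.
case: cid => /= g [g1 g2 g3].
apply: integral_ae_eq => //=.
- by apply/measurable_EFinP; exact: measurable_normal_pdf.
- by move=> E ET mE; rewrite -g3.
Qed.

End normal.

Section growth.
Context {R : realType}.
Implicit Types (m s : R).
Local Notation mu := (@lebesgue_measure R).

(** A polynomial is absorbed by passing to a normal density of doubled
variance, which makes every function of polynomial growth integrable. *)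
Lemma normal_pdf_growth m s : s != 0 -> exists2 K : R, 0 <= K &
  forall z, (1 + (z - m) ^+ 6) * normal_pdf m s z <=
            K * normal_pdf m (Num.sqrt 2 * s) z.
Proof.
move=> s0; have s20 : Num.sqrt 2 * s != 0 by rewrite mulf_neq0// sqrtr_eq0 -ltNge.
have ss : 0 < s ^+ 2 by rewrite exprn_even_gt0.
(* exp y >= 1 + y^3 / 6 at y = (z - m)^2 / (4 s^2) *)
exists ((1 + 6 * (4 * s ^+ 2) ^+ 3) * normal_peak s / normal_peak (Num.sqrt 2 * s)).
  rewrite divr_ge0 ?normal_peak_ge0// mulr_ge0 ?normal_peak_ge0// addr_ge0// mulr_ge0//.
  by rewrite exprn_ge0// mulr_ge0// sqr_ge0.
move=> z; rewrite !normal_pdfE//.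
have p0 : normal_peak (Num.sqrt 2 * s) != 0 by rewrite gt_eqF ?normal_peak_gt0.
rewrite [leRHS](_ : _ = normal_peak s * ((1 + 6 * (4 * s ^+ 2) ^+ 3) *
  normal_fun m (Num.sqrt 2 * s) z)); last by field.
rewrite mulrCA ler_wpM2l ?normal_peak_ge0//.
rewrite /normal_fun.
set u := z - m.
pose y := u ^+ 2 / (4 * s ^+ 2).
have y0 : 0 <= y by rewrite divr_ge0 ?sqr_ge0// mulr_ge0// sqr_ge0.
have -> : - u ^+ 2 / (s ^+ 2 *+ 2) = - y - y by rewrite /y; field.
have -> : - u ^+ 2 / ((Num.sqrt 2 * s) ^+ 2 *+ 2) = - y.
  by rewrite exprMn sqr_sqrtr// /y; field.
rewrite expRD mulrA ler_wpM2r ?expR_ge0//.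
rewrite expRN -ler_pdivlMr ?invr_gt0 ?expR_gt0// invrK.
have := expR_ge1Dxn 2 y0; rewrite (_ : 3`! = 6%N)// => ye.
have e1 : 1 <= expR y by rewrite -[leLHS]expR0 ler_expR.
have -> : u ^+ 6 = (4 * s ^+ 2) ^+ 3 * y ^+ 3 by rewrite /y; field.
have A0 : 0 <= (4 * s ^+ 2) ^+ 3 by rewrite exprn_ge0// mulr_ge0// ltW.
have : (4 * s ^+ 2) ^+ 3 * y ^+ 3 <= (4 * s ^+ 2) ^+ 3 * (6 * expR y).
  rewrite ler_wpM2l//; move: ye; rewrite -lerBrDl ler_pdivrMr// mulrBl => ye.
  by apply: (le_trans ye); lra.
lra.
Qed.

Lemma integrable_growth m s C (f : R -> R) : s != 0 ->
  measurable_fun [set: R] f ->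
  (forall z, `|f z| <= C * (1 + (z - m) ^+ 6)) ->
  (normal_prob m s).-integrable setT (EFin \o f).
Proof.
move=> s0 mf fC; apply: integrable_normal_prob => //.
have [K K0 HK] := normal_pdf_growth m s0.
have C0 : 0 <= C.
  have := fC m; rewrite subrr expr0n addr0 mulr1; exact: le_trans.
apply: (@le_integrable _ _ _ mu _ _ _
  (fun z => (C * K)%:E * (normal_pdf m (Num.sqrt 2 * s) z)%:E)%E) => //.
- by apply/measurable_EFinP/measurable_funM => //; exact: measurable_normal_pdf.
- move=> z _; rewrite -EFinM /= lee_fin !normrM !(ger0_norm (normal_pdf_ge0 _ _ _)).
  rewrite (ger0_norm C0) (ger0_norm K0) -[leRHS]mulrA.
  apply: le_trans (ler_wpM2l C0 (HK z)).
  by rewrite mulrA ler_wpM2r// normal_pdf_ge0.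
- by apply: integrableZl => //; exact: integrable_normal_pdf.
Qed.

(** The fundamental theorem of calculus on [- n, n]; the decay hypothesis on
[G] makes the boundary terms vanish in the limit. *)
Lemma integral_is_derive0 (G g : R -> R) (C : R) :
  (forall x : R, is_derive x 1 G (g x)) -> continuous g ->
  (forall x, `|x| * `|G x| <= C) ->
  mu.-integrable setT (EFin \o g) -> (\int[mu]_x (g x)%:E = 0)%E.
Proof.
move=> dG cg GC ig.
have gi n : mu.-integrable setT (EFin \o (g \_ `[- n.+1%:R, n.+1%:R])).
  by rewrite -restrict_EFin; apply/integrable_restrict; rewrite ?setTI//; exact: integrableS ig.
pose g_ n (x : R) := (g \_ `[- n.+1%:R, n.+1%:R]) x.
have aeg : {ae mu, forall x, [set: R] x -> (fun n => (g_ n x)%:E) @ \oo --> (EFin \o g) x}.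
  apply/aeW => x _; apply: cvg_near_cst; near=> n; rewrite /g_ patchE mem_set//=.
  rewrite in_itv/= -ler_norml; near: n.
  exists (Num.truncn `|x|).+1 => // n /= xn.
  apply/ltW/(lt_le_trans (truncnS_gt _)); rewrite ler_nat ltnW//.
have bg : {ae mu, forall x n, [set: R] x -> (`|(g_ n x)%:E| <= `|(g x)%:E|)%E}.
  apply/aeW => x0 k _; rewrite /g_ patchE; case: ifPn => _ //=.
  by rewrite normr0 lee_fin.
have [_ _ cvgI] := @dominated_convergence _ _ _ mu _ measurableT
  (fun n x => (g_ n x)%:E) (EFin \o g) (fun x => `|(g x)%:E|%E)
  (fun n => measurable_int _ (gi n)) (measurable_int _ ig) aeg (integrable_abse ig) bg.
apply: (cvg_unique _ cvgI) => //.
have E n : (\int[mu]_x (g_ n x)%:E = (G n.+1%:R - G (- n.+1%:R))%:E)%E.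
  rewrite /g_ EFinB -(@continuous_FTC2 _ g G)//.
  - by rewrite [RHS]integral_mkcond; apply: eq_integral => x _; rewrite !patchE; case: ifP.
  - by rewrite -subr_gt0 opprK addr_gt0.
  - by apply: continuous_subspaceT.
  - split.
    + by move=> x _; apply: ex_derive; exact: dG.
    + apply: cvg_at_right_filter; apply: differentiable_continuous.
      by apply/derivable1_diffP; apply: ex_derive; exact: dG.
    + apply: cvg_at_left_filter; apply: differentiable_continuous.
      by apply/derivable1_diffP; apply: ex_derive; exact: dG.
  - by move=> x _; rewrite derive1E; apply: derive_val; exact: dG.
suff : (fun n => (G n.+1%:R - G (- n.+1%:R))%:E) @ \oo --> (0%E : \bar R) by rewrite -(funext E).
apply: cvg_EFin; first exact: nearW.
apply/cvgr0Pnorm_le => e e0; near=> n.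
rewrite /comp /=.
have n0 : 0 < n.+1%:R :> R by [].
have B y : `|y| = n.+1%:R -> `|G y| <= C / n.+1%:R.
  by move=> yn; rewrite ler_pdivlMr// mulrC -yn.
rewrite (le_trans (ler_normB _ _))//.
rewrite (le_trans (lerD (B _ _) (B _ _)))// ?normrN ?ger0_norm//.
rewrite -mulrDl ler_pdivrMr// -ler_pdivrMl//.
near: n; exists (Num.truncn (e^-1 * (C + C))) => // n /= xn.
by apply/ltW/(lt_le_trans (truncnS_gt _)); rewrite ler_nat.
Unshelve. all: end_near. Qed.

End growth.

Section stein.
Context {R : realType}.
Implicit Types (m s : R).
Local Notation mu := (@lebesgue_measure R).

Lemma Rintegral_normal_prob m s (f : R -> R) :
  (normal_prob m s).-integrable setT (EFin \o f) ->
  \int[normal_prob m s]_x f x = \int[mu]_x (f x * normal_pdf m s x).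
Proof. by move=> /integral_normal_prob[_]; rewrite /Rintegral => ->. Qed.

Lemma is_derive_normal_pdf m s (x : R) : s != 0 ->
  is_derive x 1 (normal_pdf m s) (- (x - m) / s ^+ 2 * normal_pdf m s x).
Proof.
move=> s0; rewrite normal_pdfE// /normal_fun.
have -> : - (x - m) / s ^+ 2 * (normal_peak s * expR (- (x - m) ^+ 2 / (s ^+ 2 *+ 2)))
  = normal_peak s * ((- (x - m) / s ^+ 2) * expR (- (x - m) ^+ 2 / (s ^+ 2 *+ 2))).
  by ring.
apply: is_deriveZ.
pose q (y : R) := - (y - m) ^+ 2 / (s ^+ 2 *+ 2).
have dq : is_derive x 1 q (- (x - m) / s ^+ 2).
  rewrite /q.
  have -> : (fun y : R => - (y - m) ^+ 2 / (s ^+ 2 *+ 2)) =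
            (fun y => (- (s ^+ 2 *+ 2)^-1) *: (y - m) ^+ 2).
    by apply/funext => y; rewrite /GRing.scale/= mulNr mulrC mulNr.
  apply: is_derive_eq.
  rewrite /GRing.scale/=; field; exact: s0.
rewrite mulrC; exact: (is_derive1_comp (f := expR) (g := q)).
Qed.

(** Integration by parts, since [(x - m) / s^2] is minus the logarithmic
derivative of the normal density; all moments and the characteristic function
below come from this identity. *)
Lemma stein m s (h h' : R -> R) C : s != 0 ->
  (forall x : R, is_derive x 1 h (h' x)) -> continuous h' ->
  (forall z, `|h z| <= C * (1 + (z - m) ^+ 4)) ->
  (forall z, `|h' z| <= C * (1 + (z - m) ^+ 4)) ->
  \int[normal_prob m s]_x (h x * (x - m)) = s ^+ 2 * \int[normal_prob m s]_x h' x.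
Proof.
move=> s0 dh ch' hC h'C.
have ch : continuous h.
  by move=> x; apply: differentiable_continuous; apply/derivable1_diffP; apply: ex_derive.
have mh : measurable_fun setT h by exact: continuous_measurable_fun.
have mh' : measurable_fun setT h' by exact: continuous_measurable_fun.
have mm : measurable_fun setT (fun x : R => x - m) by exact: measurable_funB.
have C0 : 0 <= C.
  have := hC m; rewrite subrr expr0n addr0 mulr1; exact: le_trans.
have u46 (u : R) : 0 <= u -> 1 + u ^+ 4 <= 2 * (1 + u ^+ 6) /\
    (1 + u) * (1 + u ^+ 4) <= 4 * (1 + u ^+ 6).
  move=> u0; have u4 : u ^+ 4 <= 1 + u ^+ 6.
    have [u1|u1] := lerP u 1.
      by rewrite (@le_trans _ _ 1) ?exprn_ile1// lerDl exprn_ge0.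
    by rewrite (@le_trans _ _ (u ^+ 6)) ?ler_eXn2l// ?lerDr// ltW.
  have u5 : u ^+ 5 <= 1 + u ^+ 6.
    have [u1|u1] := lerP u 1.
      by rewrite (@le_trans _ _ 1) ?exprn_ile1// lerDl exprn_ge0.
    by rewrite (@le_trans _ _ (u ^+ 6)) ?ler_eXn2l// ?lerDr// ltW.
  have u1 : u <= 1 + u ^+ 6.
    have [u1|u1] := lerP u 1.
      by rewrite (@le_trans _ _ 1)// lerDl exprn_ge0.
    by rewrite (@le_trans _ _ (u ^+ 6)) ?ler_eXnr// ?lerDr// ltW.
  have u60 : 0 <= u ^+ 6 by exact: exprn_ge0.
  split; first by lra.
  rewrite (_ : (1 + u) * (1 + u ^+ 4) = 1 + u + u ^+ 4 + u ^+ 5); last by ring.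
  by lra.
have norm_even (u : R) k : `|u| ^+ k.*2 = u ^+ k.*2.
  by rewrite -normrX ger0_norm// exprn_even_ge0// odd_double.
have ih : (normal_prob m s).-integrable setT (EFin \o h').
  apply: (@integrable_growth _ _ _ (2 * C)) => // z; apply: (le_trans (h'C z)).
  rewrite [2 * C]mulrC -mulrA ler_wpM2l//.
  by have [] := u46 `|z - m| (normr_ge0 _); rewrite (norm_even _ 2) (norm_even _ 3).
have ihm : (normal_prob m s).-integrable setT (EFin \o (fun x => h x * (x - m))).
  apply: (@integrable_growth _ _ _ (4 * C)) => //.
    exact: measurable_funM.
  move=> z; rewrite normrM (le_trans (ler_wpM2r _ (hC z)))//.
  rewrite [4 * C]mulrC -!mulrA ler_wpM2l//.
  have [_] := u46 `|z - m| (normr_ge0 _); rewrite (norm_even _ 2) (norm_even _ 3).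
  apply: le_trans; rewrite mulrC ler_wpM2r ?lerDr// addr_ge0//.
  by rewrite -(norm_even _ 2) exprn_ge0.
have [iw' _] := integral_normal_prob ih.
have [iwm _] := integral_normal_prob ihm.
pose G x := h x * normal_pdf m s x.
pose g x := h' x * normal_pdf m s x - s ^- 2 * (h x * (x - m) * normal_pdf m s x).
have dG (x : R) : is_derive x 1 G (g x).
  rewrite /G; have dw := is_derive_normal_pdf m x s0.
  have := is_deriveM (dh x) dw.
  rewrite /GRing.scale/= => H; apply: (is_derive_eq H).
  by rewrite /g; field.
have cw : continuous (normal_pdf m s) by exact: continuous_normal_pdf.
have cg : continuous g.
  move=> x; apply: cvgB; first by apply: cvgM; [exact: ch'|exact: cw].
  apply: cvgM; first exact: cvg_cst.
  apply: cvgM; last exact: cw.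
  apply: cvgM; first exact: ch.
  by apply: cvgB; [exact: cvg_id|exact: cvg_cst].
have ig : mu.-integrable setT (EFin \o g).
  rewrite /comp /g; under eq_fun do rewrite EFinB.
  apply: integrableB => //.
  by under eq_fun do rewrite EFinM; apply: integrableZl.
have [K K0 HK] := normal_pdf_growth m s0.
have s20 : Num.sqrt 2 * s != 0 by rewrite mulf_neq0// sqrtr_eq0 -ltNge.
have GC x : `|x| * `|G x| <= (`|m| + 1) * (4 * C) * (K * normal_peak (Num.sqrt 2 * s)).
  have xb : `|x| <= (`|m| + 1) * (1 + `|x - m|).
    have := ler_normD (x - m) m; rewrite subrK => xm.
    have := mulr_ge0 (normr_ge0 m) (normr_ge0 (x - m)); lra.
  rewrite /G normrM (ger0_norm (normal_pdf_ge0 _ _ _)) mulrA.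
  have [_] := u46 `|x - m| (normr_ge0 _); rewrite (norm_even _ 2) (norm_even _ 3) => u.
  have h4 : 0 <= C * (1 + (x - m) ^+ 4) by exact: le_trans (hC x).
  have : `|x| * `|h x| <= (`|m| + 1) * (4 * C) * (1 + (x - m) ^+ 6).
    apply: (le_trans (ler_pM _ _ xb (hC x))) => //.
    rewrite -!mulrA ler_wpM2l ?addr_ge0//.
    by rewrite [leLHS]mulrCA [leRHS]mulrCA ler_wpM2l.
  move=> hh; apply: (le_trans (ler_wpM2r (normal_pdf_ge0 _ _ _) hh)).
  rewrite -[leLHS]mulrA ler_wpM2l ?mulr_ge0 ?addr_ge0//.
  apply: (le_trans (HK x)); rewrite ler_wpM2l//.
  exact: normal_pdf_ub.
have := integral_is_derive0 dG cg GC ig.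
move=> I0; have : \int[mu]_x g x = 0 by rewrite /Rintegral I0.
rewrite /g RintegralB//; last first.
  by rewrite /comp; under eq_fun do rewrite EFinM; apply: integrableZl.
rewrite RintegralZl// -!Rintegral_normal_prob// => /eqP.
rewrite subr_eq0 => /eqP ->; rewrite mulrA divff ?mul1r//.
by rewrite expf_neq0.
Qed.

End stein.

Section moments.
Context {R : realType}.
Implicit Types (m s : R).

Lemma expr4_growth (u : R) : 1 + u ^+ 4 <= 2 * (1 + u ^+ 6).
Proof.
have := sqr_ge0 (u ^+ 2 - 1); have := sqr_ge0 (u * (u ^+ 2 - 1)).
have := sqr_ge0 u; have := sqr_ge0 (u ^+ 3); nra.
Qed.

Lemma Rintegral_cst_probability d (T : measurableType d) (P : probability T R) (r : R) :
  \int[P]_x r = r.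
Proof.
rewrite Rintegral_cst// -[RHS]mulr1; congr (_ * _).
exact: (congr1 fine (@probability_setT _ _ _ P)).
Qed.

Lemma normal_prob_mean m s : s != 0 -> \int[normal_prob m s]_x (x - m) = 0.
Proof.
move=> s0; have := @stein _ m s (fun=> 1) (fun=> 0) 1 s0.
rewrite Rintegral_cst_probability mulr0 => <- //.
- by apply: eq_Rintegral => x _; rewrite mul1r.
- by move=> x; exact: cvg_cst.
- by move=> z; rewrite normr1 mul1r lerDl exprn_even_ge0.
- by move=> z; rewrite normr0 mul1r addr_ge0// exprn_even_ge0.
Qed.

Lemma abs_growth (u : R) : `|u| <= 1 + u ^+ 4 /\ u ^+ 2 <= 1 + u ^+ 4 /\
  `|u ^+ 3| <= 1 + u ^+ 4.
Proof.
have h2 : `|u| ^+ 2 = u ^+ 2 by rewrite -normrX ger0_norm// sqr_ge0.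
have h4 : `|u| ^+ 4 = u ^+ 4 by rewrite -normrX ger0_norm// exprn_even_ge0.
rewrite -h2 -h4 normrX; set v := `|u|; have v0 : 0 <= v by exact: normr_ge0.
have := sqr_ge0 (v - 1); have := sqr_ge0 (v ^+ 2 - 1).
have := sqr_ge0 (v * (v - 1)) => *.
  by split; [|split]; nra.
Qed.

Lemma normal_prob_var m s : s != 0 ->
  \int[normal_prob m s]_x ((x - m) ^+ 2) = s ^+ 2.
Proof.
move=> s0; have dm (x : R) : is_derive x 1 (fun x => x - m) 1.
  by apply: is_derive_eq; exact: subr0.
have c1 : continuous (fun _ : R => 1 : R) by move=> x; exact: cvg_cst.
have b1 z : `|z - m| <= 1 * (1 + (z - m) ^+ 4).
  by rewrite mul1r; case: (abs_growth (z - m)).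
have b2 z : `|1 : R| <= 1 * (1 + (z - m) ^+ 4).
  by rewrite normr1 mul1r lerDl exprn_even_ge0.
rewrite -[RHS]mulr1 -(Rintegral_cst_probability (normal_prob m s) 1).
rewrite -(stein s0 dm c1 b1 b2).
by apply: eq_Rintegral => x _; rewrite expr2.
Qed.

Lemma normal_prob_fourth m s : s != 0 ->
  \int[normal_prob m s]_x ((x - m) ^+ 4) = 3 * s ^+ 4.
Proof.
move=> s0; have dm (x : R) : is_derive x 1 (fun x => (x - m) ^+ 3) (3 * (x - m) ^+ 2).
  by apply: is_derive_eq; rewrite /GRing.scale/=; ring.
have := @stein _ m s (fun x => (x - m) ^+ 3) (fun x => 3 * (x - m) ^+ 2) 3 s0 dm.
have cm : continuous (fun x : R => x - m).
  by move=> x; apply: cvgB; [exact: cvg_id|exact: cvg_cst].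
rewrite RintegralZl//; last first.
  apply: (@integrable_growth _ _ _ 2) => //.
    by apply: measurable_funX; exact: measurable_funB.
  move=> z; apply: le_trans (expr4_growth _).
  by rewrite ger0_norm ?sqr_ge0//; have [_ []] := abs_growth (z - m).
rewrite normal_prob_var// => h.
transitivity (\int[normal_prob m s]_x ((x - m) ^+ 3 * (x - m))).
  by apply: eq_Rintegral => x _; rewrite -exprSr.
rewrite h//.
- by ring.
- move=> x; apply: cvgM; first exact: cvg_cst.
  by apply: (@continuous_comp _ _ _ (fun x : R => x - m) (fun y => y ^+ 2)); [exact: cm|exact: exprn_continuous].
- move=> z; have [_ [_ h3]] := abs_growth (z - m); apply: (le_trans h3).
  have : 0 <= (z - m) ^+ 4 by exact: exprn_even_ge0.
  lra.
- move=> z; rewrite normrM ger0_norm// ler_wpM2l// ger0_norm ?sqr_ge0//.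
  by have [_ []] := abs_growth (z - m).
Qed.

(** As a function of [a] the left side solves G' = - s^2 a G by [stein], so
G times exp ((s a)^2 / 2) is constant. *)
Lemma normal_prob_cos m s a th : s != 0 ->
  \int[normal_prob m s]_x cos (a * (x - m) + th) =
  cos th * expR (- (s * a) ^+ 2 / 2).
Proof.
move=> s0; pose G (a : R) := \int[normal_prob m s]_x cos (a * (x - m) + th).
have ccos (f : R -> R) : continuous f -> continuous (fun x => cos (f x)).
  by move=> cf x; apply: continuous_comp; [exact: cf|exact: continuous_cos].
have csin (f : R -> R) : continuous f -> continuous (fun x => sin (f x)).
  by move=> cf x; apply: continuous_comp; [exact: cf|exact: continuous_sin].
have clin (b : R) : continuous (fun x : R => b * (x - m) + th).
  move=> x; apply: cvgD; last exact: cvg_cst.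
  apply: cvgM; first exact: cvg_cst.
  by apply: cvgB; [exact: cvg_id|exact: cvg_cst].
have cosb x : `|cos x| <= 1 :> R by rewrite ler_norml cos_geN1 cos_le1.
have sinb x : `|sin x| <= 1 :> R by rewrite ler_norml sin_geN1 sin_le1.
have ge1 (z : R) k : 1 <= 1 + z ^+ k.*2.
  by rewrite lerDl exprn_even_ge0// odd_double.
have icos b : (normal_prob m s).-integrable setT
    (EFin \o (fun x => cos (b * (x - m) + th))).
  apply: (@integrable_growth _ _ _ 1) => //.
    by apply: continuous_measurable_fun; apply: ccos; exact: clin.
  by move=> z; rewrite mul1r (le_trans (cosb _))// (ge1 _ 3).
have dG (b : R) : is_derive b 1 G (- (s ^+ 2 * b * G b)).
  have dcos (x y : R) : is_derive y 1 (fun b : R => cos (b * (x - m) + th))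
      (- (x - m) * sin (y * (x - m) + th)).
    apply: is_derive_eq.
    by rewrite /GRing.scale/= !mulr1 !addr0; ring.
  pose g (x : R) : R := `|x - m|.
  have Ib : `]b - 1, b + 1[%classic b by rewrite /= in_itv/= ltrBlDr ltrDl ltr01.
  have df (b' x : R) : `]b - 1, b + 1[%classic b' -> [set: R] x ->
      derivable (fun b : R => cos (b * (x - m) + th)) b' 1.
    by move=> _ _; apply: ex_derive; exact: dcos.
  have ig : (normal_prob m s).-integrable setT (EFin \o g).
    apply: (@integrable_growth _ _ _ 2) => //.
      by apply: measurableT_comp => //; exact: measurable_funB.
    move=> z; apply: le_trans (expr4_growth _); rewrite /g normr_id.
    by have [] := abs_growth (z - m).
  have gub (b' x : R) : `]b - 1, b + 1[%classic b' -> [set: R] x ->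
      `|partial1of2 (fun b x : R => cos (b * (x - m) + th)) b' x| <= g x.
    move=> _ _; rewrite /partial1of2 derive1E (@derive_val _ _ _ _ _ _ _ (dcos x b')).
    by rewrite normrM normrN ler_piMr.
  have [] := (@derivable_under_integral _ _ _ (normal_prob m s)
    (fun b x : R => cos (b * (x - m) + th)) setT measurableT b _ _ Ib
    (fun b' _ => icos b') df g (fun x => normr_ge0 _) ig gub,
    @differentiation_under_integral _ _ _ (normal_prob m s)
    (fun b x : R => cos (b * (x - m) + th)) setT measurableT b _ _ Ib
    (fun b' _ => icos b') df g (fun x => normr_ge0 _) ig gub).
  move=> dG dGE; apply: DeriveDef; first exact: dG.
  rewrite -derive1E dGE /G.
  have dsin (x : R) : is_derive x 1 (fun x => sin (b * (x - m) + th))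
      (b * cos (b * (x - m) + th)).
    apply: is_derive_eq.
    by rewrite /GRing.scale/=; ring.
  have := @stein _ m s (fun x => sin (b * (x - m) + th))
    (fun x => b * cos (b * (x - m) + th)) (`|b| + 1) s0 dsin.
  rewrite RintegralZl// mulrA => <-.
  - rewrite -[RHS]mulN1r -RintegralZl//.
      apply: eq_Rintegral => x _; rewrite /partial1of2 derive1E.
      rewrite (@derive_val _ _ _ _ _ _ _ (dcos x b)); ring.
    apply: (@integrable_growth _ _ _ 2) => //.
      apply: measurable_funM; last exact: measurable_funB.
      by apply: continuous_measurable_fun; apply: csin; exact: clin.
    move=> z; apply: le_trans (expr4_growth _).
    rewrite normrM; have [h _] := abs_growth (z - m).
    by rewrite (le_trans _ h)// ler_piMl.
  - move=> x; apply: cvgM; first exact: cvg_cst.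
    exact: (ccos _ (clin b)).
  - move=> z; rewrite (le_trans (sinb _))// -[leLHS]mulr1 ler_pM// ?(ge1 _ 2)//.
    by rewrite lerDr.
  - move=> z; rewrite normrM; apply: ler_pM => //; first by rewrite lerDl.
    by rewrite (le_trans (cosb _))// (ge1 _ 2).
pose H b := G b * expR (s ^+ 2 * b ^+ 2 / 2).
have dH (b : R) : is_derive b 1 H 0.
  rewrite /H.
  pose q (b : R) := s ^+ 2 * b ^+ 2 / 2.
  have dq : is_derive b 1 q (s ^+ 2 * b).
    have -> : q = (fun b : R => (s ^+ 2 / 2) *: b ^+ 2).
      by apply/funext => y; rewrite /GRing.scale/= /q; ring.
    by apply: is_derive_eq; rewrite /GRing.scale/=; field.
  have de := is_derive1_comp (is_derive_expR (q b)) dq.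
  have := is_deriveM (dG b) de; rewrite /GRing.scale/= => h.
  by apply: (is_derive_eq h) => /=; rewrite /q; ring.
have := @is_derive_0_is_cst _ H a 0 dH.
rewrite /H expr0n /= mulr0 mul0r expR0 mulr1.
have -> : G 0 = cos th.
  rewrite /G; under eq_Rintegral do rewrite mul0r add0r.
  by rewrite Rintegral_cst_probability.
rewrite -/(G a) => <-; rewrite -[RHS]mulrA -expRD exprMn mulNr addrN expR0.
by rewrite mulr1.
Qed.

End moments.

Section normal_law.
Context {R : realType} d (T : measurableType d) (P : probability T R).
Variables (X : T -> R) (m v : R).
Hypotheses (mX : measurable_fun [set: T] X) (v0 : 0 <= v).
Hypothesis lawX : has_normal_law P X m v.

(** Uniform treatment of the degenerate case [v = 0], where the law is a Dirac
mass. *)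
Lemma integral_normal_law (f : R -> R) C : measurable_fun [set: R] f ->
  (forall z, `|f z| <= C * (1 + (z - m) ^+ 6)) ->
  P.-integrable setT (fun w => (f (X w))%:E) /\
  \int[P]_w f (X w) =
    if v == 0 then f m else \int[normal_prob m (Num.sqrt v)]_x f x.
Proof.
move=> mf fC.
have mfE : measurable_fun [set: R] (EFin \o f) by apply/measurable_EFinP.
have mfX : measurable_fun [set: T] (fun w => (f (X w))%:E).
  by apply/measurable_EFinP; exact: measurableT_comp.
pose X' : T -> measurableTypeR R := X.
have mX' : measurable_fun [set: T] X' by exact: mX.
have push g : measurable_fun [set: R] g -> (forall y, 0 <= g y)%E ->
    (\int[P]_w g (X w) = \int[pushforward P X']_y g y)%E.
  by move=> mg g0; rewrite ge0_integral_pushforward.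
have push' : P.-integrable setT (fun w => (f (X w))%:E) ->
    (\int[P]_w (f (X w))%:E = \int[pushforward P X']_y (f y)%:E)%E.
  by move=> fi; rewrite (integral_pushforward mX').
case: eqVneq (lawX) => [vE|vN]; rewrite /has_normal_law /normal_law.
  rewrite vE eqxx => law.
  have int g : (\int[pushforward P X']_y g y = \int[\d_(m : measurableTypeR R)]_y g y)%E.
    by apply: eq_measure_integral => A mA _; exact: law.
  have fi : P.-integrable setT (fun w => (f (X w))%:E).
    apply/integrableP; split => //.
    rewrite (push (fun y => `|(f y)%:E|%E)) //; last exact: measurableT_comp.
    rewrite int integral_dirac//; last exact: measurableT_comp.
    by rewrite diracT mul1e ltry.
  split => //; rewrite /Rintegral push'// int integral_dirac//.
  by rewrite diracT mul1e.
rewrite (negbTE vN) => law.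
have int g : (\int[pushforward P X']_y g y = \int[normal_prob m (Num.sqrt v)]_y g y)%E.
  by apply: eq_measure_integral => A mA _; exact: law.
have s0 : Num.sqrt v != 0 by rewrite sqrtr_eq0 -ltNge lt_def vN.
have fi' := integrable_growth s0 mf fC.
have fi : P.-integrable setT (fun w => (f (X w))%:E).
  apply/integrableP; split => //.
  rewrite (push (fun y => `|(f y)%:E|%E)) //; last exact: measurableT_comp.
  by rewrite int; case/integrableP : fi'.
by split => //; rewrite /Rintegral push'// int.
Qed.

Let sq : (Num.sqrt v) ^+ 2 = v. Proof. exact: sqr_sqrtr. Qed.

Let sv0 : v != 0 -> Num.sqrt v != 0.
Proof. by move=> vN; rewrite sqrtr_eq0 -ltNge lt_def vN. Qed.

Lemma normal_law_mean :
  P.-integrable setT (fun w => (X w)%:E) /\ \int[P]_w X w = m.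
Proof.
have mm : measurable_fun [set: R] (fun x => x - m) by exact: measurable_funB.
have [|i1 i2] := @integral_normal_law (fun x => x - m) 2 mm.
  move=> z; apply: le_trans (expr4_growth _); by have [] := abs_growth (z - m).
have ic : P.-integrable setT (fun w : T => m%:E).
  exact: finite_measure_integrable_cst.
have iX : P.-integrable setT (fun w => (X w)%:E).
  have := integrableD measurableT i1 ic; apply: eq_integrable => // w _ /=.
  by rewrite -EFinD subrK.
split => //; apply/eqP; rewrite -subr_eq0; apply/eqP.
move: i2; rewrite RintegralB// Rintegral_cst_probability => ->.
case: eqVneq => [_|vN]; first by rewrite subrr.
by apply: normal_prob_mean; exact: sv0.
Qed.

Lemma normal_law_var : P.-integrable setT (fun w => ((X w - m) ^+ 2)%:E) /\
  \int[P]_w ((X w - m) ^+ 2) = v.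
Proof.
have mm : measurable_fun [set: R] (fun x => (x - m) ^+ 2).
  by apply: measurable_funX; exact: measurable_funB.
have [|i1 i2] := @integral_normal_law (fun x => (x - m) ^+ 2) 2 mm.
  move=> z; apply: le_trans (expr4_growth _); rewrite ger0_norm ?sqr_ge0//.
  by have [_ []] := abs_growth (z - m).
split => //; rewrite i2.
case: eqVneq => [->|vN]; first by rewrite subrr expr0n.
by rewrite normal_prob_var// sv0.
Qed.

Lemma normal_law_fourth : P.-integrable setT (fun w => ((X w - m) ^+ 4)%:E) /\
  \int[P]_w ((X w - m) ^+ 4) = 3 * v ^+ 2.
Proof.
have mm : measurable_fun [set: R] (fun x => (x - m) ^+ 4).
  by apply: measurable_funX; exact: measurable_funB.
have [|i1 i2] := @integral_normal_law (fun x => (x - m) ^+ 4) 2 mm.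
  move=> z; apply: le_trans (expr4_growth _); rewrite ger0_norm ?lerDr//.
  by rewrite exprn_even_ge0.
split => //; rewrite i2.
case: eqVneq => [->|vN]; first by rewrite subrr !expr0n mulr0.
rewrite normal_prob_fourth ?sv0//.
by rewrite (exprM _ 2 2) sq.
Qed.

Lemma normal_law_cos th :
  \int[P]_w cos (X w + th) = cos (m + th) * expR (- v / 2).
Proof.
have cb : measurable_fun [set: R] (fun x : R => cos (x + th)).
  apply: measurableT_comp; first exact: continuous_measurable_fun (@continuous_cos R).
  exact: measurable_funD.
have [|_ ->] := @integral_normal_law _ 1 cb.
  move=> z; rewrite mul1r (@le_trans _ _ 1)//.
    by rewrite ler_norml cos_geN1 cos_le1.
  by rewrite lerDl exprn_even_ge0.
case: eqVneq => [->|vN]; first by rewrite oppr0 mul0r expR0 mulr1.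
transitivity (\int[normal_prob m (Num.sqrt v)]_x cos (1 * (x - m) + (m + th))).
  by apply: eq_Rintegral => x _; congr cos; ring.
rewrite normal_prob_cos ?sv0//.
by rewrite mulr1 sq.
Qed.

End normal_law.

(** * Concentration of Gaussian sums of squares *)

Section gauss_seq.
Context {R : realType} d (T : measurableType d) (P : probability T R).

(** Joint normality with uncorrelated coordinates, phrased through finite linear
combinations because these are the laws that the model provides;
independence is encoded in the form of the variances. *)
Definition gauss_seq (xi : nat -> T -> R) (m v : nat -> R) : Prop :=
  [/\ forall j, measurable_fun [set: T] (xi j), forall j, 0 <= v j &
      forall (k : nat) (a : nat -> R),
        has_normal_law P (fun w => \sum_(j < k) a j * xi j w)
          (\sum_(j < k) a j * m j) (\sum_(j < k) a j ^+ 2 * v j)].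

Lemma has_normal_law_eq (X X' : T -> R) (m m' v v' : R) :
  has_normal_law P X m v -> X =1 X' -> m = m' -> v = v' ->
  has_normal_law P X' m' v'.
Proof. by move=> h /funext <- <- <-. Qed.

Section centred.
Variables (xi : nat -> T -> R) (v : nat -> R).
Hypothesis gxi : gauss_seq xi (fun=> 0) v.

Let mxi j : measurable_fun [set: T] (xi j). Proof. by case: gxi. Qed.
Let v0 j : 0 <= v j. Proof. by case: gxi. Qed.

Lemma sum_pred1 k i (c : R) (f : nat -> R) : (i < k)%N ->
  \sum_(j < k) (if (j == i :> nat) then c else 0) * f j = c * f i.
Proof.
move=> ik; rewrite (bigD1 (Ordinal ik))//= eqxx big1 ?addr0// => j ji.
have /negbTE -> : nat_of_ord j != i by apply: contra ji => /eqP h; apply/eqP/val_inj.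
by rewrite mul0r.
Qed.

Let law1 i : has_normal_law P (xi i) 0 (v i).
Proof.
have [_ _ /(_ i.+1 (fun j => if (j == i)%N then 1 else 0)) h] := gxi.
apply: (has_normal_law_eq h) => [w||].
- by rewrite (sum_pred1 _ (xi ^~ w))// mul1r.
- by rewrite big1// => j _; rewrite mulr0.
- rewrite -[RHS]mul1r -(@sum_pred1 i.+1)//; apply: eq_bigr => j _.
  by case: ifP => _; rewrite ?expr1n// expr0n.
Qed.

Let law2 i j c : i != j ->
  has_normal_law P (fun w => xi i w + c * xi j w) 0 (v i + c ^+ 2 * v j).
Proof.
move=> ij; pose a l : R := if (l == i)%N then 1 else if (l == j)%N then c else 0.
have E (f : nat -> R) : \sum_(l < (maxn i j).+1) a l * f l = f i + c * f j.
  rewrite -[f i]mul1r -(@sum_pred1 (maxn i j).+1 i) ?ltnS ?leq_maxl//.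
  rewrite -(@sum_pred1 (maxn i j).+1 j) ?ltnS ?leq_maxr// -big_split/=.
  apply: eq_bigr => l _; rewrite /a -mulrDl; congr (_ * _).
  case: eqVneq => [->|_]; last by rewrite add0r.
  by rewrite (negbTE ij) addr0.
have E2 (f : nat -> R) : \sum_(l < (maxn i j).+1) a l ^+ 2 * f l = f i + c ^+ 2 * f j.
  rewrite -[f i]mul1r -(@sum_pred1 (maxn i j).+1 i) ?ltnS ?leq_maxl//.
  rewrite -(@sum_pred1 (maxn i j).+1 j) ?ltnS ?leq_maxr// -big_split/=.
  apply: eq_bigr => l _; rewrite /a -mulrDl; congr (_ * _).
  case: eqVneq => [->|_]; first by rewrite (negbTE ij) addr0 expr1n.
  by case: ifPn => _; rewrite ?add0r// expr0n.
have [_ _ /(_ (maxn i j).+1 a) h] := gxi.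
apply: (has_normal_law_eq h) => [w||]; first exact: (E (xi ^~ w)).
  by rewrite big1// => l _; rewrite mulr0.
exact: E2.
Qed.

Let Rint (f : T -> R) := P.-integrable [set: T] (EFin \o f).

Let RintD f g : Rint f -> Rint g -> Rint (fun w => f w + g w).
Proof. by move=> fi gi; have := integrableD measurableT fi gi. Qed.

Let RintZ c f : Rint f -> Rint (fun w => c * f w).
Proof. by move=> fi; have := integrableZl measurableT c fi. Qed.

Let xi4 i : Rint (fun w => xi i w ^+ 4) /\ \int[P]_w (xi i w ^+ 4) = 3 * v i ^+ 2.
Proof.
have := normal_law_fourth (mxi i) (v0 i) (law1 i).
by rewrite /Rint /comp; under [X in _.-integrable _ X]eq_fun do rewrite subr0;
  under eq_Rintegral do rewrite subr0.
Qed.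

Let xi2 i : Rint (fun w => xi i w ^+ 2) /\ \int[P]_w (xi i w ^+ 2) = v i.
Proof.
have := normal_law_var (mxi i) (v0 i) (law1 i).
by rewrite /Rint /comp; under [X in _.-integrable _ X]eq_fun do rewrite subr0;
  under eq_Rintegral do rewrite subr0.
Qed.

(** Independence is replaced by polarisation: x^2 y^2 is a combination of the
fourth powers of x + y, x - y, x and y, whose means are known. *)
Let xi22 i j : i != j -> Rint (fun w => xi i w ^+ 2 * xi j w ^+ 2) /\
  \int[P]_w (xi i w ^+ 2 * xi j w ^+ 2) = v i * v j.
Proof.
move=> ij.
have H c : Rint (fun w => (xi i w + c * xi j w) ^+ 4) /\
    \int[P]_w ((xi i w + c * xi j w) ^+ 4) = 3 * (v i + c ^+ 2 * v j) ^+ 2.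
  have mc : measurable_fun [set: T] (fun w => xi i w + c * xi j w).
    by apply: measurable_funD => //; exact: measurable_funM.
  have vc : 0 <= v i + c ^+ 2 * v j by rewrite addr_ge0// mulr_ge0// sqr_ge0.
  have := normal_law_fourth mc vc (law2 c ij).
  by rewrite /Rint /comp; under [X in _.-integrable _ X]eq_fun do rewrite subr0;
    under eq_Rintegral do rewrite subr0.
have [p1 p2] := H 1; have [m1 m2] := H (-1).
have [a1 a2] := xi4 i; have [b1 b2] := xi4 j.
have E : (fun w => xi i w ^+ 2 * xi j w ^+ 2) =
    (fun w => 12^-1 * ((xi i w + 1 * xi j w) ^+ 4 + (xi i w + -1 * xi j w) ^+ 4)
      + ((- 6^-1) * xi i w ^+ 4 + (- 6^-1) * xi j w ^+ 4)).
  by apply/funext => w; field.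
have r1 : Rint (fun w => (xi i w + 1 * xi j w) ^+ 4 + (xi i w + -1 * xi j w) ^+ 4).
  exact: RintD.
have r2 := RintZ (12^-1) r1.
have r3 : Rint (fun w => (- 6^-1) * xi i w ^+ 4) by exact: RintZ.
have r4 : Rint (fun w => (- 6^-1) * xi j w ^+ 4) by exact: RintZ.
have r5 := RintD r3 r4.
split; first by rewrite E; exact: RintD.
rewrite E RintegralD// RintegralZl// RintegralD// RintegralD// !RintegralZl//.
by rewrite p2 m2 a2 b2; field.
Qed.

Let Y i w := xi i w ^+ 2 - v i.

Let cstI c : Rint (fun w => c).
Proof. exact: finite_measure_integrable_cst. Qed.

Let YY i j : Rint (fun w => Y i w * Y j w) /\
  \int[P]_w (Y i w * Y j w) = if i == j then 2 * v i ^+ 2 else 0.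
Proof.
have [a1 a2] := xi2 i; have [b1 b2] := xi2 j.
have [c1 c2] : Rint (fun w => xi i w ^+ 2 * xi j w ^+ 2) /\
    \int[P]_w (xi i w ^+ 2 * xi j w ^+ 2) = if i == j then 3 * v i ^+ 2 else v i * v j.
  case: eqVneq => [<-|]; last exact: xi22.
  have := xi4 i; rewrite (_ : (fun w => xi i w ^+ 4) = (fun w => xi i w ^+ 2 * xi i w ^+ 2))//.
  by apply/funext => w; ring.
have E : (fun w => Y i w * Y j w) =
    (fun w => xi i w ^+ 2 * xi j w ^+ 2 + ((- v j) * xi i w ^+ 2 + ((- v i) * xi j w ^+ 2 + v i * v j))).
  by apply/funext => w; rewrite /Y; ring.
have r1 : Rint (fun w => (- v j) * xi i w ^+ 2) by exact: RintZ.
have r2 : Rint (fun w => (- v i) * xi j w ^+ 2) by exact: RintZ.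
have r3 := RintD r2 (cstI (v i * v j)).
have r4 := RintD r1 r3.
split; first by rewrite E; exact: RintD.
rewrite E RintegralD// RintegralD// RintegralD//; last exact: cstI.
rewrite Rintegral_cst_probability !RintegralZl//.
rewrite a2 b2 c2; case: eqVneq => [->|_]; ring.
Qed.

(** The variables xi_i^2 - v_i are uncorrelated with variances 2 v_i^2. *)
Lemma gauss_seq_sum_sqr k :
  Rint (fun w => (\sum_(i < k) (xi i w ^+ 2 - v i)) ^+ 2) /\
  \int[P]_w ((\sum_(i < k) (xi i w ^+ 2 - v i)) ^+ 2) = 2 * \sum_(i < k) v i ^+ 2.
Proof.
have cross k' l : Rint (fun w => (\sum_(i < k') Y i w) * Y l w) /\
    ((k' <= l)%N -> \int[P]_w ((\sum_(i < k') Y i w) * Y l w) = 0).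
  elim: k' => [|k' [IH1 IH2]].
    rewrite (_ : (fun w => _) = (fun=> 0)); last first.
      by apply/funext => w; rewrite big_ord0 mul0r.
    by split=> [|_]; [exact: cstI|rewrite Rintegral_cst_probability].
  have [y1 y2] := YY k' l.
  rewrite (_ : (fun w => _) = (fun w => (\sum_(i < k') Y i w) * Y l w + Y k' w * Y l w)); last first.
    by apply/funext => w; rewrite big_ord_recr/= mulrDl.
  split=> [|kl]; first exact: RintD.
  by rewrite RintegralD// IH2 ?(ltnW kl)// y2 (ltn_eqF kl) addr0.
elim: k => [|k [IH1 IH2]].
  rewrite (_ : (fun w => _) = (fun=> 0)); last first.
    by apply/funext => w; rewrite big_ord0 expr0n.
  by split; [exact: cstI|rewrite Rintegral_cst_probability big_ord0 mulr0].
have [y1 y2] := YY k k; have [c1 c2] := cross k k.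
rewrite (_ : (fun w => _) = (fun w => (\sum_(i < k) (xi i w ^+ 2 - v i)) ^+ 2 +
  (2 * ((\sum_(i < k) Y i w) * Y k w) + Y k w * Y k w))); last first.
  by apply/funext => w; rewrite big_ord_recr/= /Y; ring.
have r1 := RintZ 2 c1; have r2 := RintD r1 y1.
split; first exact: RintD.
rewrite RintegralD// RintegralD// RintegralZl// c2// y2 eqxx IH2 big_ord_recr/=; ring.
Qed.

End centred.
End gauss_seq.

Lemma measurable_sum_sqr_limit {R : realType} d (T : measurableType d)
    (xi : nat -> T -> R) (N : T -> R) :
  (forall j, measurable_fun [set: T] (xi j)) ->
  (forall w, (fun k => \sum_(j < k) xi j w ^+ 2) @ \oo --> N w) ->
  measurable_fun [set: T] N.
Proof.
move=> mxi cvgN.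
apply: (@measurable_fun_cvg _ _ _ _ (fun k w => \sum_(j < k) xi j w ^+ 2)) => //.
move=> k; apply: measurable_sum => j; exact: measurable_funX.
Qed.

Section chebyshev.
Context {R : realType} d (T : measurableType d) (P : probability T R).
Variables (xi : nat -> T -> R) (v : nat -> R) (N : T -> R) (E Q : R).
Hypothesis gxi : gauss_seq P xi (fun=> 0) v.
Hypothesis cvgN : forall w, (fun k => \sum_(j < k) xi j w ^+ 2) @ \oo --> N w.
Hypothesis cvgE : (fun k => \sum_(j < k) v j) @ \oo --> E.
Hypothesis leQ : forall k, \sum_(j < k) v j ^+ 2 <= Q.

(** Fatou's lemma carries the variance bound for partial sums over to the
limit [N]. *)
Lemma gauss_seq_chebyshev (a : R) : 0 < a ->
  (P [set w | (a <= `|N w - E|)%R] <= (2 * Q / a ^+ 2)%:E)%E.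
Proof.
move=> a0; have [mxi _ _] := gxi.
have mN := measurable_sum_sqr_limit mxi (@cvgN).
pose f k w := (((\sum_(i < k) (xi i w ^+ 2 - v i)) ^+ 2)%:E : \bar R).
have mf k : measurable_fun [set: T] (f k).
  apply/measurable_EFinP; apply: measurable_funX; apply: measurable_sum => j.
  by apply: measurable_funB => //; exact: measurable_funX.
have f0 k w : [set: T] w -> (0 <= f k w)%E by move=> _; rewrite lee_fin sqr_ge0.
have If k : (\int[P]_w f k w = (2 * \sum_(i < k) v i ^+ 2)%:E)%E.
  have [fi <-] := gauss_seq_sum_sqr gxi k.
  by rewrite /Rintegral fineK//; exact: integrable_fin_num.
have flim w : limn_einf (f ^~ w) = (((N w - E) ^+ 2)%:E)%E.
  suff h : f ^~ w @ \oo --> ((N w - E) ^+ 2)%:E.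
    by rewrite is_cvg_limn_einfE; [exact: cvg_lim|apply/cvg_ex; eexists; exact: h].
  apply: cvg_EFin; first exact: nearW.
  rewrite (_ : _ \o _ = fun k => (\sum_(i < k) xi i w ^+ 2 - \sum_(i < k) v i) ^+ 2); last first.
    by apply/funext => k; rewrite /f /comp /= big_split/= sumrN.
  apply: (@cvg_comp _ _ _ _ (fun x => x ^+ 2)); last exact: sqr_continuous.
  exact: cvgB.
have F : (\int[P]_w ((N w - E) ^+ 2)%:E <= (2 * Q)%:E)%E.
  under eq_integral do rewrite -flim.
  apply: (le_trans (fatou P measurableT mf f0)).
  apply: (@le_trans _ _ (ereal_sup (range (fun k => (\int[P]_w f k w)%E)))); last first.
    by apply: ub_ereal_sup => _ [k _ <-]; rewrite If lee_fin ler_wpM2l.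
  rewrite limn_einf_lim; apply: lime_le; first exact: is_cvg_einfs.
  apply: nearW => k; apply: (@le_trans _ _ (\int[P]_w f k w)%E).
    by apply: ereal_inf_lbound; exists k => //=.
  by apply: ereal_sup_ubound; exists k.
have a20 : 0 < a ^+ 2 by rewrite exprn_gt0.
have mNE : measurable_fun [set: T] (fun w => ((N w - E) ^+ 2)%:E : \bar R).
  by apply/measurable_EFinP; apply: measurable_funX; exact: measurable_funB.
have := le_integral_abse P measurableT mNE a20.
rewrite (_ : _ `&` _ = [set w | a <= `|N w - E|]); last first.
  rewrite setTI; apply/seteqP; split => w /=; rewrite lee_fin normrX.
    by rewrite ler_sqr ?nnegrE// ltW.
  by move=> h; rewrite ler_sqr ?nnegrE// ltW.
have -> : (\int[P]_w `|((N w - E) ^+ 2)%:E| = \int[P]_w ((N w - E) ^+ 2)%:E)%E.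
  by apply: eq_integral => w _; rewrite gee0_abs ?lee_fin ?sqr_ge0.
move=> /le_trans/(_ F).
by rewrite -lee_pdivlMl// -EFinM mulrC.
Qed.

End chebyshev.

(** * The characteristic function determines the law of a sum of squares *)

Section bounded_prob.
Context {R : realType} d (T : measurableType d) (P : probability T R).

Lemma bounded_integrable (f : T -> R) (M : R) : measurable_fun [set: T] f ->
  (forall w, `|f w| <= M) -> P.-integrable [set: T] (fun w => (f w)%:E).
Proof.
move=> mf fM.
apply: (@le_integrable _ _ _ P _ measurableT _ (fun=> M%:E)).
- exact/measurable_EFinP.
- by move=> w _; rewrite /= lee_fin (le_trans (fM w))// ler_norm.
- exact: finite_measure_integrable_cst.
Qed.

Lemma bounded_cvg (f_ : nat -> T -> R) (f : T -> R) (M : R) :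
  (forall n, measurable_fun [set: T] (f_ n)) ->
  (forall n w, `|f_ n w| <= M) ->
  (forall w, f_ ^~ w @ \oo --> f w) ->
  (fun n => \int[P]_w (f_ n w)%:E)%E @ \oo --> (\int[P]_w (f w)%:E)%E.
Proof.
move=> mf fM ff.
have mE n : measurable_fun [set: T] (fun w => (f_ n w)%:E) by exact/measurable_EFinP.
have mF : measurable_fun [set: T] (fun w => (f w)%:E).
  by apply/measurable_EFinP; apply: measurable_fun_cvg mf _ => w _; exact: ff.
have c : {ae P, forall w, [set: T] w -> (fun n => (f_ n w)%:E) @ \oo --> (f w)%:E}.
  by apply/aeW => w _; apply: cvg_EFin; [exact: nearW|exact: ff].
have i : P.-integrable [set: T] (fun=> M%:E) by exact: finite_measure_integrable_cst.
have b : {ae P, forall w n, [set: T] w -> (`|(f_ n w)%:E| <= M%:E)%E}.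
  by apply/aeW => w n _; rewrite lee_fin.
by have [] := @dominated_convergence _ _ _ P _ measurableT
  (fun n w => (f_ n w)%:E) (fun w => (f w)%:E) _ mE mF c i b.
Qed.

End bounded_prob.

Section linearise.
Context {R : realType} d (T : measurableType d) (P : probability T R).
Variable xi : nat -> T -> R.
Hypothesis mxi : forall j, measurable_fun [set: T] (xi j).

Let cosb (x : R) : `|cos x| <= 1. Proof. by rewrite ler_norml cos_geN1 cos_le1. Qed.

(** Interpolates between the characteristic function (i = 0) and the Laplace
transform of a partial sum of squares (i = k, a = 0, th = 0). *)
Definition damped_cos (c : R) (i k : nat) (a : nat -> R) (th : R) : \bar R :=
  (\int[P]_w (expR (- c * \sum_(j < i) xi j w ^+ 2) *
              cos (\sum_(j < k) a j * xi j w + th))%:E)%E.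

(** The factor exp (- c xi_i^2) is the mean of cos (sqrt (2 c) xi_i g) over a
standard normal g; by Fubini's theorem it becomes a random change of the i-th
coefficient inside the cosine. *)
Lemma damped_cosS c i k a th : 0 <= c -> (i < k)%N ->
  damped_cos c i.+1 k a th = (\int[normal_prob 0 1]_g
    damped_cos c i k (fun j => if (j == i)%N then (a j + Num.sqrt (2 * c) * g)%R else a j) th)%E.
Proof.
move=> c0 ik.
pose N := @normal_prob R 0 1.
pose f (z : T * measurableTypeR R) : \bar R := (expR (- c * \sum_(j < i) xi j z.1 ^+ 2) *
   cos (Num.sqrt (2 * c) * xi i z.1 * z.2 + (\sum_(j < k) a j * xi j z.1 + th)))%:E.
have mx j : measurable_fun [set: T * measurableTypeR R] (fun z => xi j z.1).
  by apply: measurableT_comp => //; exact: measurable_fst.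
have mf : measurable_fun setT f.
  apply/measurable_EFinP; apply: measurable_funM.
    apply: measurableT_comp => //; apply: measurable_funM => //.
    by apply: measurable_sum => j; exact: measurable_funX.
  apply: measurableT_comp; first exact: continuous_measurable_fun (@continuous_cos R).
  apply: measurable_funD.
    apply: measurable_funM; last exact: measurable_snd.
    exact: measurable_funM.
  apply: measurable_funD => //; apply: measurable_sum => j.
  exact: measurable_funM.
have fi : (P \x N)%E.-integrable setT f.
  apply: (@bounded_integrable _ _ _ (P \x N)%E _ 1) => //.
    exact/measurable_EFinP.
  move=> z; rewrite normrM ger0_norm ?expR_ge0// mulr_ile1 ?expR_ge0//.
  rewrite -[leRHS]expR0 ler_expR mulNr oppr_le0 mulr_ge0// sumr_ge0// => j _.
  exact: sqr_ge0.
transitivity (\int[P]_w \int[N]_g f (w, g))%E.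
  apply: eq_integral => w _; rewrite /f/=.
  set e := expR _; set psi := \sum_(j < k) _ + th.
  have I : N.-integrable setT (fun g : measurableTypeR R =>
      (cos (Num.sqrt (2 * c) * xi i w * (g - 0) + psi))%:E).
    apply: (@bounded_integrable _ _ _ N _ 1) => //.
    apply: measurableT_comp; first exact: continuous_measurable_fun (@continuous_cos R).
    apply: measurable_funD => //; apply: measurable_funM => //.
    exact: measurable_funB.
  under eq_integral do rewrite EFinM -[X in _ * X + _]subr0.
  rewrite integralZl//.
  have H := @normal_prob_cos R 0 1 (Num.sqrt (2 * c) * xi i w) psi (oner_neq0 _).
  have {}H := congr1 EFin H; rewrite /Rintegral fineK in H; last exact: integrable_fin_num.
  rewrite H -EFinM mul1r exprMn sqr_sqrtr ?mulr_ge0//.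
  congr (_%:E); rewrite mulrCA mulrC; congr (_ * _).
  by rewrite /e -expRD big_ord_recr/=; congr expR; field.
rewrite (@Fubini _ _ _ _ _ P N f fi); apply: eq_integral => g _.
apply: eq_integral => w _; rewrite /f /=; congr (_ * cos _)%:E.
rewrite addrA; congr (_ + _).
rewrite [RHS](bigD1 (Ordinal ik))//= eqxx (bigD1 (Ordinal ik))//= addrA; congr (_ + _).
  by ring.
apply: eq_bigr => j ji; case: ifPn => // /eqP h.
by case/eqP: ji; exact: val_inj.
Qed.

End linearise.

Section smooth_step.
Context {R : realType}.

(** For large n the power is about exp (- exp (n (x - y)) / n): it tends to 1 for
x <= y and to 0 for y < x, and it is a polynomial in exp (- n y). *)
Definition smooth_step (x : R) (n : nat) (y : R) : R :=
  (1 - expR (- (n%:R * y))) ^+ Num.truncn (expR (n%:R * x) / n%:R).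

Lemma bernoulli_ineq (u : R) K : 0 <= u <= 1 -> 1 - K%:R * u <= (1 - u) ^+ K.
Proof.
move=> /andP[u0 u1]; elim: K => [|K IH]; first by rewrite mul0r subr0 expr0.
rewrite exprS (le_trans _ (ler_wpM2l _ IH)) ?subr_ge0//.
rewrite -natr1; have : 0 <= K%:R * (u * u) by rewrite !mulr_ge0.
lra.
Qed.

Lemma smooth_step_bound x n y : 0 <= y -> 0 <= smooth_step x n y <= 1.
Proof.
move=> y0; have e1 : expR (- (n%:R * y)) <= 1.
  by rewrite -[leRHS]expR0 ler_expR oppr_le0 mulr_ge0.
have e0 := expR_ge0 (- (n%:R * y)).
by rewrite exprn_ge0 ?subr_ge0//= exprn_ile1// ?subr_ge0// lerBlDr lerDl.
Qed.

(** Bernoulli's inequality for x <= y, and 1 - u <= exp (- u) for y < x; the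
division by n in the exponent of [smooth_step] settles the case x = y. *)
Lemma smooth_step_cvg (x y : R) : 0 <= y ->
  (fun n => smooth_step x n y) @ \oo --> ((x <= y)%R%:R : R).
Proof.
move=> y0; have nV : (fun n : nat => (n%:R : R)^-1) @ \oo --> (0 : R).
  by rewrite -cvg_shiftS; exact: cvg_harmonic.
have [xy|yx] := lerP x y.
  rewrite -[X in _ --> X]subr0.
  have lo : (fun n : nat => 1 - (n%:R : R)^-1) @ \oo --> (1 - 0 : R).
    by apply: cvgB => //; exact: cvg_cst.
  apply: (squeeze_cvgr _ lo); last by rewrite subr0; exact: cvg_cst.
  near=> n; have /andP[_ ->] := smooth_step_bound x n y0; rewrite andbT.
  have n0 : 0 < n%:R :> R by rewrite ltr0n; near: n; exact: nbhs_infty_gt.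
  apply: le_trans (bernoulli_ineq _ _); last first.
    by rewrite expR_ge0 -[leRHS]expR0 ler_expR oppr_le0 mulr_ge0.
  rewrite lerB//.
  have T : (Num.truncn (expR (n%:R * x) / n%:R))%:R <= expR (n%:R * x) / n%:R.
    by rewrite truncn_le// divr_ge0// expR_ge0.
  apply: (le_trans (ler_wpM2r (expR_ge0 _) T)).
  rewrite mulrAC -expRD -[leRHS]mul1r ler_wpM2r ?invr_ge0 ?(ltW n0)//.
  by rewrite -[leRHS]expR0 ler_expR -mulrBr mulr_ge0_le0 ?(ltW n0)// subr_le0.
(* exp (n (x - y)) / n >= n D, by the quadratic term of the exponential *)
pose D := (x - y) ^+ 2 / 2.
have D0 : 0 < D by rewrite divr_gt0// exprn_gt0// subr_gt0.
have hi : (fun n : nat => expR 1 / D * (n%:R : R)^-1) @ \oo --> (0 : R).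
  by rewrite -[X in _ --> X](mulr0 (expR 1 / D)); apply: cvgM => //; exact: cvg_cst.
apply: (squeeze_cvgr _ (cvg_cst 0) hi).
near=> n; have /andP[-> _] := smooth_step_bound x n y0 => /=.
have n0 : 0 < n%:R :> R by rewrite ltr0n; near: n; exact: nbhs_infty_gt.
rewrite /smooth_step; set K := Num.truncn _; set u := expR _.
have u1 : u <= 1 by rewrite -[leRHS]expR0 ler_expR oppr_le0 mulr_ge0.
have u0 : 0 < u by exact: expR_gt0.
have : (1 - u) ^+ K <= expR (- u) ^+ K.
  by rewrite lerXn2r ?nnegrE ?subr_ge0 ?expR_ge0// expR_ge1Dx.
move=> /le_trans; apply; rewrite -expRM_natl.
have K1 : expR (n%:R * x) / n%:R - 1 <= K%:R.
  by rewrite lerBlDr natr1 ltW// truncnS_gt.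
have Ku : n%:R * D - 1 <= K%:R * u.
  apply: le_trans (ler_wpM2r (ltW u0) K1).
  rewrite mulrBl mul1r lerB// /u mulrAC -expRD -mulrBr.
  rewrite ler_pdivlMr//.
  have z0 : 0 <= n%:R * (x - y) by rewrite mulr_ge0// subr_ge0 ltW.
  have := expR_ge1Dxn 1 z0; rewrite (_ : 2`! = 2%N)// => h.
  by apply: le_trans h; rewrite /D exprMn; lra.
apply: (@le_trans _ _ (expR (1 - n%:R * D))).
  by rewrite ler_expR; lra.
have nD : 0 < n%:R * D by exact: mulr_gt0.
rewrite expRD -mulrA ler_wpM2l ?expR_ge0// expRN -invfM [D * _]mulrC.
rewrite lef_pV2 ?posrE ?expR_gt0//.
by rewrite (le_trans _ (expR_ge1Dx _))// lerDr.
Unshelve. all: end_near. Qed.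

End smooth_step.

Section uniqueness.
Context {R : realType} d (T : measurableType d) (P : probability T R)
  d' (T' : measurableType d') (P' : probability T' R).
Variables (xi : nat -> T -> R) (xi' : nat -> T' -> R) (N : T -> R) (N' : T' -> R).
Hypothesis mxi : forall j, measurable_fun [set: T] (xi j).
Hypothesis mxi' : forall j, measurable_fun [set: T'] (xi' j).
Hypothesis same_chf : forall (k : nat) (a : nat -> R) (th : R),
  (\int[P]_w (cos (\sum_(j < k) a j * xi j w + th))%:E =
   \int[P']_w (cos (\sum_(j < k) a j * xi' j w + th))%:E)%E.
Hypothesis cvgN : forall w, (fun k => \sum_(j < k) xi j w ^+ 2) @ \oo --> N w.
Hypothesis cvgN' : forall w, (fun k => \sum_(j < k) xi' j w ^+ 2) @ \oo --> N' w.

Lemma same_damped_cos (c : R) i k a th : 0 <= c -> (i <= k)%N ->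
  damped_cos P xi c i k a th = damped_cos P' xi' c i k a th.
Proof.
move=> c0; elim: i a => [|i IH] a ik.
  have := same_chf k a th; rewrite /damped_cos => h.
  by under eq_integral do rewrite big_ord0 mulr0 expR0 mul1r;
    under [RHS]eq_integral do rewrite big_ord0 mulr0 expR0 mul1r.
rewrite !damped_cosS//; apply: eq_integral => g _.
by apply: IH; exact: ltnW.
Qed.

Lemma same_laplace_partial (c : R) k : 0 <= c ->
  (\int[P]_w (expR (- c * \sum_(j < k) xi j w ^+ 2))%:E =
   \int[P']_w (expR (- c * \sum_(j < k) xi' j w ^+ 2))%:E)%E.
Proof.
move=> c0; have := same_damped_cos (fun=> 0) 0 c0 (leqnn k).
have E d0 (T0 : measurableType d0) (P0 : probability T0 R) (x : nat -> T0 -> R) :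
    damped_cos P0 x c k k (fun=> 0) 0 = (\int[P0]_w (expR (- c * \sum_(j < k) x j w ^+ 2))%:E)%E.
  apply: eq_integral => w _; rewrite [X in cos (X + _)]big1 ?addr0 ?cos0 ?mulr1// => j _.
  by rewrite mul0r.
by rewrite !E.
Qed.

End uniqueness.

Section limit.
Context {R : realType} d (T : measurableType d) (P : probability T R).
Variables (xi : nat -> T -> R) (N : T -> R).
Hypothesis mxi : forall j, measurable_fun [set: T] (xi j).
Hypothesis cvgN : forall w, (fun k => \sum_(j < k) xi j w ^+ 2) @ \oo --> N w.

Lemma sum_sqr_limit_ge0 w : 0 <= N w.
Proof.
have c := @cvgN w; rewrite -(cvg_lim (@Rhausdorff R) c).
apply: limr_ge; first exact: (cvgP _ c).
by apply: nearW => k; apply: sumr_ge0 => j _; exact: sqr_ge0.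
Qed.

Lemma laplace_partial_cvg (c : R) : 0 <= c ->
  (fun k => \int[P]_w (expR (- c * \sum_(j < k) xi j w ^+ 2))%:E)%E @ \oo -->
  (\int[P]_w (expR (- c * N w))%:E)%E.
Proof.
move=> c0; apply: (bounded_cvg (M := 1)).
- move=> k; apply: measurableT_comp => //; apply: measurable_funM => //.
  apply: measurable_sum => j; exact: measurable_funX.
- move=> k w; rewrite ger0_norm ?expR_ge0// -[leRHS]expR0 ler_expR mulNr oppr_le0.
  by rewrite mulr_ge0// sumr_ge0// => j _; exact: sqr_ge0.
- move=> w; apply: (cvg_comp _ expR); last exact: continuous_expR.
  by apply: cvgM; [exact: cvg_cst|exact: cvgN].
Qed.

End limit.

Section laplace_unique.
Context {R : realType} d (T : measurableType d) (P : probability T R)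
  d' (T' : measurableType d') (P' : probability T' R).
Variables (N : T -> R) (N' : T' -> R).
Hypotheses (mN : measurable_fun [set: T] N) (mN' : measurable_fun [set: T'] N').
Hypotheses (N0 : forall w, 0 <= N w) (N0' : forall w, 0 <= N' w).
Hypothesis same_laplace : forall c : R, 0 <= c ->
  (\int[P]_w (expR (- c * N w))%:E = \int[P']_w (expR (- c * N' w))%:E)%E.

Let term_bound d0 (T0 : measurableType d0) (P0 : probability T0 R) (M : T0 -> R) (c m : R) K :
  measurable_fun [set: T0] M -> (forall w, 0 <= M w) -> 0 <= c -> 0 <= m ->
  P0.-integrable [set: T0] (fun w => (expR (- c * M w) * (1 - expR (- (m * M w))) ^+ K)%:E).
Proof.
move=> mM M0 c0 m0; apply: (@bounded_integrable _ _ _ P0 _ 1).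
  apply: measurable_funM.
    by apply: measurableT_comp => //; exact: measurable_funM.
  apply: measurable_funX; apply: measurable_funB => //.
  apply: measurableT_comp => //; apply: measurableT_comp => //.
  exact: measurable_funM.
move=> w; have e1 (x : R) : 0 <= x -> 0 <= expR (- x) <= 1.
  by move=> x0; rewrite expR_ge0 -[leRHS]expR0 ler_expR oppr_le0.
rewrite normrM mulr_ile1//.
  by have /andP[? ?] := e1 _ (mulr_ge0 c0 (M0 w)); rewrite mulNr ger0_norm.
have /andP[? ?] := e1 _ (mulr_ge0 m0 (M0 w)).
by rewrite normrX exprn_ile1// ger0_norm ?subr_ge0// lerBlDr lerDl.
Qed.

Lemma same_laplace_poly (c m : R) K : 0 <= c -> 0 <= m ->
  (\int[P]_w (expR (- c * N w) * (1 - expR (- (m * N w))) ^+ K)%:E =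
   \int[P']_w (expR (- c * N' w) * (1 - expR (- (m * N' w))) ^+ K)%:E)%E.
Proof.
move=> + m0; elim: K c => [|K IH] c c0.
  under eq_integral do rewrite expr0 mulr1.
  by under [RHS]eq_integral do rewrite expr0 mulr1; exact: same_laplace.
have E d0 (T0 : measurableType d0) (P0 : probability T0 R) (M : T0 -> R) :
    measurable_fun [set: T0] M -> (forall w, 0 <= M w) ->
    (\int[P0]_w (expR (- c * M w) * (1 - expR (- (m * M w))) ^+ K.+1)%:E =
     \int[P0]_w (expR (- c * M w) * (1 - expR (- (m * M w))) ^+ K)%:E -
     \int[P0]_w (expR (- (c + m) * M w) * (1 - expR (- (m * M w))) ^+ K)%:E)%E.
  move=> mM M0; rewrite -integralB_EFin//; last 2 first.
    exact: term_bound.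
    by apply: term_bound => //; exact: addr_ge0.
  apply: eq_integral => w _; rewrite -EFinB; congr (_%:E).
  by rewrite opprD mulrDl expRD exprS !mulNr; ring.
rewrite (E _ _ P N mN N0) (E _ _ P' N' mN' N0').
by congr (_ - _)%E; apply: IH => //; exact: addr_ge0.
Qed.

(** Equal Laplace transforms give equal means of every [smooth_step], and these
converge boundedly to the indicator of [x <= N]. *)
Lemma same_tail (x : R) : P [set w | x <= N w] = P' [set w | x <= N' w].
Proof.
have C d0 (T0 : measurableType d0) (P0 : probability T0 R) (M : T0 -> R) :
    measurable_fun [set: T0] M -> (forall w, 0 <= M w) ->
    (fun n => \int[P0]_w (smooth_step x n (M w))%:E)%E @ \oo --> P0 [set w | x <= M w].
  move=> mM M0.
  have mA : measurable [set w | x <= M w].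
    rewrite (_ : [set w | _] = [set: T0] `&` M @^-1` `[x, +oo[); last first.
      by rewrite setTI; apply/seteqP; split => w /=; rewrite in_itv/= andbT.
    by apply: mM.
  have -> : P0 [set w | x <= M w] = (\int[P0]_w ((x <= M w)%R%:R)%:E)%E.
    rewrite -[X in P0 X]setIT -(integral_indic _ measurableT mA).
    apply: eq_integral => w _; rewrite indicE; congr (_%:R)%:E; congr nat_of_bool.
    by apply/idP/idP => h; [exact: set_mem h|exact: mem_set h].
  apply: (bounded_cvg (M := 1)).
  - move=> n; apply: measurable_funX; apply: measurable_funB => //.
    apply: measurableT_comp => //; apply: measurableT_comp => //.
    exact: measurable_funM.
  - move=> n w; have /andP[h1 h2] := smooth_step_bound x n (M0 w).
    by rewrite ger0_norm.
  - by move=> w; exact: smooth_step_cvg.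
have h := C _ _ P _ mN N0; have := C _ _ P' _ mN' N0'.
rewrite (_ : (fun n => _) = (fun n => \int[P]_w (smooth_step x n (N w))%:E)%E).
  by move=> h'; apply: (cvg_unique _ h h').
apply/funext => n.
have E0 d0 (T0 : measurableType d0) (P0 : probability T0 R) (M : T0 -> R) :
    (\int[P0]_w (smooth_step x n (M w))%:E = \int[P0]_w (expR (- 0 * M w) *
      (1 - expR (- (n%:R * M w))) ^+ Num.truncn (expR (n%:R * x) / n%:R))%:E)%E.
  by apply: eq_integral => w _; rewrite oppr0 mul0r expR0 mul1r.
by rewrite (E0 _ _ P') (E0 _ _ P) same_laplace_poly.
Qed.

End laplace_unique.

Section chf.
Context {R : realType}.

Lemma gauss_seq_chf d (T : measurableType d) (P : probability T R) xi m v :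
  gauss_seq P xi m v -> forall (k : nat) (a : nat -> R) (th : R),
  (\int[P]_w (cos (\sum_(j < k) a j * xi j w + th))%:E =
   (cos (\sum_(j < k) a j * m j + th) *
    expR (- (\sum_(j < k) a j ^+ 2 * v j) / 2))%:E)%E.
Proof.
move=> [mxi v0 law] k a th.
have mX : measurable_fun [set: T] (fun w => \sum_(j < k) a j * xi j w).
  by apply: measurable_sum => j; exact: measurable_funM.
have V0 : 0 <= \sum_(j < k) a j ^+ 2 * v j.
  by apply: sumr_ge0 => j _; rewrite mulr_ge0// sqr_ge0.
rewrite -(normal_law_cos mX V0 (law k a)) /Rintegral fineK//.
apply: integrable_fin_num => //; apply: (@bounded_integrable _ _ _ P _ 1).
  apply: measurableT_comp; first exact: continuous_measurable_fun (@continuous_cos R).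
  exact: measurable_funD.
by move=> w; rewrite ler_norml cos_geN1 cos_le1.
Qed.

Lemma sum_pad (k K : nat) (a f : nat -> R) : (k <= K)%N ->
  \sum_(j < K) (if (j < k)%N then a j else 0) * f j = \sum_(j < k) a j * f j.
Proof.
move=> kK; rewrite (big_ord_widen K (fun j => a j * f j) kK) [RHS]big_mkcond/=.
by apply: eq_bigr => j _; case: ifP => // _; rewrite mul0r.
Qed.

Lemma sum_split_at (K i : nat) (f : nat -> R) : (i < K)%N ->
  \sum_(j < K) f j = f i + \sum_(j < K) (if (j == i :> nat) then 0 else f j).
Proof.
move=> iK; rewrite (bigD1 (Ordinal iK))//=; congr (_ + _).
rewrite [RHS](bigD1 (Ordinal iK))//= eqxx add0r; apply: eq_bigr => j ji.
by case: ifPn => // /eqP h; case/eqP: ji; exact: val_inj.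
Qed.

End chf.

(** * Continuity in a shift of the mean *)

Section shift.
Context {R : realType} d (T : measurableType d) (P : R -> probability T R).
Variables (xi : R -> nat -> T -> R) (N : R -> T -> R) (v : nat -> R) (i : nat).
Hypothesis vi0 : 0 < v i.
Hypothesis gxi : forall b, gauss_seq (P b) (xi b) (fun j => if (j == i)%N then b else 0) v.
Hypothesis cvgN : forall b w, (fun k => \sum_(j < k) xi b j w ^+ 2) @ \oo --> N b w.

Let s := Num.sqrt (v i).
Let s0 : s != 0. Proof. by rewrite sqrtr_eq0 -ltNge. Qed.
Let mxi b j : measurable_fun [set: T] (xi b j). Proof. by case: (gxi b). Qed.

(** The unshifted sequence with its i-th coordinate replaced by an independent
normal variable, so that only the second marginal depends on the shift. *)
Let xi' (j : nat) (z : T * measurableTypeR R) : R := if (j == i)%N then z.2 else xi 0 j z.1.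
Let N' (z : T * measurableTypeR R) : R := N 0 z.1 - xi 0 i z.1 ^+ 2 + z.2 ^+ 2.

Let mxi' j : measurable_fun setT (xi' j).
Proof.
rewrite /xi'; case: (j == i)%N; first exact: measurable_snd.
by apply: measurableT_comp => //; exact: measurable_fst.
Qed.

Let cvgN' z : (fun k => \sum_(j < k) xi' j z ^+ 2) @ \oo --> N' z.
Proof.
rewrite /N'; have h : (fun k => \sum_(j < k) xi 0 j z.1 ^+ 2 - xi 0 i z.1 ^+ 2 + z.2 ^+ 2) @ \oo
    --> N 0 z.1 - xi 0 i z.1 ^+ 2 + z.2 ^+ 2.
  apply: cvgD; last exact: cvg_cst.
  by apply: cvgB; [exact: cvgN|exact: cvg_cst].
apply: cvg_trans h; apply: near_eq_cvg; near=> k.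
have ik : (i < k)%N by near: k; exact: nbhs_infty_gt.
rewrite (sum_split_at (fun j => xi 0 j z.1 ^+ 2) ik).
rewrite (sum_split_at (fun j => xi' j z ^+ 2) ik) {1}/xi' eqxx /=.
rewrite (_ : \sum_(j < k) (if (j == i :> nat) then 0 else xi' j z ^+ 2) =
  \sum_(j < k) (if (j == i :> nat) then 0 else xi 0 j z.1 ^+ 2)); first by ring.
apply: eq_bigr => j _; rewrite /xi'. by case: (nat_of_ord j == i).
Unshelve. all: end_near. Qed.

Let chf_prod b (k : nat) (a : nat -> R) th : (i < k)%N ->
  (\int[P b]_w (cos (\sum_(j < k) a j * xi b j w + th))%:E =
   \int[P 0 \x normal_prob b s]_z (cos (\sum_(j < k) a j * xi' j z + th))%:E)%E.
Proof.
move=> ik.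
rewrite (gauss_seq_chf (gxi b)).
pose f (z : T * measurableTypeR R) : \bar R := (cos (\sum_(j < k) a j * xi' j z + th))%:E.
have mf : measurable_fun setT f.
  apply/measurable_EFinP.
  apply: measurableT_comp; first exact: continuous_measurable_fun (@continuous_cos R).
  apply: measurable_funD => //; apply: measurable_sum => j.
  exact: measurable_funM.
have fi : (P 0 \x normal_prob b s)%E.-integrable setT f.
  apply: (@bounded_integrable _ _ _ (P 0 \x normal_prob b s)%E _ 1) => //.
    exact/measurable_EFinP.
  by move=> w; rewrite ler_norml cos_geN1 cos_le1.
rewrite -(@integral12_prod_meas1 _ _ _ _ _ (P 0) (normal_prob b s) f fi).
pose a' j := if (j == i)%N then 0 else a j.
have E w : (fubini_F (normal_prob b s) f w = (expR (- (s * a i) ^+ 2 / 2))%:E *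
    (cos (\sum_(j < k) a' j * xi 0 j w + (a i * b + th)))%:E)%E.
  rewrite /fubini_F /f.
  have H := @normal_prob_cos R b s (a i) (\sum_(j < k) a' j * xi 0 j w + (a i * b + th)) s0.
  have I : (normal_prob b s).-integrable setT (fun g : measurableTypeR R =>
      (cos (a i * (g - b) + (\sum_(j < k) a' j * xi 0 j w + (a i * b + th))))%:E).
    apply: (@bounded_integrable _ _ _ (normal_prob b s) _ 1) => //.
      apply: measurableT_comp; first exact: continuous_measurable_fun (@continuous_cos R).
      apply: measurable_funD => //; apply: measurable_funM => //.
      exact: measurable_funB.
    by move=> ?; rewrite ler_norml cos_geN1 cos_le1.
  have {}H := congr1 EFin H; rewrite /Rintegral fineK in H; last exact: integrable_fin_num.
  rewrite -EFinM mulrC -H; apply: eq_integral => y _; congr (cos _)%:E.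
  rewrite (sum_split_at (fun j => a j * xi' j (w, y)) ik) /xi' eqxx /=.
  rewrite (_ : \sum_(j < k) a' j * xi 0 j w =
    \sum_(j < k) (if (j == i :> nat) then 0 else a j * (if (j == i :> nat) then y else xi 0 j w))).
    by ring.
  by apply: eq_bigr => j _; rewrite /a'; case: (nat_of_ord j == i); rewrite ?mul0r.
under [RHS]eq_integral do rewrite E.
rewrite integralZl//; last first.
  apply: (@bounded_integrable _ _ _ (P 0) _ 1) => //.
    apply: measurableT_comp; first exact: continuous_measurable_fun (@continuous_cos R).
    apply: measurable_funD => //; apply: measurable_sum => j.
    exact: measurable_funM.
  by move=> ?; rewrite ler_norml cos_geN1 cos_le1.
rewrite (gauss_seq_chf (gxi 0)) -EFinM mulrCA -expRD; congr (cos _ * expR _)%:E.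
  rewrite [X in _ = X + _]big1 ?add0r; last by move=> j _; case: (nat_of_ord j == i); rewrite mulr0.
  congr (_ + _); rewrite (sum_split_at (fun j => a j * (if (j == i)%N then b else 0)) ik) eqxx.
  by rewrite big1 ?addr0// => j _; case: (nat_of_ord j == i); rewrite ?mulr0.
rewrite (sum_split_at (fun j => a j ^+ 2 * v j) ik).
rewrite (_ : \sum_(j < k) a' j ^+ 2 * v j =
    \sum_(j < k) (if (j == i :> nat) then 0 else a j ^+ 2 * v j)).
  by rewrite exprMn sqr_sqrtr ?ltW//; field.
by apply: eq_bigr => j _; rewrite /a'; case: (nat_of_ord j == i); rewrite ?expr0n ?mul0r.
Qed.

Let chf_same b (k : nat) (a : nat -> R) th :
  (\int[P b]_w (cos (\sum_(j < k) a j * xi b j w + th))%:E =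
   \int[P 0 \x normal_prob b s]_z (cos (\sum_(j < k) a j * xi' j z + th))%:E)%E.
Proof.
pose a' j := if (j < k)%N then a j else 0.
have kK : (k <= maxn k i.+1)%N by rewrite leq_maxl.
have := @chf_prod b (maxn k i.+1) a' th (leq_maxr _ _).
under eq_integral do rewrite (sum_pad a (xi b ^~ _) kK).
move=> ->; apply: eq_integral => z _.
by rewrite (sum_pad a (xi' ^~ z) kK).
Qed.

(** Both sequences have the same characteristic function. *)
Lemma shift_tail b x : (P b [set w | (x <= N b w)%R] =
  (P 0 \x normal_prob b s) [set z | (x <= N' z)%R])%E.
Proof.
apply: same_tail.
- by apply: (measurable_sum_sqr_limit (xi := xi b)); [exact: mxi|exact: cvgN].
- by apply: (measurable_sum_sqr_limit (xi := xi')); [exact: mxi'|exact: cvgN'].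
- by move=> w; apply: (sum_sqr_limit_ge0 (xi := xi b)); exact: cvgN.
- by move=> w; apply: (sum_sqr_limit_ge0 (xi := xi')); exact: cvgN'.
move=> c c0.
have h1 := laplace_partial_cvg (P := P b) (mxi b) (@cvgN b) c0.
have h2 := laplace_partial_cvg (P := (P 0 \x normal_prob b s)%E) mxi' cvgN' c0.
apply: (cvg_unique _ h1) => //.
apply: cvg_trans h2; apply: near_eq_cvg; near=> k.
by apply/esym; apply: same_laplace_partial.
Unshelve. all: end_near. Qed.

(** By [shift_tail] the probability is the integral over y of H(y) times the
normal density with mean [b] at y, where H does not depend on [b]; continuity
follows by domination. *)
Lemma shift_continuous (x : R) :
  continuous (fun b => fine (P b [set w | (x <= N b w)%R])).
Proof.
pose A : set (T * measurableTypeR R) := [set z | (x <= N' z)%R].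
have mN' : measurable_fun setT N'.
  by apply: (measurable_sum_sqr_limit (xi := xi')); [exact: mxi'|exact: cvgN'].
have mA : measurable A.
  rewrite (_ : A = setT `&` N' @^-1` `[x, +oo[); last first.
    by rewrite setTI; apply/seteqP; split => w /=; rewrite in_itv/= andbT.
  exact: mN'.
pose f (z : T * measurableTypeR R) : \bar R := (\1_A z)%:E.
have mf : measurable_fun setT f by apply/measurable_EFinP; exact: measurable_indic.
have f0 z : (0 <= f z)%E by rewrite lee_fin.
pose G := fubini_G (P 0) f.
have mG : measurable_fun setT G by exact: measurable_fun_fubini_tonelli_G.
have G0 y : (0 <= G y)%E by apply: integral_ge0.
have G1 y : (G y <= 1)%E.
  rewrite /G /fubini_G -(@probability_setT _ _ _ (P 0)) -[leRHS]mul1e -integral_cst//.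
  apply: ge0_le_integral => //.
    by apply: measurableT_comp mf _; exact: measurable_pair2.
  by move=> w _; rewrite /f lee_fin indicE; case: (_ \in _).
pose H (y : R) : R := fine (G y).
have GE y : G y = (H y)%:E.
  by rewrite fineK// ge0_fin_numE// (le_lt_trans (G1 y))// ltry.
have mH : measurable_fun [set: R] H.
  by apply: measurableT_comp => //; exact: mG.
have H01 y : 0 <= H y <= 1 by rewrite -!lee_fin -GE G0 G1.
have E b : fine (P b [set w | (x <= N b w)%R]) =
    \int[lebesgue_measure]_y (H y * normal_pdf b s y).
  rewrite shift_tail -/A.
  have -> : ((P 0 \x normal_prob b s) A = \int[normal_prob b s]_y (H y)%:E)%E.
    rewrite -[A]setIT -(integral_indic _ measurableT mA).
    rewrite -/f (@fubini_tonelli2 _ _ _ _ _ (P 0) (normal_prob b s) f mf f0).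
    by apply: eq_integral => y _; exact: GE.
  have HI : (normal_prob b s).-integrable setT (EFin \o H).
    apply: (@bounded_integrable _ _ _ (normal_prob b s) _ 1) => //.
    by move=> y; have /andP[? ?] := H01 y; rewrite ger0_norm.
  by have [_ ->] := integral_normal_prob HI.
rewrite (funext E) => b0.
have s20 : Num.sqrt 2 * s != 0 by rewrite mulf_neq0// sqrtr_eq0 -ltNge.
pose C := normal_peak s * expR (1 / (2 * s ^+ 2)) / normal_peak (Num.sqrt 2 * s).
have C0 : 0 <= C by rewrite divr_ge0 ?normal_peak_ge0// mulr_ge0 ?normal_peak_ge0 ?expR_ge0.
pose g (y : R) : R := C * normal_pdf b0 (Num.sqrt 2 * s) y.
have Ib : b0 \in (`]b0 - 1, b0 + 1[%classic : set R).
  by rewrite inE /= in_itv/= ltrBlDr ltrDl ltr01.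
have gub (b y : R) : `]b0 - 1, b0 + 1[%classic b -> normal_pdf b s y <= g y.
  rewrite /= in_itv/= => /andP[b1 b2].
  rewrite /g !normal_pdfE// /C.
  have p0 : normal_peak (Num.sqrt 2 * s) != 0 by rewrite gt_eqF ?normal_peak_gt0.
  rewrite [leRHS](_ : _ = normal_peak s * (expR (1 / (2 * s ^+ 2)) *
    normal_fun b0 (Num.sqrt 2 * s) y)); last by field.
  rewrite ler_wpM2l ?normal_peak_ge0// /normal_fun -expRD ler_expR.
  rewrite exprMn [Num.sqrt 2 ^+ 2]sqr_sqrtr//.
  have ss : 0 < s ^+ 2 by rewrite exprn_even_gt0.
  rewrite -subr_ge0 [leRHS](_ : _ = (2 + 2 * (y - b) ^+ 2 - (y - b0) ^+ 2) / (4 * s ^+ 2)); last by field.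
  rewrite divr_ge0//; last exact: mulr_ge0 (ler0n _ 4) (ltW ss).
  have bb : 0 <= (1 - (b - b0)) * (1 + (b - b0)) by rewrite mulr_ge0//; lra.
  have := sqr_ge0 ((y - b) - (b - b0)); nra.
have intf (b : R) : `]b0 - 1, b0 + 1[%classic b ->
    (@lebesgue_measure R).-integrable setT (EFin \o (fun y => H y * normal_pdf b s y)).
  move=> _; apply: (@le_integrable _ _ _ lebesgue_measure _ _ _
      (fun y => (normal_pdf b s y)%:E)) => //.
  - by apply/measurable_EFinP; apply: measurable_funM => //; exact: measurable_normal_pdf.
  - move=> y _; rewrite /= lee_fin normrM; have /andP[h0 h1] := H01 y.
    by rewrite (ger0_norm h0) ler_piMl.
  - exact: integrable_normal_pdf.
have cf : {ae (@lebesgue_measure R), forall y, [set: R] y -> {in `]b0 - 1, b0 + 1[%classic,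
    continuous ((fun b y => H y * normal_pdf b s y) ^~ y)}}.
  apply/aeW => y _; have cc : continuous (normal_pdf y s) by exact: continuous_normal_pdf.
  have ch : continuous (fun b => H y * normal_pdf b s y).
    have -> : (fun b => H y * normal_pdf b s y) = (fun b => H y * normal_pdf y s b).
      by apply/funext => b; rewrite !normal_pdfE// /normal_fun -sqrrN opprB.
    by move=> b; apply: cvgM; [exact: cvg_cst|exact: (cc b)].
  by move=> b _; exact: (ch b).
have ig : (@lebesgue_measure R).-integrable setT (EFin \o g).
  rewrite /comp /g; under eq_fun do rewrite EFinM.
  by apply: integrableZl => //; exact: integrable_normal_pdf.
have ub (b : R) : `]b0 - 1, b0 + 1[%classic b ->
    {ae (@lebesgue_measure R), forall y, [set: R] y -> `|H y * normal_pdf b s y| <= g y}.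
  move=> bI; apply/aeW => y _; have /andP[h0 h1] := H01 y.
  rewrite normrM (ger0_norm h0) (ger0_norm (normal_pdf_ge0 _ _ _)).
  by apply: le_trans (gub _ _ bI); rewrite ler_piMl ?normal_pdf_ge0.
exact: (@continuity_under_integral _ _ _ lebesgue_measure
  (fun b y => H y * normal_pdf b s y) setT measurableT _ _ intf cf g ig ub b0 Ib).
Qed.

End shift.

(** * Translates of normal laws *)

Section translation.
Context {R : realType}.

Lemma lebesgue_measure_translation (c : R) (A : set R) : measurable A ->
  pushforward lebesgue_measure ((fun x => x - c) : _ -> measurableTypeR R) A =
  lebesgue_measure A.
Proof.
move=> mA; apply/esym.
have mc : measurable_fun setT ((fun x => x - c) : R -> measurableTypeR R).
  exact: measurable_funB.
apply: (@lebesgue_measure_unique R (pushforward lebesgue_measure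
  ((fun x => x - c) : R -> measurableTypeR R))) => // X [[a b]] _ <-.
rewrite /pushforward /= [X in _ = lebesgue_measure X](_ : _ = `]a + c, b + c]%classic); last first.
  by apply/seteqP; split => x /=; rewrite !in_itv/= ltrBrDr lerBlDr.
rewrite !lebesgue_measure_itv/= !lte_fin ltrD2r.
by case: ifP => // _; rewrite -!EFinB; congr (_%:E); ring.
Qed.

(** The density of a normal law is translated, and Lebesgue measure is
translation invariant. *)
Lemma normal_law_translation (m v c : R) (A : set R) : 0 <= v -> measurable A ->
  normal_law m v ((fun x => x - c) @^-1` A) = normal_law (m - c) v A.
Proof.
move=> v0 mA; rewrite /normal_law; case: eqP => [_|/eqP vN].
  rewrite !diracE; congr (_%:R%:E).
have s0 : Num.sqrt v != 0 by rewrite sqrtr_eq0 -ltNge lt_def vN.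
rewrite /normal_prob.
pose f y : \bar R := (normal_pdf (m - c) (Num.sqrt v) y)%:E.
have mf : measurable_fun setT f.
  by apply/measurable_EFinP; exact: measurable_normal_pdf.
have f0 y : (0 <= f y)%E by rewrite lee_fin normal_pdf_ge0.
pose sh : measurableTypeR R -> measurableTypeR R := fun x => x - c.
have msh : measurable_fun [set: measurableTypeR R] sh by exact: measurable_funB.
transitivity (\int[pushforward lebesgue_measure sh]_(y in A) f y)%E.
  have -> := ge0_integral_pushforward msh lebesgue_measure mA (measurable_funTS mf) (fun y _ => f0 y).
  apply: eq_integral => y _; rewrite /f /= !normal_pdfE// /normal_fun.
  by rewrite /sh (_ : y - c - (m - c) = y - m)//; ring.
by apply: eq_measure_integral => B mB _; exact: lebesgue_measure_translation.
Qed.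

Lemma has_normal_law_translation d (T : measurableType d) (P : probability T R)
    (X : T -> R) (m v c : R) : 0 <= v ->
  has_normal_law P X m v -> has_normal_law P (fun w => X w - c) (m - c) v.
Proof.
move=> v0 h A mA; rewrite -normal_law_translation// -h//.
rewrite -[X in measurable X]setTI; have : measurable_fun [set: R] (fun x => x - c).
  exact: measurable_funB.
exact.
Qed.

Lemma has_normal_law_ae d (T : measurableType d) (P : probability T R)
    (X X' : T -> R) (m v : R) :
  measurable_fun [set: T] X -> measurable_fun [set: T] X' ->
  {ae P, forall w, X w = X' w} -> has_normal_law P X m v -> has_normal_law P X' m v.
Proof.
move=> mX mX' XX' h A mA; rewrite -h//.
rewrite -[X' @^-1` A]setTI -[X @^-1` A]setTI.
have m1 : measurable ([set: T] `&` X' @^-1` A) by exact: mX'.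
have m2 : measurable ([set: T] `&` X @^-1` A) by exact: mX.
rewrite -[LHS]mul1e -[RHS]mul1e -!integral_cst// integral_mkcond [RHS]integral_mkcond.
apply: ae_eq_integral => //.
- by apply/(measurable_restrictT _ m1).
- by apply/(measurable_restrictT _ m2).
apply: filterS XX' => w XX' _; rewrite !patchE.
rewrite (_ : (w \in _) = (w \in [set: T] `&` X @^-1` A))//.
by apply/idP/idP; rewrite !inE /= XX'.
Qed.

End translation.

(** * Orthonormal bases of a Hilbert space *)

Section inner_product.
Context {R : realType} (H : normedModType R) (ip : {dot H for idfun}).
Implicit Types x y z : H.

Lemma ipC x y : ip x y = ip y x.
Proof. by rewrite hermC/= expr0 mul1r. Qed.

Lemma ipDl x y z : ip (x + y) z = ip x z + ip y z.
Proof. exact: linearDl. Qed.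

Lemma ipZl (a : R) x y : ip (a *: x) y = a * ip x y.
Proof. by rewrite linearZl_LR. Qed.

Lemma ipDr x y z : ip x (y + z) = ip x y + ip x z.
Proof. exact: linearDr. Qed.

Lemma ipZr (a : R) x y : ip x (a *: y) = a * ip x y.
Proof. by rewrite ipC ipZl ipC. Qed.

Lemma ipBl x y z : ip (x - y) z = ip x z - ip y z.
Proof. exact: linearBl. Qed.

Lemma ipBr x y z : ip x (y - z) = ip x y - ip x z.
Proof. exact: linearBr. Qed.

Lemma ip_sumr x (k : nat) (F : nat -> H) :
  ip x (\sum_(j < k) F j) = \sum_(j < k) ip x (F j).
Proof. exact: linear_sumr. Qed.

Lemma ip_suml x (k : nat) (F : nat -> H) :
  ip (\sum_(j < k) F j) x = \sum_(j < k) ip (F j) x.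
Proof. by rewrite ipC ip_sumr; apply: eq_bigr => j _; rewrite ipC. Qed.

Lemma ip_sumZr x (k : nat) (a : nat -> R) (F : nat -> H) :
  ip x (\sum_(j < k) a j *: F j) = \sum_(j < k) a j * ip x (F j).
Proof. by rewrite (ip_sumr _ _ (fun j => a j *: F j)); apply: eq_bigr => j _; rewrite ipZr. Qed.

Hypothesis hip : induces_norm ip.

Lemma cauchy_schwarz x y : `|ip x y| <= `|x| * `|y|.
Proof.
have [->|y0] := eqVneq y 0.
  by rewrite (linear0r ip) normr0 normr0 mulr0.
have yy : 0 < `|y| ^+ 2 by rewrite exprn_gt0// normr_gt0.
pose t := ip x y / `|y| ^+ 2.
have := sqr_ge0 `|x - t *: y|; rewrite -hip ipBl !ipBr !ipZl !ipZr !hip (ipC y x).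
have -> : t * (t * `|y| ^+ 2) = t * ip x y by rewrite /t mulfVK ?gt_eqF.
rewrite subrr subr0 subr_ge0 (_ : t * _ = ip x y ^+ 2 / `|y| ^+ 2); last by rewrite /t; ring.
rewrite ler_pdivrMr//.
rewrite -exprMn => h.
by rewrite -ler_sqr ?nnegrE ?mulr_ge0// real_normK ?num_real.
Qed.

(** Continuity is not part of the structure of a dot product; it follows from
the Cauchy-Schwarz inequality. *)
Lemma ip_continuous y : continuous (fun x => ip x y : R).
Proof.
move=> x; apply/cvgrPdist_le => e e0.
pose C := `|y| + 1; have C0 : 0 < C by rewrite ltr_wpDl.
near=> z; rewrite -ipBl; apply: le_trans (cauchy_schwarz _ _) _.
apply: (@le_trans _ _ (`|x - z| * C)); first by rewrite ler_wpM2l// lerDl.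
rewrite -ler_pdivlMr//; near: z.
by apply: cvgr_dist_le; [exact: cvg_id|exact: divr_gt0].
Unshelve. all: end_near. Qed.

Lemma ip_eq0 x : ip x x = 0 -> x = 0.
Proof. by rewrite hip => /eqP; rewrite expf_eq0 normr_eq0 => /andP[_ /eqP]. Qed.

Variable e : nat -> H.
Hypothesis he : orthonormal_basis ip e.

Lemma basis_expansion x : (fun k => \sum_(j < k) ip x (e j) *: e j) @ \oo --> x.
Proof.
have [_ /(_ x)] := he; rewrite /series/=.
by under eq_fun do rewrite big_mkord.
Qed.

Lemma parseval x : (fun k => \sum_(j < k) ip x (e j) ^+ 2) @ \oo --> `|x| ^+ 2.
Proof.
rewrite -hip (_ : (fun k => _) = (fun k => ip (\sum_(j < k) ip x (e j) *: e j) x)).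
  exact: (cvg_comp _ _ (@basis_expansion x) (@ip_continuous x x)).
apply/funext => k; rewrite (ip_suml _ _ (fun j => ip x (e j) *: e j)).
by apply: eq_bigr => j _; rewrite ipZl (ipC (e j)) expr2.
Qed.

Lemma ip_basis_sum k (a : nat -> R) j :
  ip (\sum_(i < k) a i *: e i) (e j) = if (j < k)%N then a j else 0.
Proof.
have [oe _] := he.
rewrite (ip_suml _ _ (fun i => a i *: e i)); case: ifPn => [jk|jk].
  rewrite (bigD1 (Ordinal jk))//= ipZl oe eqxx mulr1 big1 ?addr0// => i ij.
  have /negbTE ij' : nat_of_ord i != j by apply: contra ij => /eqP h; apply/eqP/val_inj.
  by rewrite ipZl oe ij' mulr0.
rewrite big1// => i _; rewrite ipZl oe; case: eqVneq => [ij|]; last by rewrite mulr0.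
by case/negP: jk; rewrite -ij.
Qed.

End inner_product.

(** * The posterior in coordinates *)

Section borel.
Context {R : realType} (H : normedModType R).

Lemma borel_open (A : set H) : open A -> measurable (A : set (borel H)).
Proof. by move=> oA; apply: sub_sigma_algebra. Qed.

Lemma continuous_borel (f : H -> R) : continuous f ->
  measurable_fun [set: borel H] (f : borel H -> R).
Proof.
move=> cf; apply: (measurability _ (RGenOInfty.measurableE R)) => _ [_ [a ->] <-].
rewrite setTI; apply: borel_open; apply: open_comp => //.
Qed.

End borel.

Section operators.
Context {R : realType} {H1 H2 : normedModType R}.
Variables (ip1 : {dot H1 for idfun}) (ip2 : {dot H2 for idfun}).
Hypotheses (hip1 : induces_norm ip1) (hip2 : induces_norm ip2).
Variables (K : {linear H1 -> H2}) (KT : H2 -> H1).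
Hypothesis hKT : is_adjoint ip1 ip2 K KT.
Variables (e : nat -> H1) (he : orthonormal_basis ip1 e).
Variables (kappa : nat -> R).
Hypothesis hkappa : forall i, KT (K (e i)) = kappa i ^+ 2 *: e i.
Variable n : nat.
Hypothesis n0 : (0 < n)%N.
Variables (Lam : {linear H1 -> H1}) (l : nat -> R).
Hypotheses (hLamcont : continuous Lam) (hLam : forall i, Lam (e i) = l i *: e i).
Hypothesis l0 : forall i, 0 <= l i.
Variable AT : H1 -> H2.
Hypothesis hAT : is_adjoint ip2 ip1 (posterior_mean_op K KT Lam n) AT.

Let M := marginal_op K KT Lam n.
Let A := posterior_mean_op K KT Lam n.
Let nV0 : 0 < n%:R^-1 :> R. Proof. by rewrite invr_gt0 ltr0n. Qed.

Let nondeg1 x y : (forall z, ip1 z x = ip1 z y) -> x = y.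
Proof.
by move=> h; apply/eqP; rewrite -subr_eq0; apply/eqP/(ip_eq0 hip1); rewrite ipBr !h subrr.
Qed.

Let nondeg2 x y : (forall z, ip2 z x = ip2 z y) -> x = y.
Proof.
by move=> h; apply/eqP; rewrite -subr_eq0; apply/eqP/(ip_eq0 hip2); rewrite ipBr !h subrr.
Qed.

Lemma adjointD x y : KT (x + y) = KT x + KT y.
Proof. by apply: nondeg1 => z; rewrite ipDr -!hKT ipDr. Qed.

Lemma adjointZ (a : R) x : KT (a *: x) = a *: KT x.
Proof. by apply: nondeg1 => z; rewrite ipZr -!hKT ipZr. Qed.

Lemma Lam_expansion h : (fun k => \sum_(j < k) (l j * ip1 h (e j)) *: e j) @ \oo --> Lam h.
Proof.
rewrite (_ : (fun k => _) = (fun k => Lam (\sum_(j < k) ip1 h (e j) *: e j))).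
  exact: (cvg_comp _ _ (basis_expansion he (x := h)) (@hLamcont h)).
apply/funext => k; rewrite linear_sum; apply: eq_bigr => j _.
by rewrite linearZ/= hLam scalerA mulrC.
Qed.

(** [Lam] is only known on the basis; continuity extends the formula to all
vectors. *)
Lemma Lam_coord h i : ip1 (Lam h) (e i) = l i * ip1 h (e i).
Proof.
have c : (fun k => ip1 (\sum_(j < k) (l j * ip1 h (e j)) *: e j) (e i)) @ \oo --> ip1 (Lam h) (e i).
  have ci := @ip_continuous _ _ ip1 hip1 (e i).
  exact: (cvg_comp _ _ (@Lam_expansion h) (ci (Lam h))).
apply: (cvg_unique _ c) => //; apply: cvg_near_cst; near=> k.
have ik : (i < k)%N by near: k; exact: nbhs_infty_gt.
by rewrite /= (ip_basis_sum he k (fun j => l j * ip1 h (e j))) ik.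
Unshelve. all: end_near. Qed.

Lemma Lam_psd h : 0 <= ip1 (Lam h) h.
Proof.
have c : (fun k => ip1 (\sum_(j < k) (l j * ip1 h (e j)) *: e j) h) @ \oo --> ip1 (Lam h) h.
  have ci := @ip_continuous _ _ ip1 hip1 h.
  exact: (cvg_comp _ _ (@Lam_expansion h) (ci (Lam h))).
have -> := esym (cvg_lim (@Rhausdorff R) c).
apply: limr_ge; first exact: (cvgP _ c).
apply: nearW => k; rewrite /= (ip_suml _ _ _ (fun j => (l j * ip1 h (e j)) *: e j)).
apply: sumr_ge0 => j _; rewrite ipZl (ipC _ (e j)) -mulrA mulr_ge0//.
by rewrite -expr2 sqr_ge0.
Qed.

Lemma marginal_opD x y : M (x + y) = M x + M y.
Proof. by rewrite /M /marginal_op adjointD !linearD/= addrACA. Qed.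

Lemma marginal_opZ (a : R) x : M (a *: x) = a *: M x.
Proof.
by rewrite /M /marginal_op adjointZ !linearZ/= scalerDr.
Qed.

(** The prior covariance is nonnegative, so only the noise term n^-1 I is kept. *)
Lemma marginal_op_coercive y : n%:R^-1 * ip2 y y <= ip2 (M y) y.
Proof.
by rewrite /M /marginal_op ipDl ipZl lerDl hKT Lam_psd.
Qed.

Lemma marginal_op_inj : injective M.
Proof.
move=> x y xy; apply/eqP; rewrite -subr_eq0; apply/eqP/(ip_eq0 hip2).
have Mxy : M (x - y) = 0 by rewrite marginal_opD -scaleN1r marginal_opZ xy scaleN1r subrr.
have := marginal_op_coercive (x - y).
rewrite Mxy (linear0l ip2) pmulr_rle0// => h; apply/eqP; rewrite eq_le h.
by rewrite hip2 sqr_ge0.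
Qed.

(** Injectivity of the marginal operator is enough to evaluate its partial
inverse on its range. *)
Lemma posterior_mean_marginal z : A (M z) = Lam (KT z).
Proof.
by rewrite /A /posterior_mean_op -/M pinvKV ?inE// => x y _ _; exact: marginal_op_inj.
Qed.

Let c i := l i / (n%:R^-1 + l i * kappa i ^+ 2).

(** The difference u of both sides is orthogonal to the range of the marginal
operator, so coercivity gives n^-1 |u|^2 <= 0. *)
Lemma posterior_mean_adjoint_basis i : AT (e i) = c i *: K (e i).
Proof.
pose u := AT (e i) - c i *: K (e i).
suff : u = 0 by move/eqP; rewrite subr_eq0 => /eqP.
have orth z : ip2 (M z) u = 0.
  rewrite /u ipBr -(hAT (M z)) -/A posterior_mean_marginal Lam_coord ipZr.
  rewrite /M /marginal_op ipDl ipZl hKT hkappa ipZr Lam_coord.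
  rewrite (ipC ip2 z) hKT (ipC ip1 (e i)) /c; field.
  rewrite pnatr_eq0 -lt0n n0 gt_eqF// ltr_wpDr// mulr_ge0// mulr_ge0// sqr_ge0.
  by [].
apply: (ip_eq0 hip2); have := marginal_op_coercive u; rewrite orth pmulr_rle0// => h.
by apply/eqP; rewrite eq_le h hip2 sqr_ge0.
Qed.

Lemma posterior_mean_adjoint_sum k (a : nat -> R) :
  AT (\sum_(j < k) a j *: e j) = \sum_(j < k) (a j * c j) *: K (e j).
Proof.
apply: nondeg2 => z; rewrite -hAT.
rewrite (ip_sumZr ip1 _ _ a) (ip_sumZr ip2 _ _ (fun j => a j * c j) (fun j => K (e j))).
apply: eq_bigr => j _; rewrite (hAT z) posterior_mean_adjoint_basis ipZr.
by rewrite mulrA.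
Qed.

Lemma posterior_mean_coord mu i :
  ip1 (A (K mu)) (e i) = c i * kappa i ^+ 2 * ip1 mu (e i).
Proof.
by rewrite (hAT (K mu)) posterior_mean_adjoint_basis ipZr hKT hkappa ipZr mulrA.
Qed.

Lemma posterior_mean_noise k (a : nat -> R) :
  ip2 (AT (\sum_(j < k) a j *: e j)) (AT (\sum_(j < k) a j *: e j)) =
  \sum_(j < k) a j ^+ 2 * (c j * kappa j) ^+ 2.
Proof.
rewrite posterior_mean_adjoint_sum (ip_sumZr ip2 _ _ (fun j => a j * c j) (fun j => K (e j))).
apply: eq_bigr => j _; rewrite ipC.
rewrite (_ : \sum_(i < k) (a i * c i) *: K (e i) = K (\sum_(i < k) (a i * c i) *: e i)).
  rewrite ipC hKT hkappa ipZr (ip_basis_sum he k (fun j => a j * c j)) ltn_ord.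
  by ring.
by rewrite linear_sum; apply: eq_bigr => i _; rewrite linearZ.
Qed.

Lemma posterior_cov_quad k (a : nat -> R) :
  let h := \sum_(j < k) a j *: e j in
  ip1 (posterior_cov_op K KT Lam n AT h) h =
  \sum_(j < k) a j ^+ 2 * (l j - l j * c j * kappa j ^+ 2).
Proof.
move=> h; rewrite /posterior_cov_op -/A -/M posterior_mean_marginal.
rewrite ipBl {2 4}/h !(ip_sumZr ip1 _ _ a) -sumrB; apply: eq_bigr => j _.
rewrite !Lam_coord ipC.
have hj : ip1 h (e j) = a j by rewrite (ip_basis_sum he) ltn_ord.
have -> : ip1 (KT (AT h)) (e j) = a j * c j * kappa j ^+ 2.
  rewrite ipC -hKT /h posterior_mean_adjoint_sum.
  rewrite (ip_sumZr ip2 _ _ (fun j => a j * c j) (fun j => K (e j))) (bigD1 j)//= big1 ?addr0.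
    by rewrite hKT hkappa ipZr; have [-> _] := he; rewrite eqxx mulr1.
  move=> i ij; rewrite hKT hkappa ipZr; have [-> _] := he.
  by rewrite eq_sym (inj_eq val_inj) (negbTE ij) !mulr0.
rewrite (ipC _ (e j)) hj; ring.
Qed.

End operators.

Section model.
Context {R : realType} {H1 H2 : normedModType R}.
Variables (ip1 : {dot H1 for idfun}) (ip2 : {dot H2 for idfun}).
Hypotheses (hip1 : induces_norm ip1) (hip2 : induces_norm ip2).
Variables (K : {linear H1 -> H2}) (KT : H2 -> H1).
Hypothesis hKT : is_adjoint ip1 ip2 K KT.
Variables (e : nat -> H1) (he : orthonormal_basis ip1 e).
Variables (kappa : nat -> R).
Hypothesis hkappa : forall i, KT (K (e i)) = kappa i ^+ 2 *: e i.
Variable n : nat.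
Hypothesis n0 : (0 < n)%N.
Variables (Lam : {linear H1 -> H1}) (l : nat -> R).
Hypotheses (hLamcont : continuous Lam) (hLam : forall i, Lam (e i) = l i *: e i).
Hypothesis l0 : forall i, 0 <= l i.
Variable AT : H1 -> H2.
Hypothesis hAT : is_adjoint ip2 ip1 (posterior_mean_op K KT Lam n) AT.

Let c i := l i / (n%:R^-1 + l i * kappa i ^+ 2).

Section sampling.
Context d (T : measurableType d) (P : probability T R).
Variables (Y : H2 -> T -> R) (mu : H1).
Hypothesis hY : gaussian_process P Y (fun h => ip2 (K mu) h)
  (fun h h' => n%:R^-1 * ip2 h h').
Variable AY : T -> H1.
Hypothesis hAY : represents P ip1 (fun h => Y (AT h)) AY.

(** The process axioms give normality of a single value with unknown parameters,
which are then the prescribed mean and variance. *)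
Lemma process_law h : has_normal_law P (Y h) (ip2 (K mu) h) (n%:R^-1 * ip2 h h).
Proof.
have [mY lin mean cov] := hY.
have [m [v [v0 law]]] := lin 1%N (fun=> h) (fun=> 1).
have {}law : has_normal_law P (Y h) m v.
  by apply: (has_normal_law_eq law) => // w; rewrite big_ord1 mul1r.
have [mi mE] := normal_law_mean (mY h) v0 law.
have [vi vE] := normal_law_var (mY h) v0 law.
have EY : ('E_P[Y h] = m%:E)%E.
  by rewrite unlock -mE /Rintegral fineK//; exact: integrable_fin_num.
have mm : ip2 (K mu) h = m by apply: EFin_inj; rewrite -mean EY.
have vv : n%:R^-1 * ip2 h h = v.
  apply: EFin_inj; rewrite -cov covariance.unlock EY /= expectation.unlock -vE.
  rewrite /Rintegral fineK; last exact: integrable_fin_num.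
  by apply: eq_integral => w _; rewrite expr2.
by rewrite mm vv.
Qed.

(** Linear combinations of coordinates of AY are values of the process [Y] at
vectors AT h; these values agree with AY almost surely for each h, and only
finitely many coordinates enter at a time. *)
Lemma sampling_gauss_seq z : gauss_seq P (fun j w => ip1 (AY w - z) (e j))
  (fun j => c j * kappa j ^+ 2 * ip1 mu (e j) - ip1 z (e j))
  (fun j => n%:R^-1 * (c j * kappa j) ^+ 2).
Proof.
have [mAY aeAY] := hAY; have [mY _ _ _] := hY.
have mip h : measurable_fun [set: T] (fun w => ip1 (AY w) h).
  have := continuous_borel (ip_continuous hip1 (y := h)).
  by move=> mh; exact: (measurableT_comp mh mAY).
split.
- move=> j; rewrite (_ : (fun w => _) = (fun w => ip1 (AY w) (e j) - ip1 z (e j))).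
    exact: measurable_funB.
  by apply/funext => w; rewrite ipBl.
- by move=> j; rewrite mulr_ge0// sqr_ge0.
move=> k a; pose h := \sum_(j < k) a j *: e j.
have law := process_law (AT h).
have {}law := has_normal_law_ae (mY _) (mip h) _ law.
have {}law : has_normal_law P (fun w => ip1 (AY w) h) (ip2 (K mu) (AT h)) (n%:R^-1 * ip2 (AT h) (AT h)).
  by apply: law; apply: filterS (aeAY h) => w ->.
have v0 : 0 <= n%:R^-1 * ip2 (AT h) (AT h) by rewrite mulr_ge0// hip2 sqr_ge0.
apply: (has_normal_law_eq (has_normal_law_translation (ip1 z h) v0 law)).
- move=> w; rewrite -ipBl (ip_sumZr ip1 _ _ a) ; by apply: eq_bigr.
- rewrite -(hAT (K mu)) !(ip_sumZr ip1 _ _ a) -sumrB; apply: eq_bigr => j _.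
  rewrite (posterior_mean_coord hip1 hip2 hKT he hkappa n0 hLamcont hLam l0 hAT).
  by rewrite -mulrBr.
- rewrite (posterior_mean_noise hip1 hip2 hKT he hkappa n0 hLamcont hLam l0 hAT).
  by rewrite mulr_sumr; apply: eq_bigr => j _; rewrite mulrCA.
Qed.

End sampling.

Lemma posterior_gauss_seq (Q : probability (borel H1) R) (m : H1) :
  gaussian_measure ip1 Q m (posterior_cov_op K KT Lam n AT) ->
  gauss_seq Q (fun j (x : borel H1) => ip1 ((x : H1) - m) (e j)) (fun=> 0)
    (fun j => l j - l j * c j * kappa j ^+ 2).
Proof.
move=> hQ.
have den i : 0 < n%:R^-1 + l i * kappa i ^+ 2.
  by rewrite ltr_pwDl ?invr_gt0 ?ltr0n// mulr_ge0// sqr_ge0.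
have vj j : 0 <= l j - l j * c j * kappa j ^+ 2.
  rewrite (_ : _ - _ = l j * n%:R^-1 / (n%:R^-1 + l j * kappa j ^+ 2)).
    by rewrite divr_ge0 ?(ltW (den j))// mulr_ge0.
  rewrite /c; field; rewrite pnatr_eq0 -lt0n n0 gt_eqF//.
  have := den j; rewrite -(pmulr_rgt0 _ (_ : 0 < n%:R :> R)) ?ltr0n//.
  by rewrite mulrDr divff ?pnatr_eq0 -?lt0n// [n%:R * _]mulrC.
split => //.
- move=> j; rewrite (_ : (fun x => _) = (fun x : borel H1 => ip1 x (e j) - ip1 m (e j))).
    apply: measurable_funB => //.
    exact: (continuous_borel (ip_continuous hip1 (y := e j))).
  by apply/funext => w; rewrite ipBl.
move=> k a; pose h := \sum_(j < k) a j *: e j.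
have S := posterior_cov_quad hip1 hip2 hKT he hkappa n0 hLamcont hLam l0 hAT k a.
have law := hQ h; rewrite /= -/h in S; rewrite S in law.
have v0 : 0 <= \sum_(j < k) a j ^+ 2 * (l j - l j * c j * kappa j ^+ 2).
  by apply: sumr_ge0 => j _; rewrite mulr_ge0// sqr_ge0.
apply: (has_normal_law_eq (has_normal_law_translation (ip1 m h) v0 law)) => //.
- move=> w; rewrite -ipBl (ip_sumZr ip1 _ _ a); by apply: eq_bigr.
- by rewrite subrr big1// => j _; rewrite mulr0.
Qed.

End model.

(** * Sobolev norms and synthesis of an element from its coordinates *)

Section sobolev.
Context {R : realType} {H : normedModType R} (ip : {dot H for idfun}).
Variables (e : nat -> H) (beta : R).
Local Notation snorm := (sobolev_norm ip e beta).

(** Bounds on finite sums avoid extended reals in the estimates that follow. *)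
Lemma sobolev_norm_leP (mu : H) (B : R) : 0 <= B ->
  (snorm mu <= B%:E)%E <->
  forall k, \sum_(j < k) ip mu (e j) ^+ 2 * j.+1%:R `^ (2 * beta) <= B ^+ 2.
Proof.
move=> B0.
have t0 j : 0 <= ip mu (e j) ^+ 2 * j.+1%:R `^ (2 * beta).
  by rewrite mulr_ge0 ?sqr_ge0 ?powR_ge0.
have psum k : (\sum_(0 <= i < k) (ip mu (e i) ^+ 2 * i.+1%:R `^ (2 * beta))%:E)%E =
    (\sum_(j < k) ip mu (e j) ^+ 2 * j.+1%:R `^ (2 * beta))%:E.
  by rewrite sumEFin big_mkord.
rewrite /sobolev_norm; set S := (\sum_(0 <= i <oo) _)%E.
have S0 : (0 <= S)%E by apply: nneseries_ge0 => j _ _; rewrite lee_fin.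
have E : (sqrte S <= B%:E)%E = (S <= (B ^+ 2)%:E)%E.
  case: S S0 => [s| |] //= s0.
  by rewrite !lee_fin -[in LHS](ger0_norm B0) -sqrtr_sqr ler_sqrt ?sqr_ge0.
rewrite E; split=> h.
  move=> k; rewrite -lee_fin -psum; apply: le_trans h.
  by apply: nneseries_lim_ge => j _; rewrite lee_fin.
rewrite /S; apply: lime_le.
  by apply: is_cvg_nneseries => j _ _; rewrite lee_fin.
by apply: nearW => k; rewrite psum lee_fin.
Qed.

Lemma sobolev_norm_lt_oo (mu : H) : (snorm mu < +oo)%E ->
  exists2 B, 0 <= B & (snorm mu <= B%:E)%E.
Proof.
move=> h; have h0 : (0 <= snorm mu)%E by exact: sqrte_ge0.
by exists (fine (snorm mu)); rewrite ?fine_ge0// fineK// ge0_fin_numE.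
Qed.

End sobolev.

Section synthesis.
Context {R : realType} {H : completeNormedModType R} (ip : {dot H for idfun}).
Hypothesis hip : induces_norm ip.
Variables (e : nat -> H) (he : orthonormal_basis ip e).

Lemma orthonormal_sum_norm (a : nat -> R) m k : (m <= k)%N ->
  `|\sum_(j < k) a j *: e j - \sum_(j < m) a j *: e j| ^+ 2 =
  \sum_(j < k) a j ^+ 2 - \sum_(j < m) a j ^+ 2.
Proof.
move=> mk.
have E k1 k2 : ip (\sum_(j < k1) a j *: e j) (\sum_(j < k2) a j *: e j) =
    \sum_(j < k2) a j * (if (j < k1)%N then a j else 0).
  rewrite (ip_sumZr ip _ _ a); apply: eq_bigr => j _.
  by rewrite (ip_basis_sum he).
have F k1 k2 : (k1 <= k2)%N -> \sum_(j < k2) a j * (if (j < k1)%N then a j else 0) = \sum_(j < k1) a j ^+ 2.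
  move=> k12; rewrite (big_ord_widen k2 (fun j => a j ^+ 2) k12) [RHS]big_mkcond/=.
  by apply: eq_bigr => j _; case: ifP => _; rewrite ?mulr0// expr2.
have G k1 k2 : (k2 <= k1)%N -> \sum_(j < k2) a j * (if (j < k1)%N then a j else 0) = \sum_(j < k2) a j ^+ 2.
  by move=> k21; apply: eq_bigr => j _; rewrite (leq_trans (ltn_ord j) k21) expr2.
by rewrite -hip ipBl !ipBr !E F// G// F// (G m)//; ring.
Qed.

(** Partial sums form a Cauchy sequence by orthogonality. *)
Lemma basis_synthesis (a : nat -> R) : cvgn (fun k => \sum_(j < k) a j ^+ 2) ->
  exists x, forall j, ip x (e j) = a j.
Proof.
move=> ca; pose S k : H := \sum_(j < k) a j *: e j.
have cS : cvgn S.
  have -> : S = series (fun j => a j *: e j) by apply/funext => k; rewrite /S /series/= big_mkord.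
  apply: cauchy_cvg; apply/cauchy_seriesP => eps eps0.
  have ca' : cvgn (series (fun j => a j ^+ 2)).
    by rewrite (_ : series _ = fun k => \sum_(j < k) a j ^+ 2)//; apply/funext => k; rewrite /series/= big_mkord.
  have /cvg_cauchy/cauchy_seriesP/(_ _ (exprn_gt0 2 eps0)) := ca'.
  apply: filterS => -[m k]/=; case: (leqP m k) => mk; last by rewrite !big_geq ?normr0// ltnW.
  rewrite (_ : \sum_(m <= j < k) a j ^+ 2 = `|\sum_(m <= j < k) a j *: e j| ^+ 2); last first.
    have := orthonormal_sum_norm a mk; rewrite -!(big_mkord xpredT (fun j => a j *: e j)).
    rewrite -!(big_mkord xpredT (fun j => a j ^+ 2)) !(big_cat_nat (leq0n m) mk)/=.
    by rewrite ![_ + _ - _]addrAC !subrr !add0r.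
  by rewrite ger0_norm ?sqr_ge0// ltr_pXn2r ?nnegrE ?normr_ge0// ltW.
have [x Sx] := (cvg_ex _).1 cS; exists x => j.
have c : (fun k => ip (S k) (e j)) @ \oo --> ip x (e j).
  have ci := @ip_continuous _ _ ip hip (e j).
  exact: (cvg_comp _ _ Sx (ci x)).
apply: (cvg_unique _ c) => //; apply: cvg_near_cst; near=> k.
have jk : (j < k)%N by near: k; exact: nbhs_infty_gt.
by rewrite (ip_basis_sum he) jk.
Unshelve. all: end_near. Qed.

End synthesis.

(** * Variances and bias in terms of the effective dimension *)

Ltac nonneg := by repeat first
  [ assumption | (apply: ltW; assumption) | exact: ler01 | exact: ler0n
  | apply: powR_ge0 | apply: sqr_ge0 | apply: expR_ge0 | apply: mulr_ge0
  | apply: addr_ge0 | apply: exprn_ge0 | rewrite invr_ge0 ].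

Section powR_facts.
Context {R : realType}.
Implicit Types a b r s : R.

Lemma powR_add a r s : 0 < a -> a `^ (r + s) = a `^ r * a `^ s.
Proof. by move=> a0; rewrite powRD//; apply/implyP => _; rewrite gt_eqF. Qed.

Lemma powR_base_le a b r : 0 < a -> a <= b -> 0 <= r -> a `^ r <= b `^ r.
Proof.
move=> a0 ab r0; rewrite ge0_ler_powR// nnegrE ltW//.
exact: lt_le_trans ab.
Qed.

Lemma powR_base_ge a b r : 0 < a -> a <= b -> r <= 0 -> b `^ r <= a `^ r.
Proof.
move=> a0 ab r0; have b0 : 0 < b by exact: lt_le_trans ab.
rewrite -[r]opprK (powRN b (- r)) (powRN a (- r)) lef_pV2 ?posrE ?powR_gt0//.
by apply: powR_base_le => //; rewrite oppr_ge0.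
Qed.

Lemma powR_divl a b r : 0 < a -> 0 < b -> (a / b) `^ r = a `^ r * b `^ (- r).
Proof.
move=> a0 b0; rewrite powRM ?invr_ge0 ?ltW//; congr (_ * _).
by rewrite -powR_inv1 ?ltW// -powRrM mulN1r.
Qed.

Lemma powR_sqr a r : 0 < a -> (a `^ r) ^+ 2 = a `^ (2 * r).
Proof. by move=> a0; rewrite mulrC powRrM powR_mulrn// powR_ge0. Qed.

(** One step of a telescoping comparison of the sum of w^(-1-a) with the integral
of the same power. *)
Lemma tail_step (a w : R) : 0 < a -> 1 < w ->
  w `^ (- 1 - a) <= a^-1 * ((w - 1) `^ (- a) - w `^ (- a)).
Proof.
move=> a0 w1; have w0 : 0 < w by rewrite (lt_trans ltr01).
have w10 : 0 < w - 1 by rewrite subr_gt0.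
have v0 : 0 < 1 - w^-1 by rewrite subr_gt0 invf_lt1.
have -> : w - 1 = w * (1 - w^-1) by rewrite mulrBr mulr1 divff ?gt_eqF.
rewrite (powRM _ (ltW w0) (ltW v0)) ler_pdivlMl// addrC powR_add// (powR_inv1 (ltW w0)).
have h : 1 + a * w^-1 <= (1 - w^-1) `^ (- a).
  rewrite /powR gt_eqF//; apply: le_trans (expR_ge1Dx _).
  rewrite lerD2l mulNr -mulrN ler_wpM2l ?(ltW a0)// lerNr.
  by apply: le_ln1Dx; rewrite ltrN2 invf_lt1.
have := ler_wpM2l (powR_ge0 w (- a)) h; nra.
Qed.

End powR_facts.

Lemma powR_inv2 {R : realType} (r : R) : 2 `^ (- r) = (2^-1) `^ r.
Proof. by rewrite -powR_inv1// -powRrM mulN1r. Qed.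

Section window.
Context {R : realType}.
Variables (alpha p C : R).
Hypotheses (halpha : 0 < alpha) (hp : 0 <= p) (hC : 1 <= C).

Definition smooth_exp := 1 + 2 * alpha + 2 * p.
Local Notation q := smooth_exp.

Variables (n : nat) (tau : R) (l kappa : nat -> R).
Hypotheses (n0 : (0 < n)%N) (tau0 : 0 < tau).
Hypothesis hl : forall i, l i = tau ^+ 2 * i.+1%:R `^ (- 1 - 2 * alpha).
Hypothesis hk0 : forall i, 0 < kappa i.
Hypothesis hk : forall i, C^-1 * i.+1%:R `^ (- p) <= kappa i <= C * i.+1%:R `^ (- p).

(** The index at which the signal-to-noise ratio is of order 1. *)
Definition eff_dim : R := (n%:R * tau ^+ 2) `^ q^-1.
(** The common order of the total posterior variance and of the total variance of
the posterior mean. *)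
Definition eff_size : R := tau ^+ 2 * eff_dim `^ (- 2 * alpha).
Local Notation M := eff_dim.
Local Notation R0 := eff_size.

Definition sn_ratio i := n%:R * l i * kappa i ^+ 2.
Definition post_var i := l i / (1 + sn_ratio i).
Definition mean_var i := l i * sn_ratio i / (1 + sn_ratio i) ^+ 2.
Local Notation x := sn_ratio.

Let q0 : 0 < q. Proof. by move: halpha hp => ? ?; rewrite /smooth_exp; lra. Qed.
Let nR : 0 < n%:R :> R. Proof. by rewrite ltr0n. Qed.
Let N0 : 0 < n%:R * tau ^+ 2. Proof. by rewrite mulr_gt0// exprn_gt0. Qed.
Let M0 : 0 < M. Proof. exact: powR_gt0. Qed.
Let R00 : 0 < R0. Proof. by rewrite mulr_gt0 ?exprn_gt0// powR_gt0. Qed.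
Let w0 i : 0 < i.+1%:R :> R. Proof. by []. Qed.
Let C0 : 0 < C. Proof. exact: lt_le_trans hC. Qed.

Lemma eff_dim_powq : M `^ q = n%:R * tau ^+ 2.
Proof. by rewrite /M -powRrM mulVf ?gt_eqF// powRr1// ltW. Qed.

Let y i := M / i.+1%:R.
Let y0 i : 0 < y i. Proof. by rewrite divr_gt0. Qed.

Lemma prior_var_scaled i : l i = R0 / M * y i `^ (1 + 2 * alpha).
Proof.
have E : M `^ (- 2 * alpha) * M^-1 * M `^ (1 + 2 * alpha) = 1.
  rewrite -(powR_inv1 (ltW M0)) -!powR_add// -[RHS](powRr0 M); congr (_ `^ _); ring.
rewrite hl /y powR_divl// /R0 (_ : - (1 + 2 * alpha) = - 1 - 2 * alpha); last by ring.
by rewrite -[LHS]mul1r -[X in X * _ = _]E; ring.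
Qed.

Lemma sn_ratio_bounds i : C ^- 2 * y i `^ q <= x i <= C ^+ 2 * y i `^ q.
Proof.
have E : y i `^ q = n%:R * l i * (i.+1%:R `^ (- p)) ^+ 2.
  rewrite /y powR_divl// eff_dim_powq hl powR_sqr//.
  rewrite (_ : - q = (- 1 - 2 * alpha) + 2 * - p); last by rewrite /smooth_exp; ring.
  by rewrite powR_add//; ring.
have l0 : 0 <= n%:R * l i by rewrite hl mulr_ge0// mulr_ge0 ?sqr_ge0 ?powR_ge0.
have /andP[k1 k2] := hk i; have wp := powR_ge0 i.+1%:R (- p).
rewrite /x E -exprVn !(mulrCA _ (_ * l i)) -!exprMn !ler_wpM2l//.
  by rewrite lerXn2r ?nnegrE ?mulr_ge0 ?(ltW (hk0 i)) ?(ltW C0).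
by rewrite lerXn2r ?nnegrE ?mulr_ge0 ?invr_ge0 ?(ltW (hk0 i)) ?(ltW C0).
Qed.

Lemma sn_ratio_ge0 i : 0 <= x i.
Proof.
by have /andP[h _] := sn_ratio_bounds i; apply: le_trans h; rewrite mulr_ge0 ?powR_ge0 ?invr_ge0 ?sqr_ge0.
Qed.

Let l_ge0 i : 0 <= l i. Proof. by rewrite hl mulr_ge0 ?sqr_ge0 ?powR_ge0. Qed.
Let x1 i : 0 < 1 + x i. Proof. by rewrite ltr_wpDr// sn_ratio_ge0. Qed.
Let RM0 : 0 < R0 / M. Proof. exact: divr_gt0. Qed.
Let C21 : 1 <= C ^+ 2. Proof. by rewrite exprn_ege1. Qed.

Lemma mean_var_ge0 i : 0 <= mean_var i.
Proof. by rewrite divr_ge0 ?sqr_ge0// mulr_ge0// sn_ratio_ge0. Qed.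

Lemma mean_var_le i : mean_var i <= post_var i.
Proof.
have -> : mean_var i = post_var i * (x i / (1 + x i)).
  by rewrite /mean_var /post_var; field; rewrite gt_eqF.
rewrite ler_piMr ?divr_ge0 ?(ltW (x1 i))// ler_pdivrMr// mul1r lerDr.
exact: ler01.
Qed.

(** Beyond M the prior variance is itself at most R0 / M; below M the ratio x_i
is at least a multiple of (M / i)^q, and q >= 1 + 2 alpha. *)
Lemma post_var_ub i : post_var i <= C ^+ 2 * (R0 / M).
Proof.
rewrite /post_var ler_pdivrMr//; have x0 := sn_ratio_ge0 i.
have [y1|y1] := lerP (y i) 1.
  rewrite prior_var_scaled.
  have h : y i `^ (1 + 2 * alpha) <= 1.
    by rewrite -[leRHS](powRr0 (y i)) ger_powR ?y0 ?y1//; move: halpha => ?; lra.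
  apply: (@le_trans _ _ (R0 / M * 1)); first by rewrite ler_wpM2l ?(ltW RM0).
  rewrite mulr1 [leRHS]mulrAC -[leLHS]mul1r ler_wpM2r ?(ltW RM0)//.
  by rewrite -[leLHS]mulr1 ler_pM// lerDl.
rewrite prior_var_scaled [C ^+ 2 * _]mulrC -[leRHS]mulrA ler_wpM2l ?(ltW RM0)//.
apply: (@le_trans _ _ (C ^+ 2 * x i)).
  have /andP[+ _] := sn_ratio_bounds i.
  rewrite ler_pdivrMl ?exprn_gt0//; apply: le_trans.
  by rewrite ler_powR ?(ltW y1)// /smooth_exp; move: hp => ?; lra.
by rewrite ler_wpM2l ?exprn_ge0 ?(ltW C0)// lerDr.
Qed.

Hypothesis M1 : 1 <= M.
Definition cutoff : nat := Num.truncn M.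
Local Notation m0 := cutoff.

Let m0_gt0 : (0 < m0)%N. Proof. by rewrite truncn_gt0. Qed.
Let m0_le : m0%:R <= M. Proof. by rewrite truncn_le ltW. Qed.
Let m0_lt : M < m0.+1%:R. Proof. exact: truncnS_gt. Qed.
Let m0_half : M <= 2 * m0%:R.
Proof.
apply: (le_trans (ltW m0_lt)); rewrite -natr1 mulr_natl mulr2n lerD2l.
by rewrite ler1n.
Qed.

Definition var_const := C ^+ 2 + 2 `^ (2 * alpha) / (2 * alpha).

(** The first M terms are at most C^2 R0 / M each; the others are at most the
prior variances, whose sum telescopes by [tail_step]. *)
Lemma sum_post_var_ub k : \sum_(j < k) post_var j <= var_const * R0.
Proof.
have head k' : (k' <= m0)%N -> \sum_(j < k') post_var j <= C ^+ 2 * R0.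
  move=> k'm; apply: (@le_trans _ _ (\sum_(j < k') C ^+ 2 * (R0 / M))).
    by apply: ler_sum => j _; exact: post_var_ub.
  rewrite sumr_const card_ord -mulr_natl mulrCA ler_wpM2l ?exprn_ge0 ?(ltW C0)//.
  rewrite mulrCA -[leRHS]mulr1 ler_wpM2l ?(ltW R00)// ler_pdivrMr// mul1r.
  by apply: le_trans m0_le; rewrite ler_nat.
have a2 : 0 < 2 * alpha by rewrite mulr_gt0.
pose D := tau ^+ 2 * (2 * alpha)^-1.
have D0 : 0 <= D by rewrite mulr_ge0 ?sqr_ge0// invr_ge0 ltW.
have tail d : \sum_(j < m0 + d) post_var j <=
    C ^+ 2 * R0 + D * (m0%:R `^ (- (2 * alpha)) - (m0 + d)%:R `^ (- (2 * alpha))).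
  elim: d => [|d IH]; first by rewrite addn0 subrr mulr0 addr0 head.
  rewrite addnS big_ord_recr/=.
  have w1 : 1 < (m0 + d).+1%:R :> R by rewrite ltr1n ltnS ltn_addr.
  have := tail_step a2 w1; rewrite -natr1 addrK natr1 => st.
  have pv : post_var (m0 + d) <= tau ^+ 2 * (m0 + d).+1%:R `^ (- 1 - 2 * alpha).
    rewrite -hl /post_var ler_pdivrMr// ler_peMr// lerDl; exact: sn_ratio_ge0.
  have := ler_wpM2l (sqr_ge0 tau) st; rewrite mulrA -/D => st'.
  have := lerD IH (le_trans pv st'); lra.
have R0E : tau ^+ 2 = R0 * M `^ (2 * alpha).
  by rewrite /R0 -mulrA -powR_add// (_ : _ + _ = 0) ?powRr0 ?mulr1//; ring.
have Dm : D * m0%:R `^ (- (2 * alpha)) <= 2 `^ (2 * alpha) / (2 * alpha) * R0.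
  have h : m0%:R `^ (- (2 * alpha)) <= (M / 2) `^ (- (2 * alpha)).
    apply: powR_base_ge; first by rewrite divr_gt0.
      by rewrite ler_pdivrMr// mulrC.
    by rewrite oppr_le0 ltW.
  apply: (le_trans (ler_wpM2l D0 h)).
  rewrite powR_divl// opprK /D R0E.
  rewrite [leLHS](_ : _ = 2 `^ (2 * alpha) / (2 * alpha) * R0 * (M `^ (2 * alpha) * M `^ (- (2 * alpha)))).
    by rewrite -powR_add// subrr powRr0 mulr1.
  by ring.
rewrite /var_const mulrDl; have [km|/ltnW mk] := leqP k m0.
  by apply: (le_trans (head _ km)); rewrite lerDl; nonneg.
rewrite -(subnKC mk); apply: (le_trans (tail _)); rewrite lerD2l.
apply: le_trans Dm; rewrite ler_wpM2l// lerBlDr lerDl; exact: powR_ge0.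
Qed.

Lemma sum_post_var_sqr_ub k : \sum_(j < k) post_var j ^+ 2 <= C ^+ 2 * var_const * (R0 ^+ 2 / M).
Proof.
apply: (@le_trans _ _ (\sum_(j < k) C ^+ 2 * (R0 / M) * post_var j)).
  apply: ler_sum => j _; rewrite expr2 ler_wpM2r ?post_var_ub//.
  by rewrite divr_ge0// ltW.
rewrite -mulr_sumr; apply: (@le_trans _ _ (C ^+ 2 * (R0 / M) * (var_const * R0))).
  by rewrite ler_wpM2l ?sum_post_var_ub// mulr_ge0 ?exprn_ge0 ?(ltW C0) ?(ltW RM0).
by rewrite le_eqVlt; apply/orP; left; apply/eqP; ring.
Qed.

(** A lower bound for the window terms of [mean_var] and of the gap, in units of
R0 / M, times 1/2 because the window has at least M / 2 indices. *)
Definition low_const := 2 `^ (- 1 - 2 * alpha) * (C ^- 2 * 2 `^ (- q)) / (1 + C ^+ 2) ^+ 2 / 2.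

Lemma low_const_gt0 : 0 < low_const.
Proof. by rewrite !divr_gt0 ?mulr_gt0 ?powR_gt0 ?invr_gt0 ?exprn_gt0 ?addr_gt0 ?exprn_gt0. Qed.

Lemma window_ratio j : (m0 <= j < m0.*2)%N -> 2^-1 <= y j <= 1.
Proof.
move=> /andP[mj jm]; rewrite /y ler_pdivlMr// ler_pdivrMr// mul1r; apply/andP; split.
  rewrite ler_pdivrMl//; apply: (@le_trans _ _ (m0.*2)%:R); first by rewrite ler_nat.
  by rewrite -mul2n natrM ler_wpM2l.
by apply: (le_trans (ltW m0_lt)); rewrite ler_nat.
Qed.

Lemma window_sn_ratio j : (m0 <= j < m0.*2)%N -> C ^- 2 * 2 `^ (- q) <= x j <= C ^+ 2.
Proof.
move=> /window_ratio/andP[y1 y2]; have /andP[x1' x2'] := sn_ratio_bounds j; apply/andP; split.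
  apply: le_trans x1'; rewrite ler_wpM2l ?invr_ge0 ?exprn_ge0 ?(ltW C0)//.
  by rewrite powR_inv2; apply: powR_base_le => //; exact: ltW.
apply: (le_trans x2'); rewrite ler_piMr ?exprn_ge0 ?(ltW C0)//.
by rewrite -[leRHS](powRr0 (y j)) ger_powR ?y0 ?y2// ltW.
Qed.

Lemma window_prior_var j : (m0 <= j < m0.*2)%N -> 2 `^ (- 1 - 2 * alpha) * (R0 / M) <= l j.
Proof.
move=> /window_ratio/andP[y1 y2]; rewrite prior_var_scaled mulrC ler_wpM2l ?(ltW RM0)//.
rewrite (_ : - 1 - 2 * alpha = - (1 + 2 * alpha)); last by ring.
by rewrite powR_inv2; apply: powR_base_le => //; move: halpha => ?; lra.
Qed.

(** Lower bounds come from the window of indices between M and 2 M, where all the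
ratios are of order 1. *)
Lemma window_sum (f : nat -> R) (b : R) : (forall j, 0 <= f j) -> 0 <= b ->
  (forall j, (m0 <= j < m0.*2)%N -> b <= f j) ->
  M * b / 2 <= \sum_(j < m0.*2) f j.
Proof.
move=> f0 b0 fb; rewrite -(big_mkord xpredT f) (@big_cat_nat _ _ _ m0)//=; last by rewrite -addnn leq_addr.
apply: (@le_trans _ _ (\sum_(m0 <= j < m0.*2) b)).
  rewrite sumr_const_nat -addnn addnK -[leRHS]mulr_natl ler_pdivrMr// [leRHS]mulrAC ler_wpM2r//.
  by rewrite mulrC.
rewrite -[leLHS]add0r lerD ?sumr_ge0//.
by apply: ler_sum_nat.
Qed.

Let x0 : R := C ^- 2 * 2 `^ (- q).
Let x01 : x0 <= 1.
Proof.
rewrite /x0 mulr_ile1 ?powR_ge0 ?invr_ge0 ?exprn_ge0 ?(ltW C0)//.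
  by rewrite invf_le1 ?exprn_gt0.
by rewrite -[leRHS](powRr0 2) ler_powR ?ler1n// oppr_le0 ltW.
Qed.

Lemma low_constE : M * (2 `^ (- 1 - 2 * alpha) * (R0 / M) * x0 / (1 + C ^+ 2) ^+ 2) / 2 = low_const * R0.
Proof.
have h1 : 1 + C ^+ 2 != 0 by rewrite gt_eqF// addr_gt0 ?exprn_gt0.
have h2 : M != 0 by rewrite gt_eqF.
by rewrite /low_const -/x0; field; rewrite h1 h2.
Qed.

Lemma sum_mean_var_lb : low_const * R0 <= \sum_(j < m0.*2) mean_var j.
Proof.
rewrite -low_constE; apply: window_sum; first exact: mean_var_ge0.
  nonneg.
move=> j jw; have /andP[xl xu] := window_sn_ratio jw; have lb := window_prior_var jw.
rewrite /mean_var; apply: ler_pM.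
- nonneg.
- nonneg.
- apply: ler_pM => //; nonneg.
- have h1 : 0 < (1 + C ^+ 2) ^+ 2 by rewrite exprn_gt0// addr_gt0// exprn_gt0.
  have h2 : 0 < (1 + x j) ^+ 2 by exact: exprn_gt0.
  rewrite lef_pV2 ?posrE//.
  by rewrite lerXn2r ?nnegrE ?(ltW (x1 j)) ?lerD2l//; nonneg.
Qed.

(** The posterior is strictly more spread out than its own mean: on the window
the gap [l / (1 + x)^2] keeps a fixed proportion of the prior variance. *)
Lemma sum_gap_lb : low_const * R0 <= \sum_(j < m0.*2) (post_var j - mean_var j).
Proof.
have E j : post_var j - mean_var j = l j / (1 + x j) ^+ 2.
  by rewrite /post_var /mean_var; field; rewrite gt_eqF.
rewrite -low_constE; apply: (@window_sum (fun j => post_var j - mean_var j)).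
- by move=> j; rewrite subr_ge0 mean_var_le.
- nonneg.
move=> j jw; have /andP[xl xu] := window_sn_ratio jw; have lb := window_prior_var jw.
rewrite E; apply: ler_pM.
- nonneg.
- nonneg.
- apply: le_trans lb; rewrite ler_piMr//; nonneg.
- have h1 : 0 < (1 + C ^+ 2) ^+ 2 by rewrite exprn_gt0// addr_gt0// exprn_gt0.
  have h2 : 0 < (1 + x j) ^+ 2 by exact: exprn_gt0.
  rewrite lef_pV2 ?posrE//.
  by rewrite lerXn2r ?nnegrE ?(ltW (x1 j)) ?lerD2l//; nonneg.
Qed.

(** The bias in coordinate i of a signal with Sobolev norm 1 along e_i. *)
Definition bias_weight (beta : R) (i : nat) := i.+1%:R `^ (- beta) / (1 + x i).

(** The weight is at most w^(-b) times min (1, C^2 (w / M)^q), and w^(-b) (w / M)^q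
increases up to w = M since b <= q. *)
Lemma bias_weight_ub beta b i : 0 <= b -> b <= beta -> b <= q ->
  0 <= bias_weight beta i <= C ^+ 2 * M `^ (- b).
Proof.
move=> b0 bb bq; have := sn_ratio_ge0 i => x0'.
apply/andP; split; first by rewrite /bias_weight; apply: divr_ge0; [nonneg|exact: ltW].
rewrite /bias_weight ler_pdivrMr//.
have wb : i.+1%:R `^ (- beta) <= i.+1%:R `^ (- b) :> R.
  by rewrite ler_powR ?ler1n// lerN2.
apply: (le_trans wb); have [y1|y1] := lerP (y i) 1.
  apply: (@le_trans _ _ (M `^ (- b))).
    apply: powR_base_ge => //; last by rewrite oppr_le0.
    by move: y1; rewrite /y ler_pdivrMr// mul1r.
  rewrite mulrAC -[leLHS]mul1r ler_wpM2r ?powR_ge0//.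
  by rewrite -[leLHS]mulr1 ler_pM// lerDl.
have E : i.+1%:R `^ (- b) = M `^ (- b) * y i `^ b.
  rewrite /y powR_divl// mulrA -powR_add// (_ : - b + b = 0) ?powRr0 ?mul1r//; ring.
rewrite E [leRHS]mulrAC mulrC ler_wpM2r ?powR_ge0//.
have yq : y i `^ b <= y i `^ q by rewrite ler_powR// ltW.
apply: (le_trans yq); have /andP[+ _] := sn_ratio_bounds i.
rewrite ler_pdivrMl ?exprn_gt0// => /le_trans; apply.
by rewrite ler_wpM2l ?exprn_ge0 ?(ltW C0)// lerDr.
Qed.

(** For a fixed coordinate the bias decreases at the rate M^(-q), faster than the
worst case when beta < q. *)
Lemma bias_weight_head beta i :
  bias_weight beta i <= C ^+ 2 * M `^ (- q) * i.+1%:R `^ (q - beta).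
Proof.
rewrite /bias_weight ler_pdivrMr//.
rewrite (_ : q - beta = - beta + q); last by ring.
rewrite powR_add// -[leLHS]mulr1 [leRHS](_ : _ = i.+1%:R `^ (- beta) *
  (C ^+ 2 * (M `^ (- q) * i.+1%:R `^ q) * (1 + x i))); last by ring.
rewrite ler_wpM2l ?powR_ge0//.
have /andP[+ _] := sn_ratio_bounds i; rewrite /y powR_divl//.
have Mq : 0 < M `^ q by exact: powR_gt0.
have wq : 0 < i.+1%:R `^ q :> R by exact: powR_gt0.
rewrite !powRN => h.
have c2 : 0 < C ^+ 2 by rewrite exprn_gt0.
have : C ^+ 2 * ((M `^ q)^-1 * i.+1%:R `^ q) * (C ^- 2 * (M `^ q / i.+1%:R `^ q)) = 1.
  by field; rewrite !gt_eqF.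
move=> E1; rewrite -[leLHS]E1 ler_wpM2l//; first by nonneg.
by apply: (le_trans h); rewrite lerDr.
Qed.

(** The worst coordinate for the bias: near M when beta <= q, and the first one
otherwise, where the bias does not decrease faster than M^(-q). *)
Definition bias_idx (beta : R) : nat := if beta <= q then m0.-1 else 0%N.

Lemma bias_weight_lb beta : 0 < beta ->
  M `^ (- Num.min beta q) / (1 + C ^+ 2 * 2 `^ q) <= bias_weight beta (bias_idx beta).
Proof.
move=> b0; have c2 : 0 < C ^+ 2 by rewrite exprn_gt0.
have tq : 1 <= 2 `^ q by rewrite -[leLHS](powRr0 2) ler_powR ?ler1n// ltW.
have A0 : 0 < 1 + C ^+ 2 * 2 `^ q by rewrite addr_gt0// mulr_gt0// powR_gt0.
rewrite /bias_weight /bias_idx; case: ifPn => [bq|].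
  have mS : m0.-1.+1 = m0 by rewrite prednK.
  rewrite (min_idPl bq) mS; apply: ler_pM; [exact: powR_ge0|by rewrite invr_ge0 ltW| |].
    by apply: powR_base_ge => //; rewrite ?ltr0n// oppr_le0 ltW.
  rewrite lef_pV2 ?posrE// lerD2l; have /andP[_ h] := sn_ratio_bounds m0.-1.
  apply: (le_trans h); rewrite ler_wpM2l ?(ltW c2)//.
  by apply: powR_base_le => //; rewrite ?(ltW q0)// /y mS ler_pdivrMr ?ltr0n.
rewrite -ltNge => qb; rewrite (min_idPr (ltW qb)) powR1 mul1r powRN -invfM.
have Mq : 1 <= M `^ q by rewrite -[leLHS](powRr0 M) ler_powR// ltW.
rewrite lef_pV2 ?posrE//; last by rewrite mulr_gt0// powR_gt0.
have /andP[_ h] := sn_ratio_bounds 0.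
apply: (le_trans (lerD (lexx 1) h)); rewrite /y divr1 mulrDr mulr1 lerD//.
rewrite mulrC ler_wpM2l ?powR_ge0// -[leLHS]mulr1 ler_wpM2l// ltW//.
Qed.

(** A single element, spread over all coordinates, whose bias inside the window is
as large as that of a signal of smoothness b. *)
Lemma window_bias_sum b : 0 < b ->
  2 `^ (- 2 - 2 * b) / (1 + C ^+ 2) ^+ 2 * M `^ (- 2 * b) <=
  \sum_(j < m0.*2) (j.+1%:R `^ (- 2^-1 - b) / (1 + x j)) ^+ 2.
Proof.
move=> b0; have c2 : 0 < 1 + C ^+ 2 by rewrite addr_gt0// exprn_gt0.
have -> : 2 `^ (- 2 - 2 * b) / (1 + C ^+ 2) ^+ 2 * M `^ (- 2 * b) =
    M * ((2 * M) `^ (- 1 - 2 * b) / (1 + C ^+ 2) ^+ 2) / 2.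
  rewrite powRM ?(ltW M0)// (_ : - 2 - 2 * b = (- 1 - 2 * b) + - 1); last by ring.
  rewrite (_ : - 2 * b = (- 1 - 2 * b) + 1); last by ring.
  rewrite !powR_add// powRr1 ?(ltW M0)// (powR_inv1 (ler0n _ 2)); ring.
apply: (window_sum (f := fun j => (j.+1%:R `^ (- 2^-1 - b) / (1 + x j)) ^+ 2)).
- by move=> j; exact: sqr_ge0.
- by nonneg.
move=> j jw; have /andP[xl xu] := window_sn_ratio jw.
rewrite expr_div_n; apply: ler_pM; [exact: powR_ge0|by nonneg| |].
  rewrite powR_sqr// (_ : 2 * (- 2^-1 - b) = - 1 - 2 * b); last by field.
  apply: powR_base_ge => //; last by move: b0 => ?; lra.
  have /andP[h _] := window_ratio jw; move: h; rewrite /y ler_pdivlMr// => h.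
  by rewrite -ler_pdivrMl// mulrC -ler_pdivlMl//; lra.
have h1 : 0 < (1 + C ^+ 2) ^+ 2 by rewrite exprn_gt0.
have h2 : 0 < (1 + x j) ^+ 2 by exact: exprn_gt0.
rewrite lef_pV2 ?posrE//.
by rewrite lerXn2r ?nnegrE ?(ltW (x1 j)) ?lerD2l ?(ltW c2).
Qed.

End window.

(** * Rates *)

Section rates.
Context {R : realType}.
Implicit Types (u v : nat -> R) (s : R).

Lemma powR_le_of (y z s : R) : 0 < s -> 0 < y -> 0 < z -> y <= z `^ s^-1 -> y `^ s <= z.
Proof.
move=> s0 y0 z0 yz; rewrite -[leRHS](@powRr1 _ z (ltW z0)) -(@mulVf _ s) ?gt_eqF// powRrM.
by apply: powR_base_le => //; exact: ltW.
Qed.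

Lemma powR_ge_of (y z s : R) : 0 < s -> 0 < y -> 0 < z -> z `^ s^-1 <= y -> z <= y `^ s.
Proof.
move=> s0 y0 z0 yz; rewrite -[leLHS](@powRr1 _ z (ltW z0)) -(@mulVf _ s) ?gt_eqF// powRrM.
by apply: powR_base_le; rewrite ?powR_gt0// ltW.
Qed.

Lemma much_smaller_powR_le u v s eps : (forall n, (0 < n)%N -> 0 < u n) ->
  (forall n, (0 < n)%N -> 0 < v n) -> 0 < s -> 0 < eps -> much_smaller u v ->
  \forall n \near \oo, (u n / v n) `^ s <= eps.
Proof.
move=> u0 v0 s0 e0 uv; have z0 : 0 < eps `^ s^-1 by exact: powR_gt0.
near=> n; have n0 : (0 < n)%N by near: n; exact: nbhs_infty_gt.
have r0 : 0 < u n / v n by rewrite divr_gt0 ?u0 ?v0.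
apply: powR_le_of => //; apply: ltW; near: n.
have /cvgrPdist_lt/(_ _ z0) := uv; apply: filterS => n.
by rewrite sub0r normrN; apply: le_lt_trans; exact: ler_norm.
Unshelve. all: end_near. Qed.

Lemma much_smaller_powR_ge u v s B : (forall n, (0 < n)%N -> 0 < u n) ->
  (forall n, (0 < n)%N -> 0 < v n) -> 0 < s -> 0 < B -> much_smaller u v ->
  \forall n \near \oo, B <= (v n / u n) `^ s.
Proof.
move=> u0 v0 s0 B0 uv; have B10 : 0 < B^-1 by rewrite invr_gt0.
have h := much_smaller_powR_le u0 v0 s0 B10 uv.
near=> n; have n0 : (0 < n)%N by near: n; exact: nbhs_infty_gt.
have r0 : 0 < u n / v n by rewrite divr_gt0 ?u0 ?v0.
have hn : (u n / v n) `^ s <= B^-1 by near: n.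
rewrite -[v n / u n]invrK invf_div -powR_inv1 ?(ltW r0)// -powRrM mulN1r powRN.
by rewrite -[leLHS]invrK lef_pV2 ?posrE// powR_gt0.
Unshelve. all: end_near. Qed.

Lemma same_order_powR u v s : (forall n, (0 < n)%N -> 0 < u n) ->
  (forall n, (0 < n)%N -> 0 < v n) -> 0 < s -> same_order u v ->
  exists2 B, 0 < B & \forall n \near \oo, B^-1 <= (v n / u n) `^ s <= B.
Proof.
move=> u0 v0 s0 [c [C [c0 cC]]].
pose D := Num.max C 1; have D0 : 0 < D by rewrite lt_max ltr01 orbT.
pose B := Num.max (c^-1 `^ s) (D `^ s).
have B0 : 0 < B by rewrite lt_max powR_gt0 ?invr_gt0.
exists B => //; near=> n; have n0 : (0 < n)%N by near: n; exact: nbhs_infty_gt.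
have r0 : 0 < v n / u n by rewrite divr_gt0 ?u0 ?v0.
have : c <= `|u n / v n| <= C by near: n.
have i0 : 0 < u n / v n by rewrite divr_gt0 ?u0 ?v0.
rewrite gtr0_norm// => /andP[h1 h2]; apply/andP; split.
  apply: le_trans (_ : (D `^ s)^-1 <= _).
    by rewrite lef_pV2 ?posrE ?powR_gt0// le_max lexx orbT.
  rewrite -powRN -mulN1r powRrM powR_inv1 ?(ltW D0)//.
  apply: powR_base_le; rewrite ?invr_gt0//; last exact: ltW.
  rewrite -[v n / u n]invrK lef_pV2 ?posrE ?invr_gt0//.
  by rewrite invf_div le_max h2.
apply: le_trans (_ : c^-1 `^ s <= _); last by rewrite le_max lexx.
apply: powR_base_le => //; last exact: ltW.
by rewrite -[leLHS]invrK lef_pV2 ?posrE ?invr_gt0// invf_div.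
Unshelve. all: end_near. Qed.

End rates.

Section eff_dim_rate.
Context {R : realType} (alpha p : R).
Hypotheses (halpha : 0 < alpha) (hp : 0 <= p).
Local Notation q := (smooth_exp alpha p).

Let q0 : 0 < q. Proof. by move: halpha hp => ? ?; rewrite /smooth_exp; lra. Qed.

(** Compares the squared bias M^(-2 b) with R0: both sides are powers of n and
tau, and the exponents agree. *)
Lemma eff_dim_rate (n : nat) (tau b : R) : (0 < n)%N -> 0 < tau -> 0 <= b ->
  eff_dim alpha p n tau `^ (- 2 * b) = eff_size alpha p n tau *
  (n%:R `^ ((alpha - b) / (1 + 2 * b + 2 * p)) / tau) `^ (2 * (1 + 2 * b + 2 * p) / q).
Proof.
move=> n0 t0 b0; have nR : 0 < n%:R :> R by rewrite ltr0n.
have d0 : 0 < 1 + 2 * b + 2 * p by move: hp => ?; lra.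
have t2 : tau ^+ 2 = tau `^ 2 by rewrite -powR_mulrn// ltW.
have E r : eff_dim alpha p n tau `^ r = n%:R `^ (r / q) * tau `^ (2 * r / q).
  rewrite /eff_dim t2 -powRrM powRM ?powR_ge0 ?(ltW nR)// -powRrM.
  by congr (_ `^ _ * _ `^ _); rewrite ?[_^-1 * _]mulrC// mulrA mulrAC.
rewrite /eff_size !E t2 powR_divl ?powR_gt0// -powRrM.
rewrite (_ : - 2 * b / q = - 2 * alpha / q + (alpha - b) / (1 + 2 * b + 2 * p) * (2 * (1 + 2 * b + 2 * p) / q)); last first.
  by field; rewrite !gt_eqF.
rewrite (_ : 2 * (- 2 * b) / q = 2 + 2 * (- 2 * alpha) / q + - (2 * (1 + 2 * b + 2 * p) / q)); last first.
  by rewrite /smooth_exp; field; rewrite -/(smooth_exp alpha p) gt_eqF.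
by rewrite !powR_add//; ring.
Qed.

Lemma eff_dim_diverges (tau : nat -> R) (B : R) :
  (fun n => n%:R * tau n ^+ 2) @ \oo --> +oo ->
  \forall n \near \oo, B <= eff_dim alpha p n (tau n).
Proof.
move=> /cvgryPge/(_ ((Num.max B 1) `^ q)) h; near=> n.
have D0 : 0 < Num.max B 1 by rewrite lt_max ltr01 orbT.
apply: le_trans (_ : Num.max B 1 <= _); first by rewrite le_max lexx.
rewrite /eff_dim; apply: powR_ge_of; rewrite ?invr_gt0// ?invrK.
  by apply: lt_le_trans (_ : (Num.max B 1) `^ q <= _); [exact: powR_gt0|near: n].
by near: n.
Unshelve. all: end_near. Qed.

End eff_dim_rate.

(** * Bias over Sobolev balls *)

Section series_facts.
Context {R : realType}.

Lemma nneg_sum_limit (v : nat -> R) (B : R) : (forall j, 0 <= v j) ->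
  (forall k, \sum_(j < k) v j <= B) ->
  exists E, [/\ (fun k => \sum_(j < k) v j) @ \oo --> E,
    forall k, \sum_(j < k) v j <= E & E <= B].
Proof.
move=> v0 vB; pose S k := \sum_(j < k) v j.
have ndS : nondecreasing_seq S.
  by apply/nondecreasing_seqP => k; rewrite /S big_ord_recr/= lerDl.
have cS : cvgn S.
  by apply: nondecreasing_is_cvgn => //; exists B => _ [k _ <-]; exact: vB.
exists (limn S); split => //.
  by move=> k; exact: (nondecreasing_cvgn_le ndS cS k).
by apply: limr_le => //; apply: nearW.
Qed.

Lemma nneg_sum_tail (v : nat -> R) (B eta : R) : (forall j, 0 <= v j) ->
  (forall k, \sum_(j < k) v j <= B) -> 0 < eta ->
  exists J, forall k, \sum_(j < k | (J <= j)%N) v j <= eta.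
Proof.
move=> v0 vB e0; have [E [cE ubE _]] := nneg_sum_limit v0 vB.
have /cvgrPdist_lt/(_ _ e0)[J _ hJ] := cE.
exists J => k; have := hJ J (leqnn J); have := ubE J => /= EJ.
rewrite ger0_norm ?subr_ge0// => EJ'.
have [kJ|Jk] := leqP k J.
  by rewrite big_pred0 ?(ltW e0)// => j; apply/negbTE; rewrite -ltnNge (leq_trans (ltn_ord j)).
have := ubE k; rewrite (bigID (fun j : 'I_k => (J <= j)%N))/=.
under [X in _ + X]eq_bigl do rewrite -ltnNge.
rewrite -(big_ord_widen k v (ltnW Jk)).
by move: EJ'; lra.
Qed.

Lemma powR_sum_ub (a : R) k : 0 < a -> \sum_(j < k) j.+1%:R `^ (- 1 - a) <= 1 + a^-1.
Proof.
move=> a0; have ai : 0 < a^-1 by rewrite invr_gt0.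
case: k => [|k]; first by rewrite big_ord0; lra.
suff h : \sum_(j < k.+1) j.+1%:R `^ (- 1 - a) <= 1 + a^-1 * (1 - k.+1%:R `^ (- a)).
  by apply: le_trans h _; have := powR_ge0 (k.+1%:R : R) (- a); nra.
elim: k => [|k IH]; first by rewrite big_ord1 !powR1 subrr mulr0 addr0.
rewrite big_ord_recr/=; have := @tail_step R a k.+2%:R a0 _.
rewrite ltr1n => /(_ isT); rewrite -[in X in X - 1]natr1 addrK.
by move: IH; lra.
Qed.

End series_facts.

Section bias_sums.
Context {R : realType}.
Variables (alpha p C : R).
Hypotheses (halpha : 0 < alpha) (hp : 0 <= p) (hC : 1 <= C).
Variables (n : nat) (tau : R) (l kappa : nat -> R).
Hypotheses (n0 : (0 < n)%N) (tau0 : 0 < tau).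
Hypothesis hl : forall i, l i = tau ^+ 2 * i.+1%:R `^ (- 1 - 2 * alpha).
Hypothesis hk0 : forall i, 0 < kappa i.
Hypothesis hk : forall i, C^-1 * i.+1%:R `^ (- p) <= kappa i <= C * i.+1%:R `^ (- p).
Local Notation q := (smooth_exp alpha p).
Local Notation x := (sn_ratio n l kappa).
Local Notation M := (eff_dim alpha p n tau).
Local Notation bw := (bias_weight n l kappa).

Let M0 : 0 < M. Proof. by rewrite powR_gt0// mulr_gt0 ?ltr0n// exprn_gt0. Qed.

Let bias_term (m beta : R) j :
  (m / (1 + x j)) ^+ 2 = m ^+ 2 * j.+1%:R `^ (2 * beta) * bw beta j ^+ 2.
Proof.
have E : j.+1%:R `^ beta * j.+1%:R `^ (- beta) = 1 :> R.
  by rewrite -powR_add// subrr powRr0.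
rewrite /bias_weight -powR_sqr// -exprMn -exprMn; congr (_ ^+ 2).
by rewrite mulrA -(mulrA m) E mulr1.
Qed.

Lemma sobolev_bias_sum (m : nat -> R) (beta b B : R) : 0 <= b -> b <= beta -> b <= q ->
  (forall k, \sum_(j < k) m j ^+ 2 * j.+1%:R `^ (2 * beta) <= B ^+ 2) ->
  forall k, \sum_(j < k) (m j / (1 + x j)) ^+ 2 <= C ^+ 4 * B ^+ 2 * M `^ (- 2 * b).
Proof.
move=> b0 bb bq hm k.
apply: le_trans (_ : \sum_(j < k) m j ^+ 2 * j.+1%:R `^ (2 * beta) * (C ^+ 2 * M `^ (- b)) ^+ 2 <= _).
  apply: ler_sum => j _; rewrite (bias_term (m j) beta).
  have /andP[w0 w1] := bias_weight_ub halpha hp hC n0 tau0 hl hk0 hk j b0 bb bq.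
  apply: ler_wpM2l; first by rewrite mulr_ge0 ?sqr_ge0 ?powR_ge0.
  by rewrite lerXn2r ?nnegrE// (le_trans w0).
rewrite -mulr_suml exprMn powR_sqr// (_ : 2 * - b = - 2 * b); last by ring.
rewrite (_ : C ^+ 4 * B ^+ 2 * _ = B ^+ 2 * ((C ^+ 2) ^+ 2 * M `^ (- 2 * b))); last by ring.
by rewrite ler_wpM2r// mulr_ge0 ?sqr_ge0 ?powR_ge0.
Qed.

(** Below J the bias weights are of the order M^(-q) J^(q - beta); from J on the
uniform bound applies to a small part of the Sobolev norm. *)
Lemma sobolev_bias_head_tail (m : nat -> R) (beta B eta : R) J : 0 <= beta -> beta <= q ->
  (forall k, \sum_(j < k) m j ^+ 2 * j.+1%:R `^ (2 * beta) <= B ^+ 2) ->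
  (forall k, \sum_(j < k | (J <= j)%N) m j ^+ 2 * j.+1%:R `^ (2 * beta) <= eta) ->
  forall k, \sum_(j < k) (m j / (1 + x j)) ^+ 2 <=
    C ^+ 4 * M `^ (- 2 * beta) * (B ^+ 2 * (J.+1%:R / M) `^ (2 * (q - beta)) + eta).
Proof.
move=> b0 bq hm ht k; pose t j := m j ^+ 2 * j.+1%:R `^ (2 * beta).
have t0 j : 0 <= t j by rewrite mulr_ge0 ?sqr_ge0 ?powR_ge0.
pose c2 := C ^+ 2 * M `^ (- beta); pose c1 := c2 * (J.+1%:R / M) `^ (q - beta).
have c20 : 0 <= c2 by rewrite mulr_ge0 ?sqr_ge0 ?powR_ge0.
have c10 : 0 <= c1 by rewrite mulr_ge0 ?powR_ge0.
have E1 : c1 ^+ 2 = C ^+ 4 * M `^ (- 2 * beta) * (J.+1%:R / M) `^ (2 * (q - beta)).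
  rewrite /c1 /c2 !exprMn !powR_sqr ?divr_gt0//.
  by rewrite (_ : 2 * - beta = - 2 * beta); ring.
have E2 : c2 ^+ 2 = C ^+ 4 * M `^ (- 2 * beta).
  by rewrite /c2 !exprMn powR_sqr// (_ : 2 * - beta = - 2 * beta); ring.
apply: le_trans (_ : \sum_(j < k) (t j * c1 ^+ 2 + (if (J <= j)%N then t j * c2 ^+ 2 else 0)) <= _).
  apply: ler_sum => j _; rewrite (bias_term (m j) beta) -/(t j).
  have /andP[w0 w1] := bias_weight_ub halpha hp hC n0 tau0 hl hk0 hk j b0 (lexx beta) bq.
  case: ifP => Jj.
    apply: le_trans (_ : t j * c2 ^+ 2 <= _).
      by rewrite ler_wpM2l// lerXn2r ?nnegrE.
    by rewrite lerDr mulr_ge0 ?sqr_ge0.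
  rewrite addr0 ler_wpM2l// lerXn2r ?nnegrE//.
  apply: le_trans (bias_weight_head halpha hp hC n0 tau0 hl hk0 hk beta j) _.
  rewrite /c1 /c2 powR_divl// -(mulrA (C ^+ 2) (M `^ (- q))) -(mulrA (C ^+ 2) (M `^ (- beta))) ler_wpM2l ?sqr_ge0//.
  rewrite (_ : - q = - beta + - (q - beta)); last by ring.
  rewrite (powR_add _ _ M0) -mulrA ler_wpM2l ?powR_ge0// mulrC ler_wpM2r ?powR_ge0//.
  apply: powR_base_le; rewrite ?subr_ge0// ler_nat ltnS.
  by rewrite leqNgt; apply/negP => /ltnW; rewrite Jj.
rewrite big_split/= -mulr_suml -big_mkcond/= -mulr_suml E1 E2.
have h1 := hm k; have h2 := ht k.
have M20 := powR_ge0 M (- 2 * beta); have C40 : 0 <= C ^+ 4 by apply: exprn_ge0; exact: le_trans hC.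
have h3 := ler_wpM2r (mulr_ge0 (mulr_ge0 C40 M20) (powR_ge0 (J.+1%:R / M) (2 * (q - beta)))) h1.
have h4 := ler_wpM2r (mulr_ge0 C40 M20) h2.
by move: h3 h4; rewrite /t; lra.
Qed.

Lemma basis_signal_bias (M1 : 1 <= M) (beta T : R) i : 0 < beta ->
  i = bias_idx alpha p n tau beta ->
  T ^+ 2 / (1 + C ^+ 2 * 2 `^ q) ^+ 2 * M `^ (- 2 * Num.min beta q) <=
  (T * i.+1%:R `^ (- beta) / (1 + x i)) ^+ 2.
Proof.
move=> b0 iE; have h := bias_weight_lb halpha hp hC n0 tau0 hl hk0 hk M1 b0.
rewrite -iE in h.
rewrite -[T ^+ 2 / _ * _]mulrA -(mulrA T) exprMn ler_wpM2l ?sqr_ge0// -/(bw beta i).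
have c0 : 0 < 1 + C ^+ 2 * 2 `^ q by rewrite ltr_wpDr// mulr_ge0 ?sqr_ge0 ?powR_ge0.
have g0 : 0 <= M `^ (- Num.min beta q) / (1 + C ^+ 2 * 2 `^ q).
  by rewrite divr_ge0 ?powR_ge0 ?(ltW c0).
apply: le_trans (_ : (M `^ (- Num.min beta q) / (1 + C ^+ 2 * 2 `^ q)) ^+ 2 <= _).
  rewrite exprMn powR_sqr// exprVn mulrC (_ : 2 * - Num.min beta q = - 2 * Num.min beta q)//.
  by ring.
by rewrite lerXn2r ?nnegrE// (le_trans g0).
Qed.

End bias_sums.

(** * Coverage of balls centred at a shifted Gaussian element *)

Section events.
Context {R : realType} d (T : measurableType d) (P : probability T R).
Implicit Types (G S : set T) (eps : R).

Lemma prob_ge_off G S eps : measurable G -> measurable S -> ~` G `<=` S ->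
  (P G <= eps%:E)%E -> ((1 - eps)%:E <= P S)%E.
Proof.
move=> mG mS GS PG; apply: (@le_trans _ _ (P (~` G))); last first.
  by apply: le_measure => //; rewrite inE//; exact: measurableC.
by rewrite probability_setC// EFinB leeB.
Qed.

Lemma prob_le_on G S eps : measurable G -> measurable S -> S `<=` G ->
  (P G <= eps%:E)%E -> (P S <= eps%:E)%E.
Proof. by move=> mG mS SG; apply: le_trans; apply: le_measure; rewrite ?inE. Qed.

Lemma measurable_lt_level (N : T -> R) x : measurable_fun setT N ->
  measurable [set w | (N w < x)%R].
Proof.
move=> mN; rewrite (_ : [set _ | _] = ~` [set w | (x <= N w)%R]); last first.
  by apply/seteqP; split => w /=; rewrite ltNge => /negP.
apply: measurableC; rewrite -[X in measurable X]setTI.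
exact: measurable_fun_le.
Qed.

(** If N concentrates around E, then so does every quantile of N whose level is
not within eps of 0 or 1. *)
Lemma quantile_close (N : T -> R) (E a x eps gamma : R) :
  measurable_fun setT N ->
  (P [set w | (a <= `|N w - E|)%R] <= eps%:E)%E -> eps < gamma -> eps < 1 - gamma ->
  P [set w | (N w < x)%R] = (1 - gamma)%:E -> `|x - E| < a.
Proof.
move=> mN Peps eg eg' Px.
have mG : measurable [set w | (a <= `|N w - E|)%R].
  rewrite -[X in measurable X]setTI; apply: measurable_fun_le => //.
  apply: measurableT_comp => //; exact: measurable_funB.
have mS : measurable [set w | (N w < x)%R].
  exact: measurable_lt_level.
rewrite ltNge; apply/negP => ax.
have [Ex|xE] := leP E x.
  suff : ((1 - eps)%:E <= P [set w | (N w < x)%R])%E by rewrite Px lee_fin; lra.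
  apply: prob_ge_off Peps => // w /= /negP; rewrite -ltNge ltr_norml => /andP[_ ?].
  by move: ax; rewrite ger0_norm ?subr_ge0//; lra.
suff : (P [set w | (N w < x)%R] <= eps%:E)%E by rewrite Px lee_fin; lra.
apply: prob_le_on Peps => // w /= wx; rewrite ltr0_norm in ax; last by rewrite subr_lt0.
by rewrite ltr0_norm; lra.
Qed.

End events.

Section shifted_ball.
Context {R : realType} {H : normedModType R}.
Context d (T : measurableType d) (P : probability T R).
Variables (X : T -> H) (b : H).
Variables (A L R0 ES ET eps gamma r : R).
Hypotheses (L0 : 0 < L) (R00 : 0 < R0).
Hypotheses (ETlb : L * R0 <= ET) (gap : L * R0 <= ES - ET) (ESub : ES <= A * R0).
Hypothesis mX : measurable_fun setT (fun w => `|X w|).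
Hypothesis mXb : measurable_fun setT (fun w => `|X w + b|).
Hypothesis conc : (P [set w | ((L / 8 * R0) <= `| `|X w| ^+ 2 - ET|)%R] <= eps%:E)%E.
Hypotheses (r0 : 0 < r) (hr : `|r ^+ 2 - ES| < L / 8 * R0).

Let theta := L / (4 * (A + 1)).
(** With |b|^2 at most this multiple of R0, the event |X|^2 < ET + (L / 8) R0 still
gives |X + b|^2 < ES - (L / 8) R0, which is below r^2. *)
Definition bias_const := L / (4 * (1 + theta^-1)).
Local Notation kap := bias_const.

Let LA : L < A.
Proof.
have LR : 0 < L * R0 by exact: mulr_gt0.
by rewrite -(ltr_pM2r R00); move: ETlb gap ESub LR => /=; lra.
Qed.

Let theta0 : 0 < theta.
Proof. by move: L0 LA => *; rewrite divr_gt0//; lra. Qed.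

Let thetaE : theta * (4 * (A + 1)) = L.
Proof. by move: L0 LA => *; rewrite /theta divfK// gt_eqF//; lra. Qed.

Let kapE : kap * (1 + theta^-1) = L / 4.
Proof.
rewrite /kap; have ti : 0 < theta^-1 by rewrite invr_gt0.
by rewrite invfM mulrA -mulrA mulVf ?mulr1// gt_eqF// addr_gt0.
Qed.

Let kap0 : 0 < kap.
Proof. by rewrite divr_gt0// mulr_gt0// addr_gt0// invr_gt0. Qed.

Let kapL : kap <= L / 16.
Proof.
have ti : 4 <= theta^-1.
  rewrite -(@ler_pM2l _ theta)// divff ?gt_eqF//.
  by move: L0 LA thetaE theta0 => *; nra.
by move: kapE kap0 => *; nra.
Qed.

Let mG : measurable [set w | ((L / 8 * R0) <= `| `|X w| ^+ 2 - ET|)%R].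
Proof.
rewrite -[X in measurable X]setTI; apply: measurable_fun_le => //.
apply: measurableT_comp => //; apply: measurable_funB => //.
exact: measurable_funX.
Qed.

Let mB (s : R) : measurable [set w | (`|X w + b| < s)%R].
Proof. exact: measurable_lt_level. Qed.

Let good w : (~` [set w | ((L / 8 * R0) <= `| `|X w| ^+ 2 - ET|)%R]) w ->
  ET - L / 8 * R0 < `|X w| ^+ 2 < ET + L / 8 * R0.
Proof. by move=> /= /negP; rewrite -ltNge ltr_distl. Qed.

Let rb : ES - L / 8 * R0 < r ^+ 2 < ES + L / 8 * R0.
Proof. by rewrite -ltr_distl. Qed.

(** |X + b|^2 is at most (1 + theta) |X|^2 + (1 + 1 / theta) |b|^2, and the gap
L R0 between ES and ET absorbs the excess. *)
Lemma small_bias_covers : `|b| ^+ 2 <= kap * R0 ->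
  ((1 - eps)%:E <= P [set w | (`|X w + b| < r)%R])%E.
Proof.
move=> bk; apply: prob_ge_off conc => // w /good/andP[_ Xw] /=.
have tri := ler_normD (X w) b.
rewrite -(ltr_pXn2r (n := 2)) ?nnegrE ?normr_ge0 ?(ltW r0)//.
apply: le_lt_trans (_ : (`|X w| + `|b|) ^+ 2 < _).
  by rewrite lerXn2r ?nnegrE ?addr_ge0.
apply: le_lt_trans (_ : (1 + theta) * `|X w| ^+ 2 + (1 + theta^-1) * `|b| ^+ 2 < _).
  rewrite -subr_ge0 (_ : _ - _ = theta^-1 * (theta * `|X w| - `|b|) ^+ 2).
    by rewrite mulr_ge0 ?invr_ge0 ?(ltW theta0) ?sqr_ge0.
  by field; rewrite gt_eqF.
have h1 : (1 + theta^-1) * `|b| ^+ 2 <= L / 4 * R0.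
  rewrite -kapE mulrAC [leRHS]mulrC ler_wpM2l//.
  by rewrite addr_ge0// invr_ge0 ltW.
have h2 : theta * ET <= theta * (A * R0) by rewrite ler_wpM2l ?(ltW theta0)//; move: L0 R00 gap ESub => *; nra.
have h3 : theta * (L * R0) <= theta * (A * R0) by rewrite ler_wpM2l ?(ltW theta0)// ler_wpM2r ?ltW.
have h4 : theta * (A * R0) <= L / 4 * R0.
  by rewrite mulrA ler_wpM2r ?(ltW R00)// ; move: L0 LA thetaE theta0 => *; nra.
have h5 : theta * `|X w| ^+ 2 <= theta * (ET + L / 8 * R0) by rewrite ler_wpM2l ?ltW.
have LR : 0 < L * R0 by rewrite mulr_gt0.
by move: rb gap => /andP[? ?] ?; nra.
Qed.

(** On the concentration event |X| and r are both at most sqrt (9 A R0 / 8), so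
that |X + b| < r would make the bias smaller than assumed. *)
Lemma large_bias_misses : 8 * A * R0 <= `|b| ^+ 2 ->
  (P [set w | (`|X w + b| < r)%R] <= eps%:E)%E.
Proof.
move=> bk; apply: prob_le_on conc => // w /= Xb; apply: contrapT => /good/andP[_ Xw].
have tri : `|b| <= `|X w + b| + `|X w|.
  by rewrite -[X in `|X|](addKr (X w)) addrC; apply: le_trans (ler_normB _ _) _.
have s1 : `|b| ^+ 2 <= (r + `|X w|) ^+ 2.
  rewrite lerXn2r ?nnegrE ?addr_ge0 ?(ltW r0)//.
  by apply: le_trans tri _; rewrite lerD2r ltW.
have s2 := sqr_ge0 (r - `|X w|).
have LR : 0 < L * R0 by rewrite mulr_gt0.
have LAR : L * R0 < A * R0 by rewrite ltr_pM2r.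
by move: rb gap ESub => /andP[? ?] ? ?; nra.
Qed.

Variable rt : R.
Hypotheses (egamma : eps < gamma) (egamma' : eps < 1 - gamma).
Hypothesis hrt : P [set w | (`|X w + b| < rt)%R] = (1 - gamma)%:E.

(** With a small bias |X + b| has the order sqrt R0 with high probability, from
above and from below, so its quantile has this order too. *)
Lemma confidence_radius_order : 0 <= eps -> `|b| ^+ 2 <= kap * R0 ->
  L / (9 * A) <= `|rt / r| <= 4 * A / L.
Proof.
move=> eps0 bk; have A0 : 0 < A by exact: lt_trans LA.
have LR : 0 < L * R0 by rewrite mulr_gt0.
have LAR : L * R0 < A * R0 by rewrite ltr_pM2r.
have bk' : `|b| ^+ 2 <= L / 16 * R0.
  by apply: le_trans bk _; rewrite ler_wpM2r ?(ltW R00).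
have rt0 : 0 < rt.
  rewrite ltNge; apply/negP => rt0.
  have := hrt; rewrite (_ : [set _ | _] = set0) ?measure0.
    by case=> e01; move: egamma' eps0 => *; lra.
  by apply/seteqP; split => // w /=; rewrite ltNge (le_trans rt0).
have up : rt ^+ 2 < 4 * A * R0.
  rewrite ltNge; apply/negP => rtA.
  suff : ((1 - eps)%:E <= P [set w | (`|X w + b| < rt)%R])%E.
    by rewrite hrt lee_fin; move: egamma => ?; lra.
  apply: prob_ge_off conc => // w /good/andP[_ Xw] /=; have tri := ler_normD (X w) b.
  rewrite -(ltr_pXn2r (n := 2)) ?nnegrE ?normr_ge0 ?(ltW rt0)//.
  apply: le_lt_trans (_ : (`|X w| + `|b|) ^+ 2 < _).
    by rewrite lerXn2r ?nnegrE ?addr_ge0.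
  have s2 := sqr_ge0 (`|b| - `|X w|).
  by move: gap ESub => ? ?; nra.
have lo : L / 8 * R0 < rt ^+ 2.
  rewrite ltNge; apply/negP => rtL.
  suff : (P [set w | (`|X w + b| < rt)%R] <= eps%:E)%E.
    by rewrite hrt lee_fin; move: egamma' => ?; lra.
  apply: prob_le_on conc => // w /= Xb; apply: contrapT => /good/andP[Xw _].
  have tri : `|X w| <= `|X w + b| + `|b|.
    by rewrite -[X in `|X|](addrK b); apply: le_trans (ler_normB _ _) _.
  have s1 : `|X w| ^+ 2 <= (rt + `|b|) ^+ 2.
    rewrite lerXn2r ?nnegrE ?addr_ge0 ?(ltW rt0)//.
    by apply: le_trans tri _; rewrite lerD2r ltW.
  have s2 := sqr_ge0 (rt - `|b|).
  by move: ETlb => ?; nra.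
have [rlo rup] : L * R0 < r ^+ 2 /\ r ^+ 2 < 9 / 8 * A * R0.
  by move: rb gap ETlb ESub => /andP[? ?] ? ? ?; split; nra.
have LA1 : L / A <= 1 by rewrite ler_pdivrMr// mul1r ltW.
have L90 : 0 < L / (9 * A) by rewrite divr_gt0// mulr_gt0.
have AL40 : 0 < 4 * A / L by rewrite divr_gt0// mulr_gt0.
have AL1 : 1 <= A / L by rewrite ler_pdivlMr// mul1r ltW.
rewrite gtr0_norm ?divr_gt0// ?divr_gt0//; apply/andP; split.
- rewrite ler_pdivlMr//.
  rewrite -(ler_pXn2r (n := 2)) ?nnegrE ?(mulr_ge0 (ltW L90) (ltW r0)) ?(ltW rt0)//.
  rewrite exprMn; have s : (L / (9 * A)) ^+ 2 <= L / (9 * A).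
    rewrite expr2 ler_piMr ?(ltW L90)//; rewrite invfM mulrCA.
    by apply: le_trans (_ : 9^-1 * 1 <= _); [rewrite ler_wpM2l ?invr_ge0|lra].
  apply: le_trans (_ : L / (9 * A) * (9 / 8 * A * R0) <= _).
    by apply: ler_pM; [exact: sqr_ge0|exact: sqr_ge0|exact: s|exact: (ltW rup)].
  by apply: le_trans (ltW lo); rewrite le_eqVlt; apply/orP; left; apply/eqP; field; rewrite gt_eqF.
- rewrite (ler_pdivrMr _ _ r0).
  rewrite -(ler_pXn2r (n := 2)) ?nnegrE ?(mulr_ge0 (ltW AL40) (ltW r0)) ?(ltW rt0)//.
  rewrite exprMn -mulrA; have s : 4 * (A / L) <= (4 * (A / L)) ^+ 2 by nra.
  apply: le_trans (_ : 4 * (A / L) * (L * R0) <= _).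
    apply: le_trans (ltW up) _; rewrite le_eqVlt; apply/orP; left; apply/eqP; field; rewrite gt_eqF//.
  apply: ler_pM; [|exact: (ltW LR)|exact: s|exact: (ltW rlo)].
  by rewrite mulr_ge0// divr_ge0 ?(ltW A0) ?(ltW L0).
Qed.

End shifted_ball.

(** * Coverage at a fixed sample size *)

Section fixed_sample_size.
Context {R : realType} {H1 H2 : normedModType R}.
Variables (ip1 : {dot H1 for idfun}) (ip2 : {dot H2 for idfun}).
Hypotheses (hip1 : induces_norm ip1) (hip2 : induces_norm ip2).
Variables (K : {linear H1 -> H2}) (KT : H2 -> H1).
Hypothesis hKT : is_adjoint ip1 ip2 K KT.
Context d (Omega : measurableType d).
Variables (P : H1 -> probability Omega R) (n : nat) (Y : H2 -> Omega -> R).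
Hypothesis n0 : (0 < n)%N.
Hypothesis hY : forall mu, gaussian_process (P mu) Y
  (fun h => ip2 (K mu) h) (fun h h' => n%:R^-1 * ip2 h h').
Variables (e : nat -> H1) (he : orthonormal_basis ip1 e).
Variable kappa : nat -> R.
Hypothesis hk0 : forall i, 0 < kappa i.
Hypothesis hkappa : forall i, KT (K (e i)) = kappa i ^+ 2 *: e i.
Variables (Lam : {linear H1 -> H1}) (l : nat -> R).
Hypotheses (hLamcont : continuous Lam) (hLam : forall i, Lam (e i) = l i *: e i).
Variable AT : H1 -> H2.
Hypothesis hAT : is_adjoint ip2 ip1 (posterior_mean_op K KT Lam n) AT.
Variable AY : Omega -> H1.
Hypothesis hAY : forall mu, represents (P mu) ip1 (fun h => Y (AT h)) AY.
Variable Pi : Omega -> probability (borel H1) R.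
Hypothesis hPi : forall w,
  gaussian_measure ip1 (Pi w) (AY w) (posterior_cov_op K KT Lam n AT).
Variables (alpha p C gamma tau : R).
Hypotheses (halpha : 0 < alpha) (hp : 0 <= p) (hC : 1 <= C).
Hypotheses (hgamma : 0 < gamma < 1) (tau0 : 0 < tau).
Hypothesis hl : forall i, l i = tau ^+ 2 * i.+1%:R `^ (- 1 - 2 * alpha).
Hypothesis hk : forall i, C^-1 * i.+1%:R `^ (- p) <= kappa i <= C * i.+1%:R `^ (- p).
Variable r : R.
Hypothesis hr : forall w, Pi w (ball (AY w) r) = (1 - gamma)%:E.
Variable rt : H1 -> R.
Hypothesis hrt : forall mu, P mu [set w | ball (AY w) (rt mu) mu] = (1 - gamma)%:E.

Local Notation x := (sn_ratio n l kappa).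
Local Notation M := (eff_dim alpha p n tau).
Local Notation R0 := (eff_size alpha p n tau).
Local Notation A := (var_const alpha C).
Local Notation L := (low_const alpha p C).

(** Chebyshev's bound [2 Q / a^2] for a = (L / 8) R0 and Q = C^2 A R0^2 / M is this
constant divided by M. *)
Definition conc_const (alpha p C : R) : R :=
  128 * C ^+ 2 * var_const alpha C / low_const alpha p C ^+ 2.
Local Notation err := (conc_const alpha p C / M).

Hypotheses (M1 : 1 <= M) (errg : err < gamma) (errg' : err < 1 - gamma).

Let l0 i : 0 <= l i. Proof. by rewrite hl mulr_ge0 ?sqr_ge0 ?powR_ge0. Qed.
Let nR : 0 < n%:R :> R. Proof. by rewrite ltr0n. Qed.
Let x0 i : 0 <= x i. Proof. exact: (sn_ratio_ge0 halpha hp hC n0 tau0 hl hk0 hk i). Qed.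
Let x1 i : 0 < 1 + x i. Proof. by rewrite ltr_wpDr. Qed.
Let L0 : 0 < L. Proof. exact: low_const_gt0. Qed.
Let M0 : 0 < M. Proof. exact: lt_le_trans M1. Qed.
Let R00 : 0 < R0. Proof. by rewrite mulr_gt0 ?exprn_gt0// powR_gt0. Qed.

Let den i : n%:R^-1 + l i * kappa i ^+ 2 = n%:R^-1 * (1 + x i).
Proof. by rewrite /sn_ratio; field; rewrite gt_eqF. Qed.

Definition mean_bias (mu : H1) : H1 := posterior_mean_op K KT Lam n (K mu) - mu.

Lemma mean_bias_coord mu j : ip1 (mean_bias mu) (e j) = - ip1 mu (e j) / (1 + x j).
Proof.
rewrite /mean_bias ipBl (posterior_mean_coord hip1 hip2 hKT he hkappa n0 hLamcont hLam l0 hAT).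
by rewrite den /sn_ratio; field; rewrite -/(x j) !gt_eqF.
Qed.

Let sampling mu z : gauss_seq (P mu) (fun j w => ip1 (AY w - z) (e j))
  (fun j => x j / (1 + x j) * ip1 mu (e j) - ip1 z (e j)) (mean_var n l kappa).
Proof.
have := sampling_gauss_seq hip1 hip2 hKT he hkappa n0 hLamcont hLam l0 hAT (hY mu) (hAY mu) z.
congr (gauss_seq _ _ _ _); apply/funext => j; rewrite den.
  by congr (_ * _ - _); rewrite /sn_ratio; field; rewrite -/(x j) !gt_eqF.
by rewrite /mean_var /sn_ratio; field; rewrite -/(x j) !gt_eqF.
Qed.

Let posterior w : gauss_seq (Pi w) (fun j (y : borel H1) => ip1 ((y : H1) - AY w) (e j))
  (fun=> 0) (post_var n l kappa).
Proof.
have := posterior_gauss_seq hip1 hip2 hKT he hkappa n0 hLamcont hLam l0 hAT (hPi w).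
congr (gauss_seq _ _ _ _); apply/funext => j; rewrite den.
by rewrite /post_var /sn_ratio; field; rewrite -/(x j) !gt_eqF.
Qed.

Let A0 : 0 <= A.
Proof.
apply: addr_ge0; first exact: sqr_ge0.
by apply: divr_ge0; [exact: powR_ge0|rewrite mulr_ge0// ltW].
Qed.

Let err0 : 0 <= err.
Proof.
apply: divr_ge0; last exact: ltW; apply: divr_ge0; last exact: sqr_ge0.
by apply: mulr_ge0 A0; apply: mulr_ge0; [by []|exact: sqr_ge0].
Qed.

Let kap0 : 0 <= bias_const A L.
Proof.
rewrite /bias_const; have L0' := ltW L0.
apply: divr_ge0 => //; apply: mulr_ge0 => //; apply: addr_ge0 => //.
rewrite invr_ge0; apply: divr_ge0 => //; apply: mulr_ge0 => //; exact: addr_ge0.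
Qed.

Let errE : 2 * (C ^+ 2 * A * (R0 ^+ 2 / M)) / (L / 8 * R0) ^+ 2 = err.
Proof. by rewrite /conc_const; field; rewrite !gt_eqF. Qed.

Let a0 : 0 < L / 8 * R0.
Proof. by apply: mulr_gt0 => //; apply: divr_gt0. Qed.

Let norm_sq (z : H1) : (fun k => \sum_(j < k) ip1 z (e j) ^+ 2) @ \oo --> `|z| ^+ 2.
Proof. exact: parseval. Qed.

Let mean_var0 j : 0 <= mean_var n l kappa j. Proof. exact: (mean_var_ge0 halpha hp hC n0 tau0 hl hk0 hk j). Qed.
Let mean_var_post j : mean_var n l kappa j <= post_var n l kappa j.
Proof. exact: (mean_var_le halpha hp hC n0 tau0 hl hk0 hk j). Qed.

Let m_dist z : measurable_fun setT (fun w => `|AY w - z|).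
Proof.
have [m _ _] := sampling 0 z.
have mN := measurable_sum_sqr_limit m (fun w => @norm_sq (AY w - z)).
rewrite (_ : (fun w => _) = (fun w => Num.sqrt (`|AY w - z| ^+ 2))); last first.
  by apply/funext => w; rewrite sqrtr_sqr normr_id.
by apply: measurableT_comp mN; apply: continuous_measurable_fun; exact: sqrt_continuous.
Qed.

(** The radius is not random and every sample point gives the same equation for
it, so one posterior suffices. *)
Lemma radius_spec : exists ES ET, [/\ L * R0 <= ET, L * R0 <= ES - ET, ES <= A * R0,
  0 < r /\ `|r ^+ 2 - ES| < L / 8 * R0 &
  forall mu, (P mu [set w | (L / 8 * R0 <=
     `| `|AY w - posterior_mean_op K KT Lam n (K mu)| ^+ 2 - ET|)%R] <= err%:E)%E].
Proof.
have sumS := sum_post_var_ub halpha hp hC n0 tau0 hl hk0 hk M1.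
have post0 j : 0 <= post_var n l kappa j by exact: le_trans (mean_var_post j).
have [ES [cES ubS ESA]] := nneg_sum_limit post0 sumS.
have sumT k : \sum_(j < k) mean_var n l kappa j <= A * R0.
  by apply: le_trans (sumS k); apply: ler_sum.
have [ET [cET ubT ETA]] := nneg_sum_limit mean_var0 sumT.
have sumS2 := sum_post_var_sqr_ub halpha hp hC n0 tau0 hl hk0 hk M1.
have sumT2 k : \sum_(j < k) mean_var n l kappa j ^+ 2 <= C ^+ 2 * A * (R0 ^+ 2 / M).
  by apply: le_trans (sumS2 k); apply: ler_sum => j _; rewrite lerXn2r ?nnegrE.
exists ES, ET; split => //.
- by apply: le_trans (ubT _); exact: sum_mean_var_lb.
- have gap0 j : 0 <= post_var n l kappa j - mean_var n l kappa j by rewrite subr_ge0.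
  have cgap : (fun k => \sum_(j < k) (post_var n l kappa j - mean_var n l kappa j)) @ \oo --> ES - ET.
    rewrite (_ : (fun k => _) = (fun k => \sum_(j < k) post_var n l kappa j) - (fun k => \sum_(j < k) mean_var n l kappa j)).
      exact: cvgB.
    by apply/funext => k; rewrite sumrB.
  have [E [cE ubE _]] : exists E, [/\ (fun k => \sum_(j < k) (post_var n l kappa j - mean_var n l kappa j)) @ \oo --> E,
     forall k, \sum_(j < k) (post_var n l kappa j - mean_var n l kappa j) <= E & E <= A * R0].
    apply: (nneg_sum_limit gap0) => k; apply: le_trans (sumS k); apply: ler_sum => j _.
    by rewrite lerBlDr lerDl.
  rewrite (cvg_unique _ cgap cE) //; apply: le_trans (ubE _); exact: sum_gap_lb.
- have [w _] : exists w : Omega, True.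
    apply: contrapT => nw; have := @probability_setT _ _ _ (P 0).
    rewrite (_ : setT = set0) ?measure0; last by apply/seteqP; split => // w _; apply: nw; exists w.
    by case=> /eqP; rewrite eq_sym oner_eq0.
  have r0 : 0 < r.
    rewrite ltNge; apply/negP => r0; have := hr w.
    rewrite (_ : ball _ _ = set0) ?measure0.
      by case; move: hgamma => /andP[? ?] ?; lra.
    by apply/seteqP; split => // y; rewrite -ball_normE/= ltNge (le_trans r0).
  split => //.
  have pw := posterior w; have [mp _ _] := pw.
  have cN (y : borel H1) := @norm_sq ((y : H1) - AY w).
  have conc := gauss_seq_chebyshev pw cN cES sumS2 a0; rewrite errE in conc.
  apply: (quantile_close _ conc errg errg').
    exact: measurable_sum_sqr_limit mp cN.
  rewrite -(hr w); congr (Pi w _); apply/seteqP; split => y /=; rewrite -ball_normE/= distrC.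
    by rewrite ltr_pXn2r ?nnegrE// ltW.
  by rewrite -[in X in X -> _](ltr_pXn2r (n := 2)) ?nnegrE// ltW.
- move=> mu; have := sampling mu (posterior_mean_op K KT Lam n (K mu)).
  have -> : (fun j => x j / (1 + x j) * ip1 mu (e j) - ip1 (posterior_mean_op K KT Lam n (K mu)) (e j)) = (fun=> 0).
    apply/funext => j; rewrite (posterior_mean_coord hip1 hip2 hKT he hkappa n0 hLamcont hLam l0 hAT).
    by rewrite den /sn_ratio; field; rewrite -/(x j) !gt_eqF.
  move=> gs; rewrite -errE.
  exact: (gauss_seq_chebyshev gs (fun w => @norm_sq _) cET sumT2 a0).
Qed.

Let ballE mu s : [set w | ball (AY w) s mu] = [set w | (`|(AY w - posterior_mean_op K KT Lam n (K mu)) + mean_bias mu| < s)%R].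
Proof. by apply/seteqP; split => w /=; rewrite -ball_normE/= /mean_bias addrA subrK. Qed.

Let m_shift mu : measurable_fun setT (fun w => `|(AY w - posterior_mean_op K KT Lam n (K mu)) + mean_bias mu|).
Proof.
rewrite (_ : (fun w => _) = (fun w => `|AY w - mu|)); first exact: m_dist mu.
by apply/funext => w; rewrite /mean_bias addrA subrK.
Qed.

Lemma measurable_coverage mu s : measurable [set w | ball (AY w) s mu].
Proof. by rewrite ballE; exact: measurable_lt_level. Qed.

Lemma coverage_ge mu : `|mean_bias mu| ^+ 2 <= bias_const A L * R0 ->
  ((1 - err)%:E <= P mu [set w | ball (AY w) r mu])%E.
Proof.
have [ES [ET [h1 h2 h3 [h4 h5] h6]]] := radius_spec; rewrite ballE.
exact: (small_bias_covers L0 R00 h1 h2 h3 (m_dist _) (m_shift mu) (h6 mu) h4 h5).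
Qed.

Lemma coverage_le mu : 8 * A * R0 <= `|mean_bias mu| ^+ 2 ->
  (P mu [set w | ball (AY w) r mu] <= err%:E)%E.
Proof.
have [ES [ET [h1 h2 h3 [h4 h5] h6]]] := radius_spec; rewrite ballE.
exact: (large_bias_misses L0 R00 h1 h2 h3 (m_dist _) (m_shift mu) (h6 mu) h4 h5).
Qed.

Lemma confidence_radius_bounds mu : `|mean_bias mu| ^+ 2 <= bias_const A L * R0 ->
  L / (9 * A) <= `|rt mu / r| <= 4 * A / L.
Proof.
have [ES [ET [h1 h2 h3 [h4 h5] h6]]] := radius_spec.
have := hrt mu; rewrite ballE => hrt'.
exact: (confidence_radius_order L0 R00 h1 h2 h3 (m_dist _) (m_shift mu) (h6 mu) h4 h5 errg errg' hrt' err0).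
Qed.

Lemma bias_sqr_ub mu B : (forall k, \sum_(j < k) (ip1 mu (e j) / (1 + x j)) ^+ 2 <= B) ->
  `|mean_bias mu| ^+ 2 <= B.
Proof.
move=> h; have c := @norm_sq (mean_bias mu).
rewrite -(cvg_lim _ c)//; apply: limr_le; first by apply/cvg_ex; eexists; exact: c.
apply: nearW => k; apply: le_trans (h k); apply: ler_sum => j _.
by rewrite mean_bias_coord mulNr sqrrN.
Qed.

Lemma bias_sqr_lb mu k : \sum_(j < k) (ip1 mu (e j) / (1 + x j)) ^+ 2 <= `|mean_bias mu| ^+ 2.
Proof.
have c := @norm_sq (mean_bias mu).
rewrite -(cvg_lim _ c)//; apply: limr_ge; first by apply/cvg_ex; eexists; exact: c.
near=> m; have km : (k <= m)%N by near: m; exact: nbhs_infty_ge.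
rewrite (big_ord_widen m (fun j => (ip1 mu (e j) / (1 + x j)) ^+ 2) km) big_mkcond/=.
apply: ler_sum => j _; rewrite mean_bias_coord mulNr sqrrN.
by case: ifP => // _; exact: sqr_ge0.
Unshelve. all: end_near. Qed.

(** The mean of one coordinate of AY - t e_i is an affine function of t, and
the other coordinates have the same law for all t. *)
Lemma coverage_continuous i :
  continuous (fun t : R => fine (P (t *: e i) [set w | ball (AY w) r (t *: e i)])).
Proof.
have r0 : 0 < r by have [ES [ET [_ _ _ [? _] _]]] := radius_spec.
have v0 : 0 < mean_var n l kappa i.
  rewrite /mean_var divr_gt0 ?exprn_gt0// /sn_ratio !mulr_gt0 ?exprn_gt0// hl mulr_gt0 ?powR_gt0 ?exprn_gt0//.
(* a signal s b along e_i shifts the i-th mean by - s b / (1 + x i) = b *)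
pose s := - (1 + x i)%R.
have gs b : gauss_seq (P ((s * b) *: e i)) (fun j w => ip1 (AY w - (s * b) *: e i) (e j))
    (fun j => if (j == i)%N then b else 0) (mean_var n l kappa).
  have := sampling ((s * b) *: e i) ((s * b) *: e i); congr (gauss_seq _ _ _ _).
  apply/funext => j; rewrite ipZl (he.1 i j); case: (eqVneq j i) => [->|ji].
    by rewrite mulr1 /s; field; rewrite gt_eqF.
  by rewrite !mulr0 subrr.
have ct b w := @norm_sq (AY w - (s * b) *: e i).
have cF := @shift_continuous _ _ _ (fun b => P ((s * b) *: e i)) (fun b j w => ip1 (AY w - (s * b) *: e i) (e j))
  (fun b w => `|AY w - (s * b) *: e i| ^+ 2) _ _ v0 gs (@ct) (r ^+ 2).
have s0 : s != 0 by rewrite oppr_eq0 gt_eqF.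
rewrite (_ : (fun t => _) = (fun t : R => 1 - fine (P ((s * (s^-1 * t)) *: e i)
   [set w | (r ^+ 2 <= `|AY w - (s * (s^-1 * t)) *: e i| ^+ 2)%R]))); last first.
  apply/funext => t; rewrite mulrA divff// mul1r.
  have mN : measurable [set w | (r ^+ 2 <= `|AY w - t *: e i| ^+ 2)%R].
    rewrite -[X in measurable X]setTI; apply: measurable_fun_le => //.
    by apply: measurable_funX; exact: m_dist _.
  rewrite (_ : [set w | ball _ _ _] = ~` [set w | (r ^+ 2 <= `|AY w - t *: e i| ^+ 2)%R]).
    rewrite probability_setC// fineB ?fin_num_measure//.
  apply/seteqP; split => w /=; rewrite -ball_normE/=.
    by move=> h; apply/negP; rewrite -ltNge ltr_pXn2r ?nnegrE// ltW.
  by move=> /negP; rewrite -ltNge ltr_pXn2r ?nnegrE// ltW.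
move=> t; apply: cvgB; first exact: cvg_cst.
have cm : {for t, continuous (fun t : R => s^-1 * t)} by exact: mulrl_continuous.
exact: (cvg_comp _ _ cm (cF _)).
Qed.

(** Coverage is at least 1 - err at t = 0 and at most err at t = T; if [c] is below
the value at T, then both lie in [0, err] and T itself will do. *)
Lemma coverage_intermediate i (T c : R) : 0 <= T -> 0 <= c -> c <= 1 - err ->
  8 * A * R0 <= `|mean_bias (T *: e i)| ^+ 2 ->
  exists2 t, 0 <= t <= T &
    (`|P (t *: e i) [set w | ball (AY w) r (t *: e i)] - c%:E| <= err%:E)%E.
Proof.
move=> T0 c0 c1 hT.
pose g t := fine (P (t *: e i) [set w | ball (AY w) r (t *: e i)]).
have gE t : P (t *: e i) [set w | ball (AY w) r (t *: e i)] = (g t)%:E.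
  by rewrite fineK// fin_num_measure// ballE; apply: measurable_lt_level.
have gT : g T <= err by rewrite -lee_fin -gE; exact: coverage_le.
have g0 : 1 - err <= g 0.
  rewrite -lee_fin -gE; apply: coverage_ge.
  apply: le_trans (_ : 0 <= _); last by rewrite mulr_ge0// ltW.
  apply: bias_sqr_ub => k; rewrite big1// => j _.
  by rewrite ipZl !mul0r expr0n.
have [cg|cg] := leP c (g T).
  exists T; first by rewrite T0 lexx.
  rewrite gE -EFinB lee_fin ger0_norm; lra.
have gc : {within `[0, T], continuous g}.
  by apply: continuous_subspaceT => t; exact: coverage_continuous.
have [|t tT gt] := IVT T0 gc (v := c).
  rewrite ge_min le_max; apply/andP; split; apply/orP; [right; exact: ltW|left; lra].
exists t; first by move: tT; rewrite in_itv.
by rewrite gE gt subee// abse0 lee_fin.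
Qed.

End fixed_sample_size.

(** * Asymptotic coverage *)

Lemma cvge_dist {R : realType} (g : nat -> \bar R) (c : R) (u : nat -> R) :
  u @ \oo --> 0 -> (\forall n \near \oo, (`|g n - c%:E| <= (u n)%:E)%E) ->
  g @ \oo --> c%:E.
Proof.
move=> u0 gu; apply: (@squeeze_cvge _ _ _ _ (fun n => (c - u n)%:E) _ (fun n => (c + u n)%:E)).
- apply: filterS gu => n; case: (g n) => [x| |] //=; rewrite !lee_fin ler_distl.
  by [].
- apply: cvg_EFin; first exact: nearW.
  rewrite -[X in _ --> X]subr0; apply: cvgB => //; exact: cvg_cst.
- apply: cvg_EFin; first exact: nearW.
  rewrite -[X in _ --> X]addr0; apply: cvgD => //; exact: cvg_cst.
Qed.

Section coverage.
Context {R : realType} {H1 H2 : completeNormedModType R}.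
Context {ip1 : {dot H1 for idfun}} {ip2 : {dot H2 for idfun}}.
Hypotheses (hip1 : induces_norm ip1) (hip2 : induces_norm ip2).
Context {K : {linear H1 -> H2}} {KT : H2 -> H1}.
Hypothesis hKT : is_adjoint ip1 ip2 K KT.
Context {d : measure_display} {Omega : measurableType d}.
Context {Y : nat -> H2 -> Omega -> R} {P : nat -> H1 -> probability Omega R}.
Hypothesis hY : forall n mu, (0 < n)%N ->
     gaussian_process (P n mu) (Y n)
       (fun h => ip2 (K mu) h) (fun h h' => n%:R^-1 * ip2 h h').
Context {e : nat -> H1}.
Hypothesis he : orthonormal_basis ip1 e.
Context {kappa : nat -> R}.
Hypothesis hkappa_pos : forall i, 0 < kappa i.
Hypothesis hkappa : forall i, KT (K (e i)) = kappa i ^+ 2 *: e i.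
Context {Lam : nat -> {linear H1 -> H1}}.
Hypothesis hLamcont : forall n, (0 < n)%N -> continuous (Lam n).
Context {lambda : nat -> nat -> R}.
Hypothesis hLam : forall n i, (0 < n)%N -> Lam n (e i) = lambda n i *: e i.
Context {AT : nat -> H1 -> H2}.
Hypothesis hAT : forall n, (0 < n)%N ->
     is_adjoint ip2 ip1 (posterior_mean_op K KT (Lam n) n) (AT n).
Context {AY : nat -> Omega -> H1}.
Hypothesis hAY : forall n mu, (0 < n)%N ->
     represents (P n mu) ip1 (fun h => Y n (AT n h)) (AY n).
Context {Pi : nat -> Omega -> probability (borel H1) R}.
Hypothesis hPi : forall n w, (0 < n)%N ->
     gaussian_measure ip1 (Pi n w) (AY n w)
       (posterior_cov_op K KT (Lam n) n (AT n)).
Context {alpha p beta C gamma : R} {tau : nat -> R}.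
Hypotheses (halpha : 0 < alpha) (hp : 0 <= p) (hbeta : 0 < beta) (hC : 1 <= C).
Hypothesis hgamma : 0 < gamma < 1.
Hypothesis htau_pos : forall n, (0 < n)%N -> 0 < tau n.
Hypothesis htau : (fun n => n%:R * tau n ^+ 2) @ \oo --> +oo.
Hypothesis hlambda : forall n i, (0 < n)%N ->
     lambda n i = tau n ^+ 2 * i.+1%:R `^ (- 1 - 2 * alpha).
Hypothesis hkappa_bounds : forall i,
     C^-1 * i.+1%:R `^ (- p) <= kappa i <= C * i.+1%:R `^ (- p).
Context {r : nat -> R}.
Hypothesis hr : forall n w, (0 < n)%N ->
     Pi n w (ball (AY n w) (r n)) = (1 - gamma)%:E.
Context {rt : H1 -> nat -> R}.
Hypothesis hrt : forall mu0 n, (0 < n)%N ->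
     P n mu0 [set w | ball (AY n w) (rt mu0 n) mu0] = (1 - gamma)%:E.

Local Notation q := (smooth_exp alpha p).
Local Notation betat := (Num.min beta q).
Local Notation rate := (fun n : nat => n%:R `^ ((alpha - betat) / (1 + 2 * betat + 2 * p))).
Local Notation M := (fun n => eff_dim alpha p n (tau n)).
Local Notation R0 := (fun n => eff_size alpha p n (tau n)).
Local Notation A := (var_const alpha C).
Local Notation L := (low_const alpha p C).
Local Notation kap := (bias_const A L).
Local Notation err := (fun n => conc_const alpha p C / eff_dim alpha p n (tau n)).
Local Notation bias := (fun n mu => `|mean_bias K KT n (Lam n) mu| ^+ 2).
Local Notation coverage := (fun (n : nat) (mu0 : H1) =>
    P n mu0 [set w | ball (AY n w) (r n) mu0]).
Local Notation snorm := (sobolev_norm ip1 e beta).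
Local Notation dexp := (2 * (1 + 2 * betat + 2 * p) / q).
Local Notation rho := (fun n => (rate n / tau n) `^ dexp).
Local Notation snorm_bounded := (fun mu : nat -> H1 =>
    (ereal_sup (range (fun n => snorm (mu n))) < +oo)%E).

Let L0 : 0 < L. Proof. exact: low_const_gt0. Qed.
Let A0 : 0 < A.
Proof.
apply: ltr_wpDr; last by rewrite exprn_gt0// (lt_le_trans ltr01 hC).
by apply: divr_ge0; [exact: powR_ge0|rewrite mulr_ge0// ltW].
Qed.
Let kap0 : 0 < kap.
Proof.
apply: divr_gt0 => //; apply: mulr_gt0 => //; apply: addr_gt0 => //.
rewrite invr_gt0; apply: divr_gt0 => //; apply: mulr_gt0 => //; exact: addr_gt0.
Qed.
Let C40 : 0 < C ^+ 4. Proof. by rewrite exprn_gt0// (lt_le_trans ltr01 hC). Qed.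
Let q0 : 0 < q. Proof. by move: halpha hp => ? ?; rewrite /smooth_exp; lra. Qed.
Let bt0 : 0 < betat. Proof. by rewrite lt_min hbeta. Qed.
Let bt1 : betat <= beta. Proof. by rewrite ge_min lexx. Qed.
Let bt2 : betat <= q. Proof. by rewrite ge_min lexx orbT. Qed.
Let dexp0 : 0 < dexp.
Proof. by rewrite divr_gt0// mulr_gt0//; move: (hp) (bt0) => ? ?; lra. Qed.
Let rate0 n : (0 < n)%N -> 0 < rate n.
Proof. by move=> n0; rewrite powR_gt0// ltr0n. Qed.
Let R00 n : (0 < n)%N -> 0 < R0 n.
Proof.
by move=> n0; rewrite mulr_gt0 ?exprn_gt0 ?htau_pos// !powR_gt0// mulr_gt0 ?ltr0n ?exprn_gt0 ?htau_pos.
Qed.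

Let rhoE n : (0 < n)%N -> M n `^ (- 2 * betat) = R0 n * rho n.
Proof. by move=> n0; apply: eff_dim_rate => //; [exact: htau_pos|exact: ltW]. Qed.

Let ok n := [/\ (0 < n)%N, 1 <= M n, err n < gamma & err n < 1 - gamma].

Let err_cvg : err @ \oo --> 0.
Proof.
apply/cvgrPdist_le => eps e0; near=> n.
have c0 : 0 <= conc_const alpha p C.
  by rewrite /conc_const divr_ge0 ?sqr_ge0// mulr_ge0 ?(ltW A0)// mulr_ge0 ?sqr_ge0.
have M1 : 1 <= M n by near: n; exact: eff_dim_diverges.
have M2 : conc_const alpha p C / eps <= M n by near: n; exact: eff_dim_diverges.
have M0 : 0 < M n by exact: lt_le_trans M1.
rewrite /= in M0 M1 M2 *; have e1 : 0 <= conc_const alpha p C / eff_dim alpha p n (tau n).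
  by apply: divr_ge0 => //; exact: ltW.
rewrite sub0r normrN (ger0_norm e1) (ler_pdivrMr _ _ M0) mulrC.
by rewrite -(ler_pdivrMr _ _ e0).
Unshelve. all: end_near. Qed.

Let err_le eps : 0 < eps -> \forall n \near \oo, err n < eps.
Proof.
move=> e0; have /cvgrPdist_lt/(_ _ e0) := err_cvg; apply: filterS => n.
by rewrite sub0r normrN; apply: le_lt_trans; exact: ler_norm.
Qed.

Let near_ok : \forall n \near \oo, ok n.
Proof.
have /andP[g0 g1] := hgamma; near=> n; split; near: n.
- exact: nbhs_infty_gt.
- exact: eff_dim_diverges.
- exact: err_le.
- by apply: err_le; rewrite subr_gt0.
Unshelve. all: end_near. Qed.

Let cov_ge n mu : ok n -> bias n mu <= kap * R0 n -> ((1 - err n)%:E <= coverage n mu)%E.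
Proof.
move=> [n0 M1 e1 e2].
exact: (coverage_ge hip1 hip2 hKT n0 (fun mu => hY mu n0) he hkappa_pos hkappa (hLamcont n0)
  (fun i => hLam i n0) (hAT n0) (fun mu => hAY mu n0) (fun w => hPi w n0) halpha hp hC hgamma
  (htau_pos n0) (fun i => hlambda i n0) hkappa_bounds (fun w => hr w n0) M1 e1 e2).
Qed.

Let cov_le n mu : ok n -> 8 * A * R0 n <= bias n mu -> (coverage n mu <= (err n)%:E)%E.
Proof.
move=> [n0 M1 e1 e2].
exact: (coverage_le hip1 hip2 hKT n0 (fun mu => hY mu n0) he hkappa_pos hkappa (hLamcont n0)
  (fun i => hLam i n0) (hAT n0) (fun mu => hAY mu n0) (fun w => hPi w n0) halpha hp hC hgamma
  (htau_pos n0) (fun i => hlambda i n0) hkappa_bounds (fun w => hr w n0) M1 e1 e2).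
Qed.

Let rt_bounds n mu : ok n -> bias n mu <= kap * R0 n ->
  L / (9 * A) <= `|rt mu n / r n| <= 4 * A / L.
Proof.
move=> [n0 M1 e1 e2].
exact: (confidence_radius_bounds hip1 hip2 hKT n0 (fun mu => hY mu n0) he hkappa_pos hkappa (hLamcont n0)
  (fun i => hLam i n0) (hAT n0) (fun mu => hAY mu n0) (fun w => hPi w n0) halpha hp hC hgamma
  (htau_pos n0) (fun i => hlambda i n0) hkappa_bounds (fun w => hr w n0) (rt := fun mu => rt mu n) (fun mu => hrt mu n0) M1 e1 e2).
Qed.

Let cov_mid n i (T c : R) : ok n -> 0 <= T -> 0 <= c -> c <= 1 - err n ->
  8 * A * R0 n <= bias n (T *: e i) ->
  exists2 t, 0 <= t <= T & (`|coverage n (t *: e i) - c%:E| <= (err n)%:E)%E.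
Proof.
move=> [n0 M1 e1 e2].
exact: (coverage_intermediate hip1 hip2 hKT n0 (fun mu => hY mu n0) he hkappa_pos hkappa (hLamcont n0)
  (fun i => hLam i n0) (hAT n0) (fun mu => hAY mu n0) (fun w => hPi w n0) halpha hp hC hgamma
  (htau_pos n0) (fun i => hlambda i n0) hkappa_bounds (fun w => hr w n0) M1 e1 e2).
Qed.

Let bias_ub n mu B : (0 < n)%N ->
  (forall k, \sum_(j < k) (ip1 mu (e j) / (1 + sn_ratio n (lambda n) kappa j)) ^+ 2 <= B) ->
  bias n mu <= B.
Proof.
move=> n0.
exact: (bias_sqr_ub hip1 hip2 hKT n0 he hkappa_pos hkappa (hLamcont n0)
  (fun i => hLam i n0) (hAT n0) halpha hp hC (htau_pos n0) (fun i => hlambda i n0) hkappa_bounds).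
Qed.

Let bias_lb n mu k : (0 < n)%N ->
  \sum_(j < k) (ip1 mu (e j) / (1 + sn_ratio n (lambda n) kappa j)) ^+ 2 <= bias n mu.
Proof.
move=> n0.
exact: (bias_sqr_lb hip1 hip2 hKT n0 he hkappa_pos hkappa (hLamcont n0)
  (fun i => hLam i n0) (hAT n0) halpha hp hC (htau_pos n0) (fun i => hlambda i n0) hkappa_bounds).
Qed.

Let cov_measurable n mu : ok n -> measurable [set w | ball (AY n w) (r n) mu].
Proof.
move=> [n0 _ _ _].
exact: (measurable_coverage hip1 hip2 hKT n0 (fun mu => hY mu n0) he hkappa_pos hkappa (hLamcont n0)
  (fun i => hLam i n0) (hAT n0) (fun mu => hAY mu n0) halpha hp hC
  (htau_pos n0) (fun i => hlambda i n0) hkappa_bounds).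
Qed.

Let cov_dist n mu : ok n -> bias n mu <= kap * R0 n ->
  (`|coverage n mu - 1%:E| <= (err n)%:E)%E.
Proof.
move=> okn h; have := cov_ge okn h; have : (coverage n mu <= 1%:E)%E by exact: probability_le1 (cov_measurable mu okn).
have : (0 <= coverage n mu)%E by exact: measure_ge0.
rewrite /=; case: (P n mu _) => [y| |] //=; rewrite !lee_fin => y0 y1 ye.
by rewrite ler0_norm ?subr_le0//; move: ye; lra.
Qed.

Let sobolev_bias n mu B : (0 < n)%N -> 0 <= B -> (snorm mu <= B%:E)%E ->
  bias n mu <= C ^+ 4 * B ^+ 2 * (R0 n * rho n).
Proof.
move=> n0 B0 hmu; apply: bias_ub => // k; rewrite -rhoE//.
have hm := (@sobolev_norm_leP R H1 ip1 e beta mu B B0).1 hmu.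
exact: (sobolev_bias_sum (m := fun j => ip1 mu (e j)) halpha hp hC n0 (htau_pos n0) (fun i => hlambda i n0) hkappa_pos
  hkappa_bounds (ltW bt0) bt1 bt2 hm k).
Qed.

(** The bound [sobolev_bias] is uniform over the Sobolev ball and is o(R0). *)
Lemma oversmall_bias : much_smaller rate tau ->
  (forall eps : R, 0 < eps -> \forall n \near \oo,
           forall mu0, (snorm mu0 <= 1)%E -> (`|coverage n mu0 - 1| < eps%:E)%E) /\
  (exists c c' : R, 0 < c /\ \forall n \near \oo,
           forall mu0, (snorm mu0 <= 1)%E -> c <= `|rt mu0 n / r n| <= c').
Proof.
move=> hs; have k0 : 0 < kap / C ^+ 4 by rewrite divr_gt0.
have hrho := much_smaller_powR_le rate0 htau_pos dexp0 k0 hs.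
have small n mu : (0 < n)%N -> rho n <= kap / C ^+ 4 -> (snorm mu <= 1)%E ->
    bias n mu <= kap * R0 n.
  move=> n0 hn hmu; apply: le_trans (sobolev_bias n0 ler01 hmu) _.
  rewrite expr1n mulr1 mulrCA mulrC ler_wpM2r ?(ltW (R00 n0))//.
  by rewrite mulrC -ler_pdivlMr.
split.
  move=> eps e0; near=> n => mu hmu.
  have okn : ok n by near: n; exact: near_ok.
  have [n0 _ _ _] := okn.
  apply: le_lt_trans (cov_dist okn (small n mu n0 _ hmu)) _; first by near: n.
  by rewrite lte_fin; near: n; exact: err_le.
exists (L / (9 * A)), (4 * A / L); split; first by rewrite divr_gt0// mulr_gt0.
near=> n => mu hmu.
have okn : ok n by near: n; exact: near_ok.
have [n0 _ _ _] := okn.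
by apply: rt_bounds => //; apply: small => //; near: n.
Unshelve. all: end_near. Qed.

Lemma balanced_fixed : same_order tau rate -> beta < q ->
  forall mu0, (snorm mu0 < +oo)%E -> (fun n => coverage n mu0) @ \oo --> 1%E.
Proof.
move=> ho bq mu /sobolev_norm_lt_oo[B B0 /(@sobolev_norm_leP R H1 ip1 e beta mu B B0) hB].
have btE : betat = beta by rewrite min_l// ltW.
have [D D0 hD] := same_order_powR htau_pos rate0 dexp0 ho.
have t0 j : 0 <= ip1 mu (e j) ^+ 2 * j.+1%:R `^ (2 * beta).
  by rewrite mulr_ge0 ?sqr_ge0 ?powR_ge0.
(* head and tail each contribute at most eta, and C^4 D (2 eta) = kap *)
pose eta := kap / (2 * C ^+ 4 * D).
have eta0 : 0 < eta.
  by apply: divr_gt0 => //; apply: mulr_gt0 => //; exact: mulr_gt0.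
have [J hJ] := nneg_sum_tail t0 hB eta0.
pose s := 2 * (q - beta); have s0 : 0 < s by rewrite mulr_gt0// subr_gt0.
have B20 : 0 < B ^+ 2 + 1 by rewrite ltr_wpDl ?sqr_ge0.
pose z := eta / (B ^+ 2 + 1); have z0 : 0 < z by rewrite divr_gt0.
apply: (cvge_dist err_cvg); near=> n.
have okn : ok n by near: n; exact: near_ok.
have [n0 M1 _ _] := okn; have M0 : 0 < M n by exact: lt_le_trans M1.
apply: cov_dist => //.
apply: le_trans (bias_ub n0 (sobolev_bias_head_tail (m := fun j => ip1 mu (e j)) halpha hp hC n0 (htau_pos n0)
  (fun i => hlambda i n0) hkappa_pos hkappa_bounds (ltW hbeta) (ltW bq) hB hJ)) _.
have -> : M n `^ (- 2 * beta) = R0 n * rho n by rewrite -rhoE// btE.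
have hz : (J.+1%:R / M n) `^ s <= z.
  apply: powR_le_of => //; first by apply: divr_gt0 => //; exact: ltr0Sn.
  rewrite (ler_pdivrMr _ _ M0) mulrC -(ler_pdivrMr _ _ (powR_gt0 _ z0)).
  by near: n; exact: eff_dim_diverges.
have hz2 : B ^+ 2 * (J.+1%:R / M n) `^ s <= eta.
  apply: le_trans (_ : (B ^+ 2 + 1) * z <= _); last by rewrite /z mulrC divfK// gt_eqF.
  apply: ler_pM; rewrite ?sqr_ge0 ?powR_ge0//.
  by rewrite lerDl.
have hDn : rho n <= D by have /andP[] : D^-1 <= rho n <= D by near: n.
rewrite -/s [R0 n * rho n]mulrC mulrA mulrAC ler_wpM2r ?(ltW (R00 n0))//.
apply: le_trans (_ : C ^+ 4 * D * (2 * eta) <= _).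
  apply: ler_pM.
  - by rewrite mulr_ge0 ?powR_ge0// ltW.
  - by rewrite addr_ge0 ?(ltW eta0)// mulr_ge0 ?sqr_ge0 ?powR_ge0.
  - by rewrite ler_wpM2l// ltW.
  - by move: hz2; lra.
rewrite le_eqVlt /eta; apply/orP; left; apply/eqP; field.
by rewrite !gt_eqF// (lt_le_trans ltr01 hC).
Unshelve. all: end_near. Qed.

Let basis_sobolev i (t T : R) : 0 <= t <= T * i.+1%:R `^ (- beta) -> (snorm (t *: e i) <= T%:E)%E.
Proof.
move=> /andP[t0 tT]; have w0 : 0 < i.+1%:R `^ (- beta) :> R by exact: powR_gt0.
have T0 : 0 <= T by rewrite -(pmulr_lge0 _ w0) (le_trans t0).
apply/sobolev_norm_leP => // k.
have E : i.+1%:R `^ (- beta) ^+ 2 * i.+1%:R `^ (2 * beta) = 1 :> R.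
  by rewrite powR_sqr// -powR_add// mulrN addNr powRr0.
have tT2 : t ^+ 2 * i.+1%:R `^ (2 * beta) <= T ^+ 2.
  apply: le_trans (_ : (T * i.+1%:R `^ (- beta)) ^+ 2 * i.+1%:R `^ (2 * beta) <= _).
    by rewrite ler_wpM2r ?powR_ge0// lerXn2r ?nnegrE ?mulr_ge0 ?(ltW w0).
  by rewrite exprMn -mulrA E mulr1.
have [ik|ki] := ltnP i k.
  rewrite (bigD1 (Ordinal ik))//= big1 ?addr0.
    by rewrite ipZl (he.1 i i) eqxx mulr1.
  move=> j ji; rewrite ipZl (he.1 i j) (_ : (i == j) = false) ?mulr0 ?expr0n/= ?mul0r//.
  by apply/negbTE; apply: contra ji => /eqP ij; apply/eqP/val_inj.
rewrite big1 ?sqr_ge0// => j _; rewrite ipZl (he.1 i j) (_ : (i == j) = false) ?mulr0 ?expr0n/= ?mul0r//.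
by apply/negbTE; rewrite gtn_eqF// (leq_trans (ltn_ord j)).
Qed.

Let D := 1 + C ^+ 2 * 2 `^ q.
Let D0 : 0 < D. Proof. by rewrite ltr_wpDr// mulr_ge0 ?sqr_ge0 ?powR_ge0. Qed.

Let signal n (T : R) := let i := bias_idx alpha p n (tau n) beta in
  (T * i.+1%:R `^ (- beta)) *: e i.

Let signal_bias n T : ok n -> T ^+ 2 / D ^+ 2 * (R0 n * rho n) <= bias n (signal n T).
Proof.
move=> [n0 M1 _ _]; rewrite -rhoE// /signal; set i := bias_idx _ _ _ _ _.
apply: le_trans (basis_signal_bias halpha hp hC n0 (htau_pos n0)
  (fun i => hlambda i n0) hkappa_pos hkappa_bounds M1 T hbeta (erefl i)) _.
apply: le_trans (bias_lb _ i.+1 n0); rewrite big_ord_recr/= ipZl (he.1 i i) eqxx mulr1.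
by rewrite lerDr; apply: sumr_ge0 => j _; exact: sqr_ge0.
Qed.

Let bounded_signals (mu : nat -> H1) (T : R) : (forall n, (snorm (mu n) <= T%:E)%E) ->
  snorm_bounded mu.
Proof.
move=> h; apply: le_lt_trans (ltry T); apply: ge_ereal_sup => _ [n _ <-]; exact: h.
Qed.

(** Signals of size T have a bias that is too large, and smaller ones interpolate. *)
Lemma balanced_sequence : same_order tau rate -> forall c : R, 0 <= c < 1 ->
  exists2 mu : nat -> H1, snorm_bounded mu & (fun n => coverage n (mu n)) @ \oo --> c%:E.
Proof.
move=> ho c /andP[c0 c1]; have [B B0 hB] := same_order_powR htau_pos rate0 dexp0 ho.
(* the size at which the guaranteed squared bias reaches 8 A R0 when rho = 1 / B *)
pose T := Num.sqrt (8 * A * D ^+ 2 * B).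
have TE : T ^+ 2 = 8 * A * D ^+ 2 * B.
  by rewrite sqr_sqrtr// !mulr_ge0 ?sqr_ge0// ltW.
have T0 : 0 <= T by exact: sqrtr_ge0.
pose good n := [/\ ok n, B^-1 <= rho n & c <= 1 - err n].
have ex n : exists mu : H1, (snorm mu <= T%:E)%E /\
    (good n -> (`|coverage n mu - c%:E| <= (err n)%:E)%E).
  have [gn|ngn] := pselect (good n); last first.
    exists (0 *: e 0%N); split; last by move=> /ngn.
    by apply: basis_sobolev; rewrite lexx mulr_ge0 ?powR_ge0.
  have [okn hrho cerr] := gn; have [n0 _ _ _] := okn.
  have := signal_bias T okn; rewrite /signal; set i := bias_idx _ _ _ _ _ => hs.
  have hT : 8 * A * R0 n <= bias n ((T * i.+1%:R `^ (- beta)) *: e i).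
    apply: le_trans hs; rewrite TE [leRHS]mulrCA [leLHS]mulrC (ler_wpM2l (ltW (R00 n0)))//.
    apply: le_trans (_ : 8 * A * D ^+ 2 * B / D ^+ 2 * B^-1 <= _).
      by rewrite le_eqVlt; apply/orP; left; apply/eqP; field; rewrite !gt_eqF.
    by rewrite ler_wpM2l// divr_ge0 ?sqr_ge0// -TE sqr_ge0.
  have [t tT ht] := cov_mid okn (mulr_ge0 T0 (powR_ge0 _ _)) c0 cerr hT.
  by exists (t *: e i); split => //; exact: basis_sobolev.
have [mu hmu] := choice ex; exists mu; first by apply: (@bounded_signals _ T) => n; case: (hmu n).
apply: (cvge_dist err_cvg); near=> n; have [_] := hmu n; apply; split.
- by near: n; exact: near_ok.
- by have /andP[] : B^-1 <= rho n <= B by near: n.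
- have : err n < 1 - c by near: n; apply: err_le; rewrite subr_gt0.
  by move=> ?; lra.
Unshelve. all: end_near. Qed.

Let cov_to0 mu : (\forall n \near \oo, 8 * A * R0 n <= bias n (mu n)) ->
  (fun n => coverage n (mu n)) @ \oo --> 0%E.
Proof.
move=> h; apply: (cvge_dist err_cvg); near=> n; rewrite sube0 gee0_abs//.
by apply: cov_le; near: n; [exact: near_ok|].
Unshelve. all: end_near. Qed.

(** The bias of a single basis signal of norm 1 exceeds every multiple of R0. *)
Lemma undersmooth_sequence : much_smaller tau rate ->
  exists2 mu : nat -> H1, snorm_bounded mu & (fun n => coverage n (mu n)) @ \oo --> 0%E.
Proof.
move=> hs; have DA0 : 0 < 8 * A * D ^+ 2 by rewrite !mulr_gt0 ?exprn_gt0.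
have hrho := much_smaller_powR_ge htau_pos rate0 dexp0 DA0 hs.
exists (fun n => signal n 1).
  by apply: (@bounded_signals _ 1) => n; apply: basis_sobolev; rewrite lexx mulr_ge0 ?powR_ge0.
apply: cov_to0; near=> n.
have okn : ok n by near: n; exact: near_ok.
have [n0 _ _ _] := okn.
apply: le_trans (signal_bias 1 okn).
rewrite [leRHS]mulrCA [leLHS]mulrC (ler_wpM2l (ltW (R00 n0)))// expr1n mul1r [leRHS]mulrC ler_pdivlMr ?exprn_gt0//.
by near: n.
Unshelve. all: end_near. Qed.

(** A fixed truth has to be bad for every n at once, hence spreads over all
coordinates: a smoothness b strictly between beta and alpha keeps it in the
Sobolev space while its squared bias M^(-2 b) dominates R0 = M^(-2 alpha). *)
Lemma fixed_prior_cases : (forall n, (0 < n)%N -> tau n = 1) ->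
  [/\ alpha < beta -> much_smaller rate tau,
      alpha = beta -> beta < q /\ same_order tau rate
    & beta < alpha -> much_smaller tau rate /\
        (exists2 mu0 : H1, (snorm mu0 < +oo)%E & (fun n => coverage n mu0) @ \oo --> 0%E)].
Proof.
move=> t1; have d0 : 0 < 1 + 2 * betat + 2 * p by move: (hp) (bt0) => ? ?; lra.
have powN (a : R) : 0 < a -> (fun n => n%:R `^ (- a)) @ \oo --> (0 : R).
  move=> a0; apply/cvgrPdist_le => eps e0; near=> n.
  have n0 : 0 < n%:R :> R by rewrite ltr0n; near: n; exact: nbhs_infty_gt.
  rewrite sub0r normrN ger0_norm ?powR_ge0//.
  rewrite powRN -[leRHS]invrK lef_pV2 ?posrE ?invr_gt0 ?powR_gt0//.
  apply: powR_ge_of; rewrite ?invr_gt0//.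
  by near: n; exact: nbhs_infty_ger.
split.
- move=> ab; pose a := - ((alpha - betat) / (1 + 2 * betat + 2 * p)).
  have a0 : 0 < a.
    rewrite /a -mulNr divr_gt0// opprB subr_gt0 lt_min ab /smooth_exp/=.
    by move: halpha hp => ? ?; lra.
  apply: cvg_trans (powN a a0); apply: near_eq_cvg; near=> n.
  have n0 : (0 < n)%N by near: n; exact: nbhs_infty_gt.
  by rewrite t1// divr1 /a opprK.
- move=> ab; have bq : beta < q by rewrite /smooth_exp; move: halpha hp => ? ?; lra.
  have btE : betat = beta by rewrite min_l// ltW.
  split => //; exists 1, 1; split => //; near=> n.
  have n0 : (0 < n)%N by near: n; exact: nbhs_infty_gt.
  by rewrite btE ab subrr mul0r powRr0 t1// divr1 normr1 lexx.
- move=> ba; have bq : beta < q by rewrite /smooth_exp; move: halpha hp => ? ?; lra.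
  have btE : betat = beta by rewrite min_l// ltW.
  split.
    pose a := (alpha - betat) / (1 + 2 * betat + 2 * p).
    have a0 : 0 < a by rewrite divr_gt0// btE subr_gt0.
    apply: cvg_trans (powN a a0); apply: near_eq_cvg; near=> n.
    have n0 : (0 < n)%N by near: n; exact: nbhs_infty_gt.
    by rewrite t1// div1r powRN.
  pose b := (alpha + beta) / 2.
  have b0 : 0 < b by rewrite /b; move: halpha hbeta => ? ?; lra.
  have ab : 0 < alpha - beta by rewrite subr_gt0.
  have sq j : (j.+1%:R `^ (- 2^-1 - b)) ^+ 2 = j.+1%:R `^ (- 1 - 2 * b) :> R.
    by rewrite powR_sqr//; congr (_ `^ _); lra.
  have [|mu hmu] := basis_synthesis hip1 he (a := fun j => j.+1%:R `^ (- 2^-1 - b)).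
    have v0 j : 0 <= (j.+1%:R `^ (- 2^-1 - b)) ^+ 2 :> R by exact: sqr_ge0.
    have [|E [cE _ _]] := nneg_sum_limit v0 (B := 1 + (2 * b)^-1).
      move=> k; apply: le_trans (_ : \sum_(j < k) j.+1%:R `^ (- 1 - 2 * b) <= _).
        by apply: ler_sum => j _; rewrite sq.
      by apply: powR_sum_ub; rewrite mulr_gt0.
    by apply/cvg_ex; exists E.
  exists mu.
    pose B := 1 + (alpha - beta)^-1.
    have B1 : 1 <= B by rewrite lerDl invr_ge0 ltW.
    apply: le_lt_trans (ltry B); apply/sobolev_norm_leP; first by lra.
    move=> k; apply: le_trans (_ : B <= _); last by rewrite expr2; nra.
    apply: le_trans (powR_sum_ub k ab); apply: ler_sum => j _.
    rewrite hmu sq -powR_add// le_eqVlt; apply/orP; left; apply/eqP; congr (_ `^ _).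
    by rewrite /b; lra.
  apply: cov_to0; pose c := 2 `^ (- 2 - 2 * b) / (1 + C ^+ 2) ^+ 2.
  have c0 : 0 < c.
    by rewrite divr_gt0 ?powR_gt0// exprn_gt0// ltr_wpDr ?sqr_ge0.
  near=> n.
  have okn : ok n by near: n; exact: near_ok.
  have [n0 M1 _ _] := okn; have M0 : 0 < M n by exact: lt_le_trans M1.
  apply: le_trans (bias_lb mu (cutoff alpha p n (tau n)).*2 n0).
  have -> : \sum_(j < (cutoff alpha p n (tau n)).*2)
      (ip1 mu (e j) / (1 + sn_ratio n (lambda n) kappa j)) ^+ 2 =
      \sum_(j < (cutoff alpha p n (tau n)).*2)
      (j.+1%:R `^ (- 2^-1 - b) / (1 + sn_ratio n (lambda n) kappa j)) ^+ 2.
    by apply: eq_bigr => j _; rewrite hmu.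
  apply: le_trans (window_bias_sum halpha hp hC n0 (htau_pos n0)
    (fun i => hlambda i n0) hkappa_pos hkappa_bounds M1 b0).
  rewrite -/c /eff_size {1}t1// expr1n mul1r.
  rewrite (_ : - 2 * b = - 2 * alpha + (alpha - beta)); last by rewrite /b; lra.
  rewrite (powR_add _ _ M0) [leRHS]mulrCA [leLHS]mulrC ler_wpM2l ?powR_ge0// [leRHS]mulrC -ler_pdivrMr//.
  apply: powR_ge_of => //; first by apply: divr_gt0 => //; exact: mulr_gt0.
  by near: n; exact: eff_dim_diverges.
Unshelve. all: end_near. Qed.

End coverage.

Theorem theorem4p2 (R : realType)
  (* the Hilbert spaces *)
  (H1 H2 : completeNormedModType R)
  (ip1 : {dot H1 for idfun}) (ip2 : {dot H2 for idfun})
  (hip1 : induces_norm ip1) (hip2 : induces_norm ip2)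
  (hsep1 : separable H1) (hsep2 : separable H2)
  (* the forward operator and its adjoint *)
  (K : {linear H1 -> H2}) (KT : H2 -> H1)
  (hKcont : continuous K) (hKinj : injective K)
  (hKT : is_adjoint ip1 ip2 K KT)
  (* the model *)
  (d : measure_display) (Omega : measurableType d)
  (Y : nat -> H2 -> Omega -> R) (P : nat -> H1 -> probability Omega R)
  (hY : forall n mu, (0 < n)%N ->
     gaussian_process (P n mu) (Y n)
       (fun h => ip2 (K mu) h) (fun h h' => n%:R^-1 * ip2 h h'))
  (* the eigenstructure and the prior covariance operator *)
  (e : nat -> H1) (he : orthonormal_basis ip1 e)
  (kappa : nat -> R) (hkappa_pos : forall i, 0 < kappa i)
  (hkappa : forall i, KT (K (e i)) = kappa i ^+ 2 *: e i)
  (Lam : nat -> {linear H1 -> H1})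
  (hLamcont : forall n, (0 < n)%N -> continuous (Lam n))
  (lambda : nat -> nat -> R)
  (hLam : forall n i, (0 < n)%N -> Lam n (e i) = lambda n i *: e i)
  (prior : nat -> probability (borel H1) R)
  (hprior : forall n, (0 < n)%N -> gaussian_measure ip1 (prior n) 0 (Lam n))
  (* the posterior N(AY, S_n) *)
  (AT : nat -> H1 -> H2)
  (hAT : forall n, (0 < n)%N ->
     is_adjoint ip2 ip1 (posterior_mean_op K KT (Lam n) n) (AT n))
  (AY : nat -> Omega -> H1)
  (hAY : forall n mu, (0 < n)%N ->
     represents (P n mu) ip1 (fun h => Y n (AT n h)) (AY n))
  (Pi : nat -> Omega -> probability (borel H1) R)
  (hPi : forall n w, (0 < n)%N ->
     gaussian_measure ip1 (Pi n w) (AY n w)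
       (posterior_cov_op K KT (Lam n) n (AT n)))
  (* the parameters *)
  (alpha p beta C gamma : R) (tau : nat -> R)
  (halpha : 0 < alpha) (hp : 0 <= p) (hbeta : 0 < beta) (hC : 1 <= C)
  (hgamma : 0 < gamma < 1)
  (htau_pos : forall n, (0 < n)%N -> 0 < tau n)
  (htau : (fun n => n%:R * tau n ^+ 2) @ \oo --> +oo)
  (hlambda : forall n i, (0 < n)%N ->
     lambda n i = tau n ^+ 2 * i.+1%:R `^ (- 1 - 2 * alpha))
  (hkappa_bounds : forall i,
     C^-1 * i.+1%:R `^ (- p) <= kappa i <= C * i.+1%:R `^ (- p))
  (* the radii of the credible ball and of the exact confidence ball *)
  (r : nat -> R)
  (hr : forall n w, (0 < n)%N ->
     Pi n w (ball (AY n w) (r n)) = (1 - gamma)%:E)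
  (rt : H1 -> nat -> R)
  (hrt : forall mu0 n, (0 < n)%N ->
     P n mu0 [set w | ball (AY n w) (rt mu0 n) mu0] = (1 - gamma)%:E) :
  let betat := Num.min beta (1 + 2 * alpha + 2 * p) in
  let rate := fun n : nat =>
    n%:R `^ ((alpha - betat) / (1 + 2 * betat + 2 * p)) in
  let coverage := fun (n : nat) (mu0 : H1) =>
    P n mu0 [set w | ball (AY n w) (r n) mu0] in
  let snorm := sobolev_norm ip1 e beta in
  let snorm_bounded := fun mu : nat -> H1 =>
    (ereal_sup (range (fun n => snorm (mu n))) < +oo)%E in
  [/\ (* (i) *)
      much_smaller rate tau ->
        (forall eps : R, 0 < eps -> \forall n \near \oo,
           forall mu0, (snorm mu0 <= 1)%E ->
             (`|coverage n mu0 - 1| < eps%:E)%E) /\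
        (exists c c' : R, 0 < c /\ \forall n \near \oo,
           forall mu0, (snorm mu0 <= 1)%E -> c <= `|rt mu0 n / r n| <= c'),
      (* (ii) *)
      same_order tau rate ->
        (beta < 1 + 2 * alpha + 2 * p ->
           forall mu0, (snorm mu0 < +oo)%E ->
             (fun n => coverage n mu0) @ \oo --> 1%E) /\
        (forall c : R, 0 <= c < 1 ->
           exists2 mu : nat -> H1, snorm_bounded mu &
             (fun n => coverage n (mu n)) @ \oo --> c%:E),
      (* (iii) *)
      much_smaller tau rate ->
        exists2 mu : nat -> H1, snorm_bounded mu &
          (fun n => coverage n (mu n)) @ \oo --> 0%E
    & (* the fixed prior *)
      (forall n, (0 < n)%N -> tau n = 1) ->
        [/\ alpha < beta -> much_smaller rate tau,
            alpha = beta ->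
              beta < 1 + 2 * alpha + 2 * p /\ same_order tau rate
          & beta < alpha ->
              much_smaller tau rate /\
              (exists2 mu0 : H1, (snorm mu0 < +oo)%E &
                 (fun n => coverage n mu0) @ \oo --> 0%E)]].
Proof.
split.
- exact: (oversmall_bias hip1 hip2 hKT hY he hkappa_pos hkappa hLamcont hLam hAT hAY hPi
    halpha hp hbeta hC hgamma htau_pos htau hlambda hkappa_bounds hr hrt).
- move=> ho; split.
    exact: (balanced_fixed hip1 hip2 hKT hY he hkappa_pos hkappa hLamcont hLam hAT hAY hPi
      halpha hp hbeta hC hgamma htau_pos htau hlambda hkappa_bounds hr ho).
  exact: (balanced_sequence hip1 hip2 hKT hY he hkappa_pos hkappa hLamcont hLam hAT hAY hPi
    halpha hp hbeta hC hgamma htau_pos htau hlambda hkappa_bounds hr ho).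
- exact: (undersmooth_sequence hip1 hip2 hKT hY he hkappa_pos hkappa hLamcont hLam hAT hAY hPi
    halpha hp hbeta hC hgamma htau_pos htau hlambda hkappa_bounds hr).
- exact: (fixed_prior_cases hip1 hip2 hKT hY he hkappa_pos hkappa hLamcont hLam hAT hAY hPi
    halpha hp hbeta hC hgamma htau_pos htau hlambda hkappa_bounds hr).
Qed.
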